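(* For $s>1$, $0<\alpha<\frac{n}{s}$, and $1\le q<s$, the space $\dot{KV}_q$ is a Banach function space.
   Context: Here $n\ge1$ is an integer. The Riesz potential is $I_\alpha f(x)=\gamma(n,\alpha)\int_{\mathbb{R}^n}|x-y|^{\alpha-n}f(y)\,dy$, with $\gamma(n,\alpha)=\Gamma(\frac{n-\alpha}{2})/[\pi^{n/2}2^\alpha\Gamma(\frac{\alpha}{2})]$. The Riesz capacity of $E\subset\mathbb{R}^n$ is $\mathrm{cap}_{\alpha,s}(E)=\inf\{\|f\|_{L^s(\mathbb{R}^n)}^s: f\ge0,\ I_\alpha f\ge1\text{ on }E\}$. ''q.e.'' means except on a set of zero $\mathrm{cap}_{\alpha,s}$-capacity. $\|u\|_{L^q(\mathrm{cap}_{\alpha,s})}=(\int_0^\infty\mathrm{cap}_{\alpha,s}(\{|u|^q>t\})\,dt)^{1/q}$. A weight is a nonnegative locally integrable function on $\mathbb{R}^n$. $\dot{\widetilde{O}}^{\alpha,s}_q$ is the space of measurable functions $g$ with finite quasi-norm $\inf_w(\int_{\{g\ne0\}}|g|^sw^{q-s}\,dx)^{1/s}$, infimum over all q.e. defined weights $w$ with $\|w\|_{L^q(\mathrm{cap}_{\alpha,s})}\le1$. $\dot{KV}_q=\dot{KV}^{\alpha,s}_q$ is the set of Lebesgue measurable $f$ on $\mathbb{R}^n$ with $\|f\|_{\dot{KV}_q}=\inf\{(\int_{\mathbb{R}^n}h^s(I_\alpha h)^{q-s}\,dx)^{1/q}:h\in\dot{\widetilde{O}}^{\alpha,s}_q,\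 h\ge|f|\text{ a.e.}\}<\infty$ (with $\inf\emptyset=+\infty$, and the integrand taken to be $0$ where $h=0$). A Banach function space $X$ on $\mathbb{R}^n$ is the set of Lebesgue measurable $f$ with $\|f\|_X:=\rho(|f|)<\infty$, where $\rho$ assigns to each nonnegative measurable function a value in $[0,\infty]$ and satisfies: (P1) $\rho(f)=0$ iff $f=0$ a.e., $\rho(f_1+f_2)\le\rho(f_1)+\rho(f_2)$, $\rho(\lambda f)=\lambda\rho(f)$ for constants $\lambda\ge0$; (P2) if $0\le f_j\uparrow f$ a.e. then $\rho(f_j)\uparrow\rho(f)$; (P3) $\rho(\chi_E)<\infty$ for every bounded measurable $E$; (P4) for every bounded measurable $E$ there is a finite $A_E\ge0$ with $\int_Ef\,dx\le A_E\rho(f)$ for all nonnegative measurable $f$. Here $\rho(f)=\|f\|_{\dot{KV}_q}$. *)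

(* Defs.v *)
From HB Require Import structures.
From mathcomp Require Import all_boot all_order all_algebra.
From mathcomp Require Import all_classical all_reals all_analysis.
From mathcomp Require Import measurable_realfun.

Set Implicit Arguments.
Unset Strict Implicit.
Unset Printing Implicit Defensive.

Import Order.TTheory GRing.Theory Num.Theory.
Import numFieldNormedType.Exports.

Local Open Scope classical_set_scope.
Local Open Scope ring_scope.
Local Open Scope ereal_scope.

Section tuple_lebesgue.
Context {R : realType}.
Local Notation T := (measurableTypeR R).

Definition tcons n (p : T * n.-tuple T) : n.+1.-tuple T := [tuple of p.1 :: p.2].
Definition tuncons n (x : n.+1.-tuple T) : T * n.-tuple T :=
  (tnth x ord0, [tuple of behead x]).

Lemma measurable_tcons n : measurable_fun [set: T * n.-tuple T] (@tcons n).
Proof. exact: measurable_cons. Qed.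

Lemma measurable_tuncons n :
  measurable_fun [set: n.+1.-tuple T] (@tuncons n).
Proof.
by apply/measurable_fun_pair; [exact: measurable_tnth|exact: measurable_behead].
Qed.

Lemma tconsK n : cancel (@tcons n) (@tuncons n).
Proof. by case=> a t; congr pair; apply: val_inj. Qed.

Section step.
Variables (n : nat) (m : {sigma_finite_measure set (n.-tuple T) -> \bar R}).

Definition lebesgue_cons : set (n.+1.-tuple T) -> \bar R :=
  pushforward (@lebesgue_measure R \x m) (@tcons n).

HB.instance Definition _ :=
  isMeasurableFun.Build _ _ _ _ (@tcons n) (@measurable_tcons n).

Let lebesgue_cons0 : lebesgue_cons set0 = 0.
Proof. exact: measure0. Qed.

Let lebesgue_cons_ge0 A : 0 <= lebesgue_cons A.
Proof. exact: measure_ge0. Qed.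

Let lebesgue_cons_sigma_additive : semi_sigma_additive lebesgue_cons.
Proof. exact: measure_semi_sigma_additive. Qed.

HB.instance Definition _ := isMeasure.Build _ _ _ lebesgue_cons
  lebesgue_cons0 lebesgue_cons_ge0 lebesgue_cons_sigma_additive.

Let lebesgue_cons_sigma_finite : sigma_finite setT lebesgue_cons.
Proof.
have /sigma_finiteP[F [TF ndF Foo]] := sigma_finiteT (@lebesgue_measure R).
have /sigma_finiteP[G [TG ndG Goo]] := sigma_finiteT m.
exists (fun k => @tuncons n @^-1` (F k `*` G k)).
  apply/esym/seteqP; split=> // x _; rewrite -preimage_bigcup /=.
  have [i _ Fi] : (\bigcup_k F k) (tuncons x).1 by rewrite -TF.
  have [j _ Gj] : (\bigcup_k G k) (tuncons x).2 by rewrite -TG.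
  exists (maxn i j) => //; split.
    by move: Fi; exact/subsetPset/ndF/leq_maxl.
  by move: Gj; exact/subsetPset/ndG/leq_maxr.
move=> k; have [mF Fk] := Foo k; have [mG Gk] := Goo k.
have mFG : measurable (F k `*` G k) by exact: measurableX.
split; first by rewrite -[X in measurable X]setTI; exact: measurable_tuncons.
rewrite /lebesgue_cons /pushforward -comp_preimage.
rewrite (_ : _ \o _ = id) ?preimage_id; last exact/funext/tconsK.
by rewrite product_measure1E// lte_mul_pinfty// ge0_fin_numE.
Qed.

HB.instance Definition _ := Measure_isSigmaFinite.Build _ _ _ lebesgue_cons
  lebesgue_cons_sigma_finite.

End step.

(* Borel Lebesgue measure on R^n, as the n-fold product of the one on R. *)
Fixpoint lebesgue_tuple n : {sigma_finite_measure set (n.-tuple T) -> \bar R} :=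
  if n is n'.+1 then lebesgue_cons (lebesgue_tuple n') else \d_[tuple].

End tuple_lebesgue.

(* [euclid R n] is n.-tuple R with the Lebesgue sigma-algebra, i.e. the sets
   that are Caratheodory-measurable for Lebesgue outer measure, and
   [leb R n] is the (complete) Lebesgue measure on it. *)
Definition euclid (R : realType) (n : nat) : measurableType _ :=
  caratheodory_type (@lebesgue_tuple R n)^*%mu.

Definition leb (R : realType) (n : nat) : {measure set (euclid R n) -> \bar R} :=
  @completed_measure_extension _ _ _ (@lebesgue_tuple R n).

(* Real powers of elements of [0, +oo], with 0 ^ r = +oo and (+oo) ^ r = 0 for
   r < 0; the library's [poweR] yields 0 and +oo there instead. *)
Definition epow {R : realType} (x : \bar R) (r : R) : \bar R :=
  if (0 <= r)%R then x `^ r else (x `^ (- r))^-1.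

(* Euler's integral, meant for z > 0 only. *)
Definition Gamma {R : realType} (z : R) : R :=
  (\int[lebesgue_measure]_(t in `]0, +oo[) (t `^ (z - 1) * expR (- t)))%R.

Section euclid_basics.
Context {R : realType} {n : nat}.
Local Notation E := (euclid R n).

Definition edist (x y : E) : R :=
  Num.sqrt (\sum_(i < n) ((tnth x i : R) - (tnth y i : R)) ^+ 2)%R.

Definition enorm (x : E) : R := Num.sqrt (\sum_(i < n) (tnth x i : R) ^+ 2)%R.

Definition ebounded (A : set E) := exists r : R, forall x, A x -> (enorm x <= r)%R.

Definition loc_integrable (w : E -> \bar R) :=
  measurable_fun [set: E] w /\
  forall A : set E, measurable A -> ebounded A -> (leb R n).-integrable A w.

(* Functions on R^n are extended-real-valued throughout. *)
Definition nonneg_measurable (f : E -> \bar R) :=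
  measurable_fun [set: E] f /\ forall x, 0 <= f x.

End euclid_basics.

Section riesz.
Context {R : realType} {n : nat} (alpha s : R).
Local Notation E := (euclid R n).
Local Notation mu := (leb R n).

Definition riesz_const : R :=
  (Gamma ((n%:R - alpha) / 2) /
   (pi `^ (n%:R / 2) * 2 `^ alpha * Gamma (alpha / 2)))%R.

Definition riesz_potential (f : E -> \bar R) (x : E) : \bar R :=
  riesz_const%:E *
  \int[mu]_y (epow (edist x y)%:E (alpha - n%:R) * f y).

Definition riesz_cap (A : set E) : \bar R :=
  ereal_inf [set 'N[mu]_s%:E[f] `^ s | f in
    [set f : E -> \bar R | nonneg_measurable f /\
       forall x, A x -> 1 <= riesz_potential f x]].

Definition quasi_everywhere (P : E -> Prop) := riesz_cap [set x | ~ P x] = 0.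

Definition Lcap_norm (q : R) (u : E -> \bar R) : \bar R :=
  (\int[lebesgue_measure]_(t in `]0%R, +oo[)
     riesz_cap [set x | t%:E < `|u x| `^ q]) `^ q^-1.

(* A q.e. defined weight is represented by an arbitrary extension of it to the
   exceptional set (which is null both for capacity and for Lebesgue measure);
   this is why nonnegativity is only required q.e. *)
Definition qe_weight (w : E -> \bar R) :=
  quasi_everywhere (fun x => 0 <= w x) /\ loc_integrable w.

Definition O_norm (q : R) (g : E -> \bar R) : \bar R :=
  ereal_inf [set (\int[mu]_(x in [set x | g x != 0])
                   (epow `|g x| s * epow (w x) (q - s))) `^ s^-1 | w in
    [set w : E -> \bar R | qe_weight w /\ Lcap_norm q w <= 1]].

Definition O_space (q : R) : set (E -> \bar R) :=
  [set g | measurable_fun [set: E] g /\ O_norm q g < +oo].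

Definition KV_norm (q : R) (f : E -> \bar R) : \bar R :=
  ereal_inf [set (\int[mu]_x
                   (if h x == 0 then 0
                    else epow (h x) s * epow (riesz_potential h x) (q - s)))
                 `^ q^-1 | h in
    [set h | O_space q h /\ \forall x \ae mu, `|f x| <= h x]].

Definition KV_space (q : R) : set (E -> \bar R) :=
  [set f | measurable_fun [set: E] f /\ KV_norm q f < +oo].

End riesz.

Section banach_function_space.
Context {R : realType} {n : nat}.
Local Notation E := (euclid R n).
Local Notation mu := (leb R n).

Record banach_function_norm (rho : (E -> \bar R) -> \bar R) : Prop := {
  bfn_ge0 : forall f, nonneg_measurable f -> 0 <= rho f ;
  bfn_eq0 : forall f, nonneg_measurable f ->
    rho f = 0 <-> \forall x \ae mu, f x = 0 ;
  bfn_triangle : forall f1 f2,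
    nonneg_measurable f1 -> nonneg_measurable f2 ->
    rho (fun x => f1 x + f2 x) <= rho f1 + rho f2 ;
  bfn_scale : forall f (lambda : R), nonneg_measurable f -> (0 <= lambda)%R ->
    rho (fun x => lambda%:E * f x) = lambda%:E * rho f ;
  bfn_fatou : forall (f_ : nat -> E -> \bar R) f,
    (forall j, nonneg_measurable (f_ j)) -> nonneg_measurable f ->
    (\forall x \ae mu, nondecreasing_seq (f_ ^~ x) /\
                       f_ ^~ x @ \oo --> f x) ->
    nondecreasing_seq (rho \o f_) /\ rho \o f_ @ \oo --> rho f ;
  bfn_indic : forall A : set E, measurable A -> ebounded A ->
    rho (fun x => (\1_A x)%:E) < +oo ;
  bfn_integral : forall A : set E, measurable A -> ebounded A ->
    exists C : R, (0 <= C)%R /\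
      forall f, nonneg_measurable f -> \int[mu]_(x in A) f x <= C%:E * rho f
}.

(* [X], normed by [nrm], is the Banach function space of [rho]. *)
Definition banach_function_space (X : set (E -> \bar R))
    (nrm rho : (E -> \bar R) -> \bar R) : Prop :=
  [/\ banach_function_norm rho,
      X = [set f | measurable_fun [set: E] f /\ rho (fun x => `|f x|) < +oo] &
      forall f, measurable_fun [set: E] f -> nrm f = rho (fun x => `|f x|)].

End banach_function_space.

(* Main.v *)
(* The potential estimates hold in any Ahlfors regular space and use neither a
   maximal function nor duality.  Write P for the Riesz potential without its
   constant, v(x) = (1 + |x|)^(alpha - n), V(h) for the integral of v h, and
   Phi(h) for the integral of h^s (P h)^(q - s).

   Admissible majorants are exactly the h >= 0 with V(h) finite, up to infinite
   Phi: if h has finite O-norm, the trace inequality (capacity dominates the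
   measure v^s' dx, s' = s / (s - 1)) and Hoelder bound V(h).  Conversely a
   multiple of P h is an admissible weight, by the capacitary strong-type
   inequality int_0^oo cap(P h > t^(1/q)) dt <= C Phi(h).  At the level t the
   test function for the capacity is obtained from h by averaging it over balls
   whose radius is that at which the truncated potential drops to t.

   Since (x, y) |-> x^s y^(q - s), composed with the linear P, has a convex q-th
   root, Phi^(1/q) is subadditive.  For the Fatou property, minimise the strictly
   convex functional int e^(-g) dnu over the nested convex sets of majorants of
   f_j with bounded energy: almost minimisers converge almost everywhere.
   Bounded energy makes them uniformly integrable, so their potentials converge
   along a subsequence, and Fatou's lemma bounds the energy of the limit. *)

Require Import Defs.
From HB Require Import structures.
From mathcomp Require Import all_boot all_order all_algebra.
From mathcomp Require Import all_classical all_reals all_analysis.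
From mathcomp Require Import measurable_realfun.
From mathcomp Require Import ring lra.

Set Implicit Arguments.
Unset Strict Implicit.
Unset Printing Implicit Defensive.

Import Order.TTheory GRing.Theory Num.Theory.
Import numFieldNormedType.Exports.

Local Open Scope classical_set_scope.
Local Open Scope ring_scope.
Local Open Scope ereal_scope.

(** * Integration of nonnegative functions *)

(** The exponent [q - s] is negative, so the energy density decreases where the potential grows, and
    the energy is not monotone in [h]. Near-optimal majorants of an increasing sequence therefore
    need not be ordered, and passing to a limit calls for an upper bound on the potentials, not only
    the lower one that Fatou's lemma would give. With [N = n] and [kap = n - alpha], the condition
    [alpha < n / s] reads [(N - kap) s < N]; it enters as integrability of [wt kap] to the power
    [s'] and as boundedness of one more potential in the trace inequality. What stands in for a
    maximal function is an exponent [p > 1] with [kap p < N]. The kernel to the power [p] is still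
    locally integrable, so the average of the [p]-th power of a potential over a ball is bounded by
    the [p]-th power of the potential truncated at its radius. This reverse Hölder property controls
    the swept function, and the surplus [p - 1] makes the sum over dyadic levels geometric in the
    range where [q < s] alone does not. *)

Section nonneg_integrals.
Context d (T : measurableType d) (R : realType).
Variable mu : {measure set T -> \bar R}.
Implicit Types f g : T -> \bar R.

Lemma le_integralT f g : (forall x, 0 <= f x) ->
  measurable_fun setT f -> measurable_fun setT g -> (forall x, f x <= g x) ->
  \int[mu]_x f x <= \int[mu]_x g x.
Proof. by move=> *; apply: ge0_le_integral. Qed.

Lemma le_ae_integralT f g : (forall x, 0 <= f x) -> (forall x, 0 <= g x) ->
  measurable_fun setT f -> measurable_fun setT g ->
  (\forall x \ae mu, f x <= g x) ->
  \int[mu]_x f x <= \int[mu]_x g x.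
Proof.
move=> f0 g0 mf mg fg; apply: ae_ge0_le_integral => //.
by apply: filterS fg => x + _.
Qed.

Lemma eq_ae_integralT f g : (forall x, 0 <= f x) -> (forall x, 0 <= g x) ->
  measurable_fun setT f -> measurable_fun setT g ->
  (\forall x \ae mu, f x = g x) ->
  \int[mu]_x f x = \int[mu]_x g x.
Proof.
move=> f0 g0 mf mg fg; apply: ge0_ae_eq_integral => //.
by apply: filterS fg => x + _.
Qed.

Lemma ae_fin_integral f : (forall x, 0 <= f x) -> measurable_fun setT f ->
  \int[mu]_x f x < +oo -> \forall x \ae mu, f x < +oo.
Proof.
move=> f0 mf foo.
have fi : mu.-integrable setT f.
  by apply/integrableP; split => //; under eq_integral do rewrite gee0_abs//.
have := integrable_ae measurableT fi.
by apply: filterS => x /(_ I); rewrite ge0_fin_numE.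
Qed.

Lemma ae_eq0_integral f : (forall x, 0 <= f x) -> measurable_fun setT f ->
  \int[mu]_x f x = 0 -> \forall x \ae mu, f x = 0.
Proof.
move=> f0 mf foo.
have : \int[mu]_x `|f x| = 0 by under eq_integral do rewrite gee0_abs//.
move=> /(ae_eq_integral_abs mu measurableT mf).
by apply: filterS => x /(_ I).
Qed.

Lemma eq0_integral f : (forall x, 0 <= f x) -> measurable_fun setT f ->
  (\forall x \ae mu, f x = 0) -> \int[mu]_x f x = 0.
Proof.
move=> f0 mf fE; rewrite (@eq_ae_integralT f (cst 0))//; first exact: integral0.
Qed.

Lemma measurable_poweRe f p : measurable_fun setT f ->
  measurable_fun setT (fun x => f x `^ p).
Proof. by move=> mf; exact: measurableT_comp (measurable_poweR _) mf. Qed.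

Lemma le_poweR (p : R) (a b : \bar R) : (0 <= p)%R -> 0 <= a -> a <= b ->
  a `^ p <= b `^ p.
Proof.
move=> p0 a0 ab; apply: gt0_ler_poweR => //; rewrite in_itv/= leey andbT//.
exact: le_trans ab.
Qed.

(** If one of the two integrals is infinite, either the other factor vanishes almost everywhere, and
    with it the product, or the right-hand side is infinite. Otherwise both functions are finite
    almost everywhere and may be replaced by their real parts. *)
Lemma hoelder_ereal f g (p q : R) :
  (forall x, 0 <= f x) -> (forall x, 0 <= g x) ->
  measurable_fun setT f -> measurable_fun setT g ->
  (0 < p)%R -> (0 < q)%R -> (p^-1 + q^-1 = 1)%R ->
  \int[mu]_x (f x * g x) <=
  (\int[mu]_x f x `^ p) `^ p^-1 * (\int[mu]_x g x `^ q) `^ q^-1.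
Proof.
have step f' g' (p' q' : R) : (forall x, 0 <= f' x) -> (forall x, 0 <= g' x) ->
    measurable_fun setT f' -> measurable_fun setT g' ->
    (0 < p')%R -> (0 < q')%R -> \int[mu]_x f' x `^ p' = +oo ->
    \int[mu]_x (f' x * g' x) <=
    (\int[mu]_x f' x `^ p') `^ p'^-1 * (\int[mu]_x g' x `^ q') `^ q'^-1.
  move=> f0 g0 mf mg p0 q0 ->.
  rewrite poweRyr ?gt_eqF ?invr_gt0//.
  have [g00|gn0] := eqVneq (\int[mu]_x g' x `^ q') 0; last first.
    rewrite gt0_mulye ?leey// poweR_gt0// lt0e gn0/=.
    by apply: integral_ge0 => x _; exact: poweR_ge0.
  rewrite eq0_integral ?mule_ge0 ?poweR_ge0//.
  - by move=> x; rewrite mule_ge0.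
  - exact: emeasurable_funM.
  - have := ae_eq0_integral (fun x => poweR_ge0 (g' x) q')
      (measurable_poweRe q' mg) g00.
    by apply: filterS => x /(poweR_eq0_eq0 (g0 x)) ->; rewrite mule0.
move=> f0 g0 mf mg p0 q0 pq.
have [|foo] := eqVneq (\int[mu]_x f x `^ p) +oo; first exact: step.
have [goo|goo] := eqVneq (\int[mu]_x g x `^ q) +oo.
  by rewrite muleC; under eq_integral do rewrite muleC; exact: step.
have ae_fin h r : (forall x, 0 <= h x) -> measurable_fun setT h -> (0 < r)%R ->
    \int[mu]_x h x `^ r != +oo -> \forall x \ae mu, h x = (fine (h x))%:E.
  move=> h0 mh r0 hoo.
  have := ae_fin_integral (fun x => poweR_ge0 (h x) r) (measurable_poweRe r mh).
  rewrite ltey => /(_ hoo); apply: filterS => x /lty_poweRy.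
  by move=> /(_ (lt0r_neq0 r0)) hx; rewrite fineK// ge0_fin_numE.
have aef := ae_fin _ _ f0 mf p0 foo.
have aeg := ae_fin _ _ g0 mg q0 goo.
have mff : measurable_fun setT (fine \o f) by exact: measurableT_comp.
have mfg : measurable_fun setT (fine \o g) by exact: measurableT_comp.
have := hoelder mu mff mfg p0 q0 pq.
have NE h r : (forall x, 0 <= h x) -> measurable_fun setT h -> (0 < r)%R ->
    (\forall x \ae mu, h x = (fine (h x))%:E) ->
    'N[mu]_r%:E[EFin \o (fine \o h)] = (\int[mu]_x h x `^ r) `^ r^-1.
  move=> h0 mh r0 aeh; rewrite unlock; congr (_ `^ _).
  apply: eq_ae_integralT => [x|x|||]; rewrite ?poweR_ge0//.
  - apply: measurable_poweRe; apply: measurableT_comp => //.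
    by apply/measurable_EFinP; exact: measurableT_comp.
  - exact: measurable_poweRe.
  by apply: filterS aeh => x hx; rewrite /= [in RHS]hx ger0_norm// fine_ge0.
rewrite !NE//; apply: le_trans.
rewrite Lnorm1; apply: le_ae_integralT => [x|x|||]; rewrite ?mule_ge0//.
- exact: emeasurable_funM.
- do 2 apply: measurableT_comp => //.
  exact: measurable_funM.
- by apply: filterS2 aef aeg => x fx gx; rewrite [in leLHS]fx [in leLHS]gx lee_abs.
Qed.

Lemma ae_cvg0_of_series (f_ : nat -> T -> \bar R) :
  (forall k x, 0 <= f_ k x) -> (forall k, measurable_fun setT (f_ k)) ->
  \sum_(k <oo) \int[mu]_x f_ k x < +oo ->
  \forall x \ae mu, \sum_(k <oo) f_ k x < +oo.
Proof.
move=> f0 mf; rewrite -integral_nneseries// => foo.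
apply: ae_fin_integral foo => [x|]; first exact: nneseries_ge0.
exact: ge0_emeasurable_sum.
Qed.

End nonneg_integrals.

Section tonelli.
Context d1 d2 (T1 : measurableType d1) (T2 : measurableType d2) (R : realType).
Variables (m1 : {sigma_finite_measure set T1 -> \bar R})
  (m2 : {sigma_finite_measure set T2 -> \bar R}).
Variable F : T1 -> T2 -> \bar R.
Hypotheses (F0 : forall x y, 0 <= F x y)
  (mF : measurable_fun setT (fun z => F z.1 z.2)).

Lemma tonelli : \int[m1]_x \int[m2]_y F x y = \int[m2]_y \int[m1]_x F x y.
Proof. exact: (@fubini_tonelli _ _ _ _ _ m1 m2 (fun z => F z.1 z.2)). Qed.

Lemma measurable_integral_snd : measurable_fun setT (fun x => \int[m2]_y F x y).
Proof. exact: (@measurable_fun_fubini_tonelli_F _ _ _ _ _ m2 (fun z => F z.1 z.2)). Qed.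

Lemma measurable_integral_fst : measurable_fun setT (fun y => \int[m1]_x F x y).
Proof. exact: (@measurable_fun_fubini_tonelli_G _ _ _ _ _ m1 (fun z => F z.1 z.2)). Qed.

End tonelli.

Lemma measurable_section d1 d2 d3 (T1 : measurableType d1)
    (T2 : measurableType d2) (T3 : measurableType d3) (G : T1 * T2 -> T3) x :
  measurable_fun setT G -> measurable_fun setT (fun y => G (x, y)).
Proof. by move=> mG; exact: (measurableT_comp mG (measurable_pair1 x)). Qed.

Lemma measurable_section_fst d1 d2 d3 (T1 : measurableType d1)
    (T2 : measurableType d2) (T3 : measurableType d3) (G : T1 * T2 -> T3) y :
  measurable_fun setT G -> measurable_fun setT (fun x => G (x, y)).
Proof. by move=> mG; exact: (measurableT_comp mG (measurable_pair2 y)). Qed.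

Lemma measurable_fst_comp d1 d2 d3 (T1 : measurableType d1)
    (T2 : measurableType d2) (T3 : measurableType d3) (f : T1 -> T3) :
  measurable_fun setT f -> measurable_fun setT (fun z : T1 * T2 => f z.1).
Proof. by move=> mf; exact: measurableT_comp mf measurable_fst. Qed.

Lemma measurable_snd_comp d1 d2 d3 (T1 : measurableType d1)
    (T2 : measurableType d2) (T3 : measurableType d3) (f : T2 -> T3) :
  measurable_fun setT f -> measurable_fun setT (fun z : T1 * T2 => f z.2).
Proof. by move=> mf; exact: measurableT_comp mf measurable_snd. Qed.

Lemma measurable_EFin_powR d (T : measurableType d) (R : realType)
    (f : T -> R) (p : R) :
  measurable_fun setT f -> measurable_fun setT (fun x => (f x `^ p)%:E).
Proof.
by move=> mf; apply/measurable_EFinP; exact: measurableT_comp (measurable_powR p) mf.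
Qed.

Lemma poweRD_pos (R : realType) (x : \bar R) (a b : R) :
  (0 < a)%R -> (0 < b)%R -> x `^ a * x `^ b = x `^ (a + b).
Proof.
move=> a0 b0; rewrite poweRD//; apply: add_neq0_poweRD_def.
by rewrite gt_eqF// addr_gt0.
Qed.

Lemma poweR_invK (R : realType) (x : \bar R) (p : R) : (0 < p)%R -> 0 <= x ->
  (x `^ p^-1) `^ p = x.
Proof. by move=> p0 x0; rewrite -poweRrM mulVf ?gt_eqF// poweRe1. Qed.

(** * Jensen's and Minkowski's inequalities for kernels *)

Section kernel_power.
Context d (T : measurableType d) (R : realType).
Variable mu : {sigma_finite_measure set T -> \bar R}.

(** This is Jensen's inequality for [K / k] and the unnormalised measure [k h dz], derived from
    Hölder's inequality with exponents [p] and [p / (p - 1)]. *)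
Lemma kernel_jensen (p : R) (K h : T -> \bar R) (k : T -> R) : (1 < p)%R ->
  (forall z, 0 <= K z) -> measurable_fun setT K ->
  (forall z, 0 < k z)%R -> measurable_fun setT k ->
  (forall z, 0 <= h z) -> measurable_fun setT h ->
  (\int[mu]_z (K z * h z)) `^ p <=
  (\int[mu]_z ((k z)%:E * h z)) `^ (p - 1) *
  \int[mu]_z (K z `^ p * ((k z `^ (1 - p))%:E * h z)).
Proof.
move=> p1 K0 mK k0 mk h0 mh.
have p0 : (0 < p)%R by lra.
pose q := (p / (p - 1))%R.
have q0 : (0 < q)%R by rewrite divr_gt0//; lra.
have pq : (p^-1 + q^-1 = 1)%R by rewrite /q invf_div; field; lra.
have pq' : (p * q^-1 = p - 1)%R by rewrite /q invf_div; field; lra.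
(* [K h = f g], the powers of [k] cancelling; [g ^ q] is [k h], and [f ^ p] is the integrand of the
   last factor. *)
pose f z := K z * ((k z `^ (- q^-1))%:E * h z `^ p^-1).
pose g z := (k z `^ q^-1)%:E * h z `^ q^-1.
have mkr r : measurable_fun setT (fun z => ((k z) `^ r)%:E).
  exact: measurable_EFin_powR.
have mf : measurable_fun setT f.
  apply: emeasurable_funM => //; apply: emeasurable_funM => //.
  exact: measurable_poweRe.
have mg : measurable_fun setT g.
  by apply: emeasurable_funM => //; exact: measurable_poweRe.
have f0 z : 0 <= f z.
  by rewrite /f !mule_ge0 ?poweR_ge0// lee_fin powR_ge0.
have g0 z : 0 <= g z by rewrite /g !mule_ge0 ?poweR_ge0// lee_fin powR_ge0.
have -> : \int[mu]_z (K z * h z) = \int[mu]_z (f z * g z).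
  apply: eq_integral => z _; rewrite /f /g -muleA; congr (_ * _).
  rewrite muleACA poweRD_pos ?invr_gt0// pq poweRe1//.
  rewrite -EFinM -powRD; last by rewrite (lt0r_neq0 (k0 z)) implybT.
  by rewrite addNr powRr0 mul1e.
have gE : \int[mu]_z g z `^ q = \int[mu]_z ((k z)%:E * h z).
  apply: eq_integral => z _.
  rewrite /g poweRM ?poweR_ge0 ?lee_fin ?powR_ge0// poweR_invK//.
  by rewrite poweR_EFin -powRrM mulVf ?gt_eqF// powRr1// ltW.
have fE : \int[mu]_z f z `^ p =
    \int[mu]_z (K z `^ p * ((k z `^ (1 - p))%:E * h z)).
  apply: eq_integral => z _.
  have r0 : 0 <= (k z `^ (- q^-1))%:E * h z `^ p^-1.
    by rewrite mule_ge0 ?poweR_ge0// lee_fin powR_ge0.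
  rewrite /f poweRM//; congr (_ * _).
  rewrite poweRM ?poweR_ge0 ?lee_fin ?powR_ge0// poweR_invK//.
  by rewrite poweR_EFin -powRrM mulNr [(q^-1 * p)%R]mulrC pq' opprB.
have I0 (F : T -> \bar R) : (forall z, 0 <= F z) -> 0 <= \int[mu]_z F z.
  by move=> F0; exact: integral_ge0.
have := hoelder_ereal mu f0 g0 mf mg p0 q0 pq.
rewrite gE fE => /(le_poweR (ltW p0) (I0 _ _)).
move=> /(_ (fun z => mule_ge0 (f0 z) (g0 z))) /le_trans; apply.
rewrite poweRM ?poweR_ge0// poweR_invK//; last first.
  by apply: I0 => z; rewrite !mule_ge0 ?poweR_ge0 ?lee_fin ?powR_ge0.
by rewrite -poweRrM [(q^-1 * p)%R]mulrC pq' muleC.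
Qed.

(** A form of Minkowski's integral inequality, where [k z] controls the weighted [L^p] norm of the
    kernel in its first variable. Integrating [kernel_jensen] in [x] and exchanging integrals
    replaces [K ^ p] by [A k ^ p], and [k ^ p k ^ (1 - p) = k] leaves one more factor [S]. *)
Lemma kernel_power_bound (p : R) (A : \bar R) (K : T -> T -> \bar R)
    (k : T -> R) (w h : T -> \bar R) : (1 < p)%R -> 0 <= A ->
  (forall x z, 0 <= K x z) -> measurable_fun setT (fun z => K z.1 z.2) ->
  (forall z, 0 < k z)%R -> measurable_fun setT k ->
  (forall x, 0 <= w x) -> measurable_fun setT w ->
  (forall x, 0 <= h x) -> measurable_fun setT h ->
  (forall z, \int[mu]_x (w x * K x z `^ p) <= A * (k z `^ p)%:E) ->
  \int[mu]_x (w x * (\int[mu]_z (K x z * h z)) `^ p) <=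
  A * (\int[mu]_z ((k z)%:E * h z)) `^ p.
Proof.
move=> p1 A0 K0 mK k0 mk w0 mw h0 mh KA.
have p0 : (0 < p)%R by lra.
set S := \int[mu]_z ((k z)%:E * h z).
have kh0 z : 0 <= (k z)%:E * h z by rewrite mule_ge0// lee_fin ltW.
have S0 : 0 <= S by exact: integral_ge0.
have mkr r : measurable_fun setT (fun z => (k z `^ r)%:E).
  exact: measurable_EFin_powR.
have mKh : measurable_fun setT (fun z => K z.1 z.2 * h z.2).
  by apply: emeasurable_funM => //; exact: measurable_snd_comp.
have mG : measurable_fun setT
    (fun z : T * T => K z.1 z.2 `^ p * ((k z.2 `^ (1 - p))%:E * h z.2)).
  apply: emeasurable_funM; first exact: measurable_poweRe.
  apply: emeasurable_funM; last exact: measurable_snd_comp.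
  exact: (measurable_snd_comp (mkr (1 - p)%R)).
have G0 x z : 0 <= K x z `^ p * ((k z `^ (1 - p))%:E * h z).
  by rewrite !mule_ge0 ?poweR_ge0// lee_fin powR_ge0.
have mI := measurable_integral_snd mu (fun x z => mule_ge0 (K0 x z) (h0 z)) mKh.
have mIG := measurable_integral_snd mu G0 mG.
have mwG : measurable_fun setT
    (fun z => w z.1 * (K z.1 z.2 `^ p * ((k z.2 `^ (1 - p))%:E * h z.2))).
  by apply: emeasurable_funM mG; exact: measurable_fst_comp.
apply: (@le_trans _ _ (\int[mu]_x (w x * (S `^ (p - 1) *
    \int[mu]_z (K x z `^ p * ((k z `^ (1 - p))%:E * h z)))))).
  apply: le_integralT => [x|||x].
  - by rewrite mule_ge0 ?poweR_ge0.
  - by apply: emeasurable_funM => //; exact: measurable_poweRe.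
  - by apply: emeasurable_funM => //; exact: emeasurable_funM.
  rewrite lee_wpmul2l//; apply: kernel_jensen => //.
  exact: (measurable_section x mK).
under eq_integral do rewrite muleCA.
rewrite ge0_integralZl//; last 3 first.
- exact: emeasurable_funM.
- by move=> x _; rewrite mule_ge0//; exact: integral_ge0.
- exact: poweR_ge0.
have -> : \int[mu]_x (w x *
      \int[mu]_z (K x z `^ p * ((k z `^ (1 - p))%:E * h z))) =
    \int[mu]_x \int[mu]_z (w x * (K x z `^ p * ((k z `^ (1 - p))%:E * h z))).
  apply: eq_integral => x _; rewrite ge0_integralZl//.
  exact: (measurable_section x mG).
rewrite tonelli//; last by move=> x z; rewrite mule_ge0.
have -> : A * S `^ p = S `^ (p - 1) * (A * S).
  rewrite muleCA; congr (_ * _); rewrite -{3}(poweRe1 S0) poweRD_pos//; last lra.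
  by rewrite subrK.
rewrite lee_wpmul2l ?poweR_ge0// -ge0_integralZl//; last first.
  by apply: emeasurable_funM => //; apply/measurable_EFinP.
apply: le_integralT => [z|||z].
- by apply: integral_ge0 => x _; rewrite mule_ge0.
- exact: (measurable_integral_fst mu (fun x z => mule_ge0 (w0 x) (G0 x z)) mwG).
- apply: emeasurable_funM => //; apply: emeasurable_funM => //.
  exact/measurable_EFinP.
under eq_integral do rewrite muleA muleC.
rewrite ge0_integralZl//; last 3 first.
- apply: emeasurable_funM => //; apply: measurable_poweRe.
  exact: (measurable_section_fst z mK).
- by move=> x _; rewrite mule_ge0 ?poweR_ge0.
- by rewrite mule_ge0// lee_fin powR_ge0.
apply: (@le_trans _ _ (((k z `^ (1 - p))%:E * h z) * (A * (k z `^ p)%:E))).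
  by rewrite lee_wpmul2l// mule_ge0// lee_fin powR_ge0.
rewrite muleCA lee_wpmul2l// muleAC -EFinM -powRD; last by rewrite (lt0r_neq0 (k0 z)) implybT.
by rewrite subrK powRr1// ltW.
Qed.

End kernel_power.

(** * Dyadic sums and the kernel [t `^ (- a)] *)

Definition ind {R : realType} (b : bool) : \bar R := (b%:R)%:E.

Section ind.
Context {R : realType}.

Lemma ind_ge0 b : 0 <= ind b :> \bar R.
Proof. by rewrite lee_fin ler0n. Qed.

Lemma ind_le1 b : ind b <= 1 :> \bar R.
Proof. by rewrite lee_fin lern1; case: b. Qed.

Lemma measurable_ind d (T : measurableType d) (b : T -> bool) :
  measurable_fun setT b -> measurable_fun setT (fun x => ind (b x) : \bar R).
Proof.
move=> mb; rewrite (_ : (fun _ => _) = fun x => if b x then 1 else 0).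
  exact: measurable_fun_ifT.
by apply/funext => x; rewrite /ind; case: (b x).
Qed.

Lemma measurable_bool_set d (T : measurableType d) (b : T -> bool) :
  measurable_fun setT b -> measurable [set x | b x].
Proof.
by move=> mb; rewrite -[X in measurable X]setTI; exact: (mb measurableT [set true]).
Qed.

Lemma integral_ind d (T : measurableType d) (mu : {measure set T -> \bar R})
    (b : T -> bool) : measurable_fun setT b ->
  \int[mu]_x ind (b x) = mu [set x | b x].
Proof.
move=> mb; have mB := measurable_bool_set mb.
rewrite -[in RHS](setIT [set x | b x]) -integral_indic//.
apply: eq_integral => x _; rewrite /ind indicE; congr (_%:R%:E).
by congr nat_of_bool; apply/idP/idP => [bx|/set_mem//]; exact/mem_set.
Qed.

End ind.

Section series.
Context {R : realType}.

Lemma nneseries_ge_term (u : nat -> \bar R) k : (forall j, 0 <= u j) ->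
  u k <= \sum_(j <oo) u j.
Proof.
move=> u0; apply: (@le_trans _ _ (\sum_(0 <= j < k.+1) u j)); last first.
  exact: nneseries_lim_ge.
by rewrite big_nat_recr//= leeDr// sume_ge0.
Qed.

Lemma nneseries_geometric (A z : R) : (0 <= A)%R -> (0 <= z < 1)%R ->
  \sum_(j <oo) (A * z ^+ j)%:E = (A / (1 - z))%:E.
Proof.
move=> A0 /andP[z0 z1].
have : series (geometric A z) @ \oo --> (A / (1 - z))%R.
  by apply: cvg_geometric_series; rewrite ger0_norm.
move=> cv; apply/cvg_lim => //.
rewrite (_ : (fun _ => _) = EFin \o series (geometric A z)).
  by apply: cvg_EFin; [exact: nearW|].
by apply/funext => n /=; rewrite /series/= sumEFin.
Qed.

Lemma nneseries_cst_pinfty (u : nat -> \bar R) (e : R) : (0 < e)%R ->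
  (forall j, e%:E <= u j) -> \sum_(j <oo) u j = +oo.
Proof.
move=> e0 eu; apply/eq_infty => t.
have u0 j : 0 <= u j by apply: le_trans (eu j); rewrite lee_fin ltW.
have [n tn] : exists n : nat, (t / e < n%:R)%R.
  by exists (Num.trunc (t / e)).+1; exact: truncnS_gt.
apply: (@le_trans _ _ (\sum_(0 <= j < n) u j)); last exact: nneseries_lim_ge.
apply: (@le_trans _ _ (\sum_(0 <= j < n) e%:E)); last exact: lee_sum.
rewrite sumEFin lee_fin big_const_nat subn0 iter_addr_0 -mulr_natr mulrC.
by rewrite -ler_pdivrMr// ltW.
Qed.

End series.

Section dyadic.
Context {R : realType}.
Implicit Types t r x p q : R.

Lemma powRX x p n : (0 <= x)%R -> ((x ^+ n) `^ p = (x `^ p) ^+ n)%R.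
Proof.
move=> x0; elim: n => [|n ih]; first by rewrite !expr0 powR1.
by rewrite !exprS powRM ?ih// exprn_ge0.
Qed.

Lemma powRD_pos x p q : (0 < x)%R -> (x `^ (p + q) = x `^ p * x `^ q)%R.
Proof. by move=> x0; rewrite powRD// (lt0r_neq0 x0) implybT. Qed.

Lemma powRB_pos x p q : (0 < x)%R -> (x `^ (p - q) = x `^ p / x `^ q)%R.
Proof. by move=> x0; rewrite powRD_pos// powRN. Qed.

Lemma powRV x p : (0 <= x)%R -> (x^-1 `^ p = (x `^ p)^-1)%R.
Proof. by move=> x0; rewrite -powR_inv1// -powRrM mulN1r powRN. Qed.

Lemma powR_lt1 x p : (0 <= x < 1)%R -> (0 < p)%R -> (x `^ p < 1)%R.
Proof.
move=> /andP[x0 x1] p0; have -> : (1 = 1 `^ p :> R)%R by rewrite powR1.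
by apply: gt0_ltr_powR => //; rewrite nnegrE.
Qed.

Lemma dyadic_shell_small t r : (0 < t)%R -> (t < r)%R ->
  exists j : nat, (2^-1 ^+ j.+1 * r <= t < 2^-1 ^+ j * r)%R.
Proof.
move=> t0 tr; have r0 : (0 < r)%R by exact: lt_trans tr.
have exj : exists j : nat, (2^-1 ^+ j.+1 * r <= t)%R.
  have [n rn] : exists n : nat, (r / t < n%:R)%R.
    by exists (Num.trunc (r / t)).+1; exact: truncnS_gt.
  exists n; rewrite exprVn mulrC ler_pdivrMr ?exprn_gt0// mulrC.
  rewrite -ler_pdivrMr// (le_trans (ltW rn))// -natrX ler_nat.
  by apply: ltnW; rewrite (leq_ltn_trans _ (ltn_expl n.+1 _)).
case: (ex_minnP exj) => j jt jmin; exists j; rewrite jt/=.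
case: j jt jmin => [_ _|j _ jmin]; first by rewrite expr0 mul1r.
by rewrite ltNge; apply/negP => /jmin; rewrite ltnn.
Qed.

(** The least [j] with [t < 2 ^ j] works: [2 ^ (j - 1) <= t] if [j > 0], and the summand [1] covers
    [j = 0]. *)
Lemma dyadic_shell_large t : (0 <= t)%R ->
  exists j : nat, (t < 2 ^+ j)%R /\ (2 ^+ j <= 2 * (1 + t))%R.
Proof.
move=> t0; have exj : exists j : nat, (t < 2 ^+ j)%R.
  exists (Num.trunc t).+1; rewrite (lt_le_trans (truncnS_gt _))//.
  by rewrite -natrX ler_nat ltnW// ltn_expl.
case: (ex_minnP exj) => j jt jmin; exists j; split => //.
case: j jt jmin => [_ _|j _ jmin]; first by rewrite expr0; lra.
have : (2 ^+ j <= t)%R by rewrite leNgt; apply/negP => /jmin; rewrite ltnn.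
by rewrite exprS; lra.
Qed.

End dyadic.

(* [t `^ (- a)] for [t > 0], with the value [+oo] at the diagonal [t = 0], where
   [powR] would give [0]. *)
Definition pker {R : realType} (a t : R) : \bar R :=
  if t == 0%R then +oo else (t `^ (- a))%:E.

Section pker.
Context {R : realType}.
Implicit Types a t l p : R.

Lemma epowN_pker a t : (0 < a)%R -> epow t%:E (- a) = pker a t.
Proof.
move=> a0; rewrite /epow /pker leNgt oppr_lt0 a0/= opprK inver powR_eq0.
by rewrite (gt_eqF a0) andbT; case: ifPn => // _; rewrite powRN.
Qed.

Lemma pker_gt0E a t : (0 < t)%R -> pker a t = (t `^ (- a))%:E.
Proof. by move=> t0; rewrite /pker gt_eqF. Qed.

Lemma pker_ge0 a t : 0 <= pker a t.
Proof. by rewrite /pker; case: ifPn => // _; rewrite lee_fin powR_ge0. Qed.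

Lemma pker_anti a t t' : (0 <= a)%R -> (0 <= t)%R -> (t <= t')%R ->
  pker a t' <= pker a t.
Proof.
move=> a0 t0 tt'; have [t00|tn0] := eqVneq t 0%R.
  by rewrite /pker t00 eqxx leey.
have {t0}t0 : (0 < t)%R by rewrite lt0r tn0.
rewrite !pker_gt0E//; last exact: lt_le_trans tt'.
rewrite lee_fin !powRN lef_pV2 ?posrE ?powR_gt0//; last exact: lt_le_trans tt'.
by rewrite ge0_ler_powR// nnegrE ltW// (lt_le_trans t0).
Qed.

Lemma pker_scale a l t : (0 < l)%R -> (0 <= t)%R ->
  pker a (l * t) = (l `^ (- a))%:E * pker a t.
Proof.
move=> l0 t0; rewrite /pker mulf_eq0 (gt_eqF l0)/=; case: ifPn => [_|tn0].
  by rewrite gt0_muley// lte_fin powR_gt0.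
by rewrite -EFinM powRM// ltW.
Qed.

Lemma pker_poweR a t p : (0 < p)%R -> pker a t `^ p = pker (a * p) t.
Proof.
move=> p0; rewrite /pker; case: ifPn => _; first by rewrite poweRyr// gt_eqF.
by rewrite poweR_EFin -powRrM mulNr.
Qed.

Lemma measurable_pker d (T : measurableType d) a (f : T -> R) :
  measurable_fun setT f -> measurable_fun setT (fun x => pker a (f x)).
Proof.
move=> mf; apply: measurable_fun_ifT => //; last exact: measurable_EFin_powR.
exact: measurable_fun_eqr.
Qed.

End pker.

(** * Kernel estimates in Ahlfors regular spaces *)

(** Besides Euclidean space, the line with [N = 1] is an instance, used to bound Euler's integral.
    Measurability of the distance is joint because Tonelli's theorem is applied to the kernels. *)
Record ahlfors_regular d (T : measurableType d) (R : realType)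
    (mu : set T -> \bar R) (dist : T -> T -> R) (N cL cU : R) : Prop := {
  ar_dim : (0 < N)%R ;
  ar_cL : (0 < cL)%R ;
  ar_cU : (0 < cU)%R ;
  ar_ge0 : forall x y, (0 <= dist x y)%R ;
  ar_sym : forall x y, dist x y = dist y x ;
  ar_tri : forall x y z, (dist x z <= dist x y + dist y z)%R ;
  ar_meas : measurable_fun setT (fun p : T * T => dist p.1 p.2) ;
  ar_lower : forall x r, (0 < r)%R ->
    (cL * r `^ N)%:E <= mu [set y | (dist x y < r)%R] ;
  ar_upper : forall x r, (0 < r)%R ->
    mu [set y | (dist x y < r)%R] <= (cU * r `^ N)%:E }.

Section kernel_estimates.
Context d (T : measurableType d) (R : realType).
Variables (mu : {sigma_finite_measure set T -> \bar R}) (dist : T -> T -> R).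
Variables (N cL cU : R).
Hypothesis reg : ahlfors_regular mu dist N cL cU.

Let dist_ge0 := ar_ge0 reg.
Let distC := ar_sym reg.
Let dist_tri := ar_tri reg.
Let N0 := ar_dim reg.
Let cU0 := ar_cU reg.

Lemma measurable_dist x : measurable_fun setT (dist x).
Proof. exact: (measurable_section x (ar_meas reg)). Qed.

Lemma measurable_dist_fst x : measurable_fun setT (dist ^~ x).
Proof. exact: (measurable_section_fst x (ar_meas reg)). Qed.

Lemma measurable_ind_ball x r :
  measurable_fun setT (fun y => ind (dist x y < r)%R : \bar R).
Proof.
by apply: measurable_ind; apply: measurable_fun_ltr => //; exact: measurable_dist.
Qed.

Lemma integral_ind_ball x r : (0 < r)%R ->
  \int[mu]_y ind (dist x y < r)%R <= (cU * r `^ N)%:E.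
Proof.
move=> r0; rewrite integral_ind; first exact: ar_upper reg _ _ r0.
by apply: measurable_fun_ltr => //; exact: measurable_dist.
Qed.

Lemma integral_ind_ball_ge x r : (0 < r)%R ->
  (cL * r `^ N)%:E <= \int[mu]_y ind (dist x y < r)%R.
Proof.
move=> r0; rewrite integral_ind; first exact: ar_lower reg _ _ r0.
by apply: measurable_fun_ltr => //; exact: measurable_dist.
Qed.

(** A point with [0 < t < r] lies in one dyadic shell, whose term already dominates. At [t = 0] the
    kernel is infinite, but so is the sum, every term being at least [r ^ (- a)]. *)
Lemma pker_le_dyadic (a r t : R) : (0 < a)%R -> (0 < r)%R -> (0 <= t)%R ->
  ind (t < r)%R * pker a t <= \sum_(j <oo)
    (((2^-1 ^+ j.+1 * r) `^ (- a))%:E * ind (t < 2^-1 ^+ j * r)%R).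
Proof.
move=> a0 r0 t0.
have u0 j : 0 <= ((2^-1 ^+ j.+1 * r) `^ (- a))%:E * ind (t < 2^-1 ^+ j * r)%R.
  by rewrite mule_ge0 ?ind_ge0// lee_fin powR_ge0.
have pos j : (0 < 2^-1 ^+ j * r)%R by rewrite mulr_gt0// exprn_gt0// invr_gt0.
case: ltP => tr; last by rewrite mul0e nneseries_ge0.
rewrite mul1e; have [t00|tn0] := eqVneq t 0%R.
  rewrite (@nneseries_cst_pinfty _ _ (r `^ (- a))) ?leey ?powR_gt0// => j.
  rewrite t00 pos mule1 lee_fin !powRN lef_pV2 ?posrE ?powR_gt0//.
  rewrite ge0_ler_powR ?nnegrE ?(ltW a0) ?(ltW r0) ?(ltW (pos _))//.
  by rewrite ger_pMl// exprn_ile1// ?invr_ge0// invf_le1// ler1n.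
have {}t0 : (0 < t)%R by rewrite lt0r tn0.
have [j /andP[jt tj]] := dyadic_shell_small t0 tr.
apply: le_trans (nneseries_ge_term j u0).
by rewrite tj mule1 -pker_gt0E// pker_anti// ltW.
Qed.

Lemma pker_integral_ball a : (0 < a < N)%R ->
  exists2 C : R, (0 < C)%R & forall z r, (0 < r)%R ->
    \int[mu]_y (ind (dist z y < r)%R * pker a (dist z y)) <=
    (C * r `^ (N - a))%:E.
Proof.
move=> /andP[a0 aN].
pose q : R := ((2^-1) `^ (N - a))%R.
have q0 : (0 <= q)%R by exact: powR_ge0.
have q1 : (q < 1)%R.
  by apply: powR_lt1; rewrite ?subr_gt0// invr_ge0 ler0n/= invf_lt1 ?ltr1n.
exists (2 `^ a * cU / (1 - q))%R.
  by rewrite divr_gt0 ?subr_gt0// mulr_gt0// powR_gt0.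
move=> z r r0.
have pos j : (0 < 2^-1 ^+ j * r)%R by rewrite mulr_gt0// exprn_gt0// invr_gt0.
have mb := measurable_ind_ball.
have mt j : measurable_fun setT (fun y => ((2^-1 ^+ j.+1 * r) `^ (- a))%:E *
    ind (dist z y < 2^-1 ^+ j * r)%R) by exact: emeasurable_funM.
have t0 j y : 0 <= ((2^-1 ^+ j.+1 * r) `^ (- a))%:E *
    ind (dist z y < 2^-1 ^+ j * r)%R.
  by rewrite mule_ge0 ?ind_ge0// lee_fin powR_ge0.
apply: (@le_trans _ _ (\int[mu]_y \sum_(j <oo)
    (((2^-1 ^+ j.+1 * r) `^ (- a))%:E * ind (dist z y < 2^-1 ^+ j * r)%R))).
  apply: le_integralT => [y|||y].
  - by rewrite mule_ge0 ?pker_ge0 ?ind_ge0.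
  - by apply: emeasurable_funM => //; apply: measurable_pker; exact: measurable_dist.
  - exact: ge0_emeasurable_sum.
  - exact: pker_le_dyadic.
rewrite integral_nneseries//.
have -> : (2 `^ a * cU / (1 - q) * r `^ (N - a) =
    (2 `^ a * cU * r `^ (N - a)) / (1 - q))%R by rewrite mulrAC.
rewrite -nneseries_geometric ?q0//; last first.
  by rewrite !mulr_ge0 ?powR_ge0// ltW.
apply: lee_nneseries => [j _ _|j _]; first exact: integral_ge0.
rewrite ge0_integralZl//; last 2 first.
- by move=> y _; exact: ind_ge0.
- by rewrite lee_fin powR_ge0.
apply: (le_trans (lee_wpmul2l _ (integral_ind_ball _ (pos j)))).
  by rewrite lee_fin powR_ge0.
rewrite -EFinM lee_fin le_eqVlt; apply/orP; left; apply/eqP.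
have e0 k : (0 <= 2^-1 ^+ k :> R)%R by rewrite exprn_ge0.
rewrite !powRM ?(ltW r0)// !powRX// exprS /q.
have i2 : (0 < 2^-1 :> R)%R by rewrite invr_gt0.
rewrite !powRB_pos// !powRN.
have -> : (2 `^ a = (2^-1 `^ a)^-1 :> R)%R by rewrite powRV// invrK.
rewrite exprMn; set u := ((2^-1 `^ a)^-1)%R.
by move: (u ^+ j)%R (((2^-1) `^ N) ^+ j)%R => w v; ring.
Qed.

Lemma measurable_pker_dist_fst a z : measurable_fun setT (fun x => pker a (dist x z)).
Proof. by apply: measurable_pker; exact: measurable_dist_fst. Qed.

(** If [dist y z >= 2 r], then [dist x z] is at least a third of [r + dist y z] on the whole ball.
    Otherwise the ball lies in the one of radius [3 r] about [z], and [r + dist y z] is at most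
    [3 r]. *)
Lemma pker_integral_ball_off a : (0 < a < N)%R ->
  exists2 C : R, (0 < C)%R & forall y z r, (0 < r)%R ->
    \int[mu]_x (ind (dist y x < r)%R * pker a (dist x z)) <=
    (C * (r `^ N * (r + dist y z) `^ (- a)))%:E.
Proof.
move=> aN; have [C C0 HC] := pker_integral_ball aN.
case/andP: aN => a0 aN.
exists (3 `^ a * cU + C * 3 `^ N)%R.
  by rewrite addr_gt0// mulr_gt0// powR_gt0.
move=> y z r r0.
have rd : (0 < r + dist y z)%R by rewrite ltr_wpDr.
have i3 : (0 < 3^-1 :> R)%R by rewrite invr_gt0.
have E3 : (3^-1 `^ (- a) = 3 `^ a :> R)%R by rewrite powRV// powRN invrK.
have [far|near] := leP (2 * r)%R (dist y z).
  apply: (@le_trans _ _ (\int[mu]_x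
      (((3^-1 * (r + dist y z)) `^ (- a))%:E * ind (dist y x < r)%R))).
    apply: le_integralT => [x|||x].
    - by rewrite mule_ge0 ?ind_ge0 ?pker_ge0.
    - by apply: emeasurable_funM; [exact: measurable_ind_ball|
                                   exact: measurable_pker_dist_fst].
    - by apply: emeasurable_funM => //; exact: measurable_ind_ball.
    case: ltP => yx; last by rewrite mul0e mule0.
    rewrite mul1e mule1 -pker_gt0E ?mulr_gt0//.
    apply: pker_anti; rewrite ?mulr_ge0// ltW//.
    by have := dist_tri y x z; lra.
  rewrite ge0_integralZl//; last 3 first.
  - exact: measurable_ind_ball.
  - by move=> x _; exact: ind_ge0.
  - by rewrite lee_fin powR_ge0.
  apply: (le_trans (lee_wpmul2l _ (integral_ind_ball y r0))).
    by rewrite lee_fin powR_ge0.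
  rewrite -EFinM lee_fin powRM ?(ltW rd)// E3.
  have -> : (3 `^ a * (r + dist y z) `^ (- a) * (cU * r `^ N) =
    (3 `^ a * cU) * (r `^ N * (r + dist y z) `^ (- a)))%R by ring.
  by rewrite ler_wpM2r ?mulr_ge0 ?powR_ge0// lerDl mulr_ge0 ?powR_ge0// ltW.
have r3 : (0 < 3 * r)%R by rewrite mulr_gt0.
apply: (@le_trans _ _ (\int[mu]_x
    (ind (dist z x < 3 * r)%R * pker a (dist z x)))).
  apply: le_integralT => [x|||x].
  - by rewrite mule_ge0 ?ind_ge0 ?pker_ge0.
  - by apply: emeasurable_funM; [exact: measurable_ind_ball|
                                 exact: measurable_pker_dist_fst].
  - apply: emeasurable_funM; first exact: measurable_ind_ball.
    by apply: measurable_pker; exact: measurable_dist.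
  rewrite (distC x z) lee_wpmul2r ?pker_ge0// lee_fin ler_nat.
  case: ltP => // yx; rewrite (_ : (_ < _)%R = true)//.
  have := dist_tri z y x; rewrite (distC z y); move: yx near; lra.
apply: (le_trans (HC z _ r3)); rewrite lee_fin.
rewrite powRB_pos// !powRM ?(ltW r0)//.
have -> : (C * (3 `^ N * r `^ N / (3 `^ a * r `^ a)) =
  (C * 3 `^ N) * (r `^ N * ((3 `^ a) * r `^ a)^-1))%R by ring.
apply: (@le_trans _ _ ((C * 3 `^ N) * (r `^ N * (r + dist y z) `^ (- a)))%R).
  rewrite ler_wpM2l ?mulr_ge0 ?powR_ge0 ?(ltW C0)//.
  rewrite ler_wpM2l ?powR_ge0// powRN lef_pV2 ?posrE ?mulr_gt0 ?powR_gt0//.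
  rewrite -powRM ?(ltW r0)// ge0_ler_powR ?nnegrE ?(ltW a0) ?(ltW rd) ?(ltW r3)//.
  by move: near; lra.
by rewrite ler_wpM2r ?mulr_ge0 ?powR_ge0// lerDr mulr_ge0 ?powR_ge0// ltW.
Qed.

Variable o : T.

Definition wt (b : R) (x : T) : R := ((1 + dist o x) `^ (- b))%R.

Lemma wt_base x : (0 < 1 + dist o x)%R.
Proof. by rewrite ltr_wpDr. Qed.

Lemma wt_gt0 b x : (0 < wt b x)%R.
Proof. by rewrite powR_gt0// wt_base. Qed.

Lemma wt_le1 b x : (0 <= b)%R -> (wt b x <= 1)%R.
Proof.
move=> b0; rewrite /wt powRN invf_le1 ?powR_gt0 ?wt_base//.
apply: (@le_trans _ _ (1 `^ b)%R); first by rewrite powR1.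
by rewrite ge0_ler_powR ?nnegrE ?ler01// ?(ltW (wt_base x))// lerDl.
Qed.

Lemma measurable_wt b : measurable_fun setT (wt b).
Proof.
apply: (measurableT_comp (measurable_powR _)).
by apply: measurable_funD => //; exact: measurable_dist.
Qed.

Lemma measurable_EFin_wt b : measurable_fun setT (fun x => (wt b x)%:E).
Proof. by apply/measurable_EFinP; exact: measurable_wt. Qed.

(** On the shell where [2 ^ j] is comparable to [1 + dist o x] the weight is at most
    [2 ^ b 2 ^ (- b j)], which has to beat the growth [q ^ j] of the integrals over balls. *)
Lemma wt_integral_le b (F : T -> \bar R) (A q : R) : (0 <= b)%R ->
  (forall x, 0 <= F x) -> measurable_fun setT F -> (0 <= A)%R -> (0 <= q)%R ->
  (2 `^ (- b) * q < 1)%R ->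
  (forall j : nat, \int[mu]_x (ind (dist o x < 2 ^+ j)%R * F x) <= (A * q ^+ j)%:E) ->
  \int[mu]_x ((wt b x)%:E * F x) <= (2 `^ b * A / (1 - 2 `^ (- b) * q))%:E.
Proof.
move=> b0 F0 mF A0 q0 q1 FA.
pose c j : R := (2 `^ b * (2 `^ (- b)) ^+ j)%R.
have c0 j : (0 <= c j)%R by rewrite mulr_ge0 ?exprn_ge0 ?powR_ge0.
have mt j : measurable_fun setT
    (fun x => (c j)%:E * (ind (dist o x < 2 ^+ j)%R * F x)).
  by do 2 apply: emeasurable_funM => //; exact: measurable_ind_ball.
have t0 j x : 0 <= (c j)%:E * (ind (dist o x < 2 ^+ j)%R * F x).
  by rewrite !mule_ge0 ?ind_ge0// lee_fin.
apply: (@le_trans _ _ (\int[mu]_x \sum_(j <oo)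
    ((c j)%:E * (ind (dist o x < 2 ^+ j)%R * F x)))).
  apply: le_integralT => [x|||x].
  - by rewrite mule_ge0// lee_fin ltW// wt_gt0.
  - by apply: emeasurable_funM => //; exact: measurable_EFin_wt.
  - exact: ge0_emeasurable_sum.
  have [j [xj jx]] := dyadic_shell_large (dist_ge0 o x).
  apply: le_trans (nneseries_ge_term j (t0 ^~ x)); rewrite xj mul1e.
  have cE : (c j = ((2 ^+ j / 2) `^ b)^-1)%R.
    rewrite /c powRM ?exprn_ge0 ?invr_ge0// powRX// powRV// invfM invrK powRN.
    by rewrite mulrC exprVn.
  rewrite lee_wpmul2r// lee_fin cE /wt powRN.
  have j2 : (0 < 2 ^+ j / 2 :> R)%R by rewrite divr_gt0// exprn_gt0.
  rewrite lef_pV2 ?posrE ?powR_gt0 ?wt_base//.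
  rewrite ge0_ler_powR ?nnegrE ?(ltW j2) ?(ltW (wt_base x))//.
  by rewrite ler_pdivrMr// mulrC.
rewrite integral_nneseries// -nneseries_geometric; last 2 first.
- by rewrite mulr_ge0// powR_ge0.
- by rewrite q1 mulr_ge0// powR_ge0.
apply: lee_nneseries => [j _ _|j _]; first exact: integral_ge0.
rewrite ge0_integralZl//; last 3 first.
- by apply: emeasurable_funM => //; exact: measurable_ind_ball.
- by move=> x _; rewrite mule_ge0// ind_ge0.
- by rewrite lee_fin.
apply: (le_trans (lee_wpmul2l _ (FA j))); first by rewrite lee_fin.
rewrite -EFinM lee_fin /c exprMn.
by move: (_ ^+ j)%R (q ^+ j)%R => u v; rewrite le_eqVlt; apply/orP; left; apply/eqP; ring.
Qed.

Lemma powR2_mulN_lt1 (x y : R) : (y < x)%R -> (2 `^ (- x) * 2 `^ y < 1 :> R)%R.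
Proof.
move=> yx; rewrite -powRD_pos// addrC -[(y - x)%R]opprB powRN -powRV//.
by apply: powR_lt1; rewrite ?subr_gt0// invr_ge0 ler0n/= invf_lt1 ?ltr1n.
Qed.

Lemma wt_integral_fin b : (N < b)%R ->
  exists2 C : R, (0 < C)%R & \int[mu]_x (wt b x)%:E <= C%:E.
Proof.
move=> Nb; have lt1 := powR2_mulN_lt1 Nb.
exists (2 `^ b * cU / (1 - 2 `^ (- b) * 2 `^ N))%R.
  by rewrite divr_gt0 ?subr_gt0// mulr_gt0// powR_gt0.
have -> : \int[mu]_x (wt b x)%:E = \int[mu]_x ((wt b x)%:E * cst 1 x).
  by apply: eq_integral => x _; rewrite mule1.
apply: wt_integral_le => //; rewrite ?powR_ge0 ?(ltW cU0)//.
- by apply: ltW; exact: lt_trans Nb.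
- move=> j; under eq_integral do rewrite mule1.
  by rewrite -powRX//; apply: integral_ind_ball; rewrite exprn_gt0.
Qed.

(** The decay [b > N] alone sums the shells, so [(2 ^ j + dist o z) ^ (- a)] can be bounded by its
    value with [1] in place of [2 ^ j], and the decay of the kernel in [z] survives. *)
Lemma wt_pker_integral a b : (0 < a < N)%R -> (N < b)%R ->
  exists2 C : R, (0 < C)%R & forall z,
    \int[mu]_x ((wt b x)%:E * pker a (dist x z)) <= (C * wt a z)%:E.
Proof.
move=> aN Nb; have [C C0 HC] := pker_integral_ball_off aN.
have lt1 := powR2_mulN_lt1 Nb.
case/andP: aN => a0 aN.
exists (2 `^ b * C / (1 - 2 `^ (- b) * 2 `^ N))%R.
  by rewrite divr_gt0 ?subr_gt0// mulr_gt0// powR_gt0.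
move=> z.
have -> : (2 `^ b * C / (1 - 2 `^ (- b) * 2 `^ N) * wt a z =
    2 `^ b * (C * wt a z) / (1 - 2 `^ (- b) * 2 `^ N))%R by ring.
apply: wt_integral_le => //; rewrite ?powR_ge0//.
- by apply: ltW; exact: lt_trans Nb.
- by move=> x; exact: pker_ge0.
- exact: measurable_pker_dist_fst.
- by rewrite mulr_ge0// ltW// wt_gt0.
move=> j; have j1 : (1 <= 2 ^+ j :> R)%R by rewrite exprn_ege1// ler1n.
have jz : (0 < 2 ^+ j + dist o z)%R by rewrite ltr_wpDr// exprn_gt0.
apply: (le_trans (HC _ _ _ _)); first by rewrite exprn_gt0.
rewrite lee_fin -mulrA ler_wpM2l ?(ltW C0)// -powRX// mulrC.
rewrite ler_wpM2r ?powR_ge0// /wt !powRN lef_pV2 ?posrE ?powR_gt0 ?wt_base//.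
by rewrite ge0_ler_powR ?nnegrE ?(ltW a0) ?(ltW (wt_base z)) ?(ltW jz)// lerD2r.
Qed.

(** Here [b] may be below [N], so [(2 ^ j + dist o z) ^ (- a)] is bounded by [2 ^ (- j a)]: the
    decay of the kernel is spent on summing the shells, and the bound is uniform in [z]. *)
Lemma wt_pker_integral_bounded a b : (0 < a < N)%R -> (N - a < b)%R ->
  exists2 C : R, (0 < C)%R & forall z,
    \int[mu]_x ((wt b x)%:E * pker a (dist x z)) <= C%:E.
Proof.
move=> aN Nab; have [C C0 HC] := pker_integral_ball_off aN.
have lt1 := powR2_mulN_lt1 Nab.
case/andP: aN => a0 aN.
exists (2 `^ b * C / (1 - 2 `^ (- b) * 2 `^ (N - a)))%R.
  by rewrite divr_gt0 ?subr_gt0// mulr_gt0// powR_gt0.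
move=> z; apply: wt_integral_le => //; rewrite ?powR_ge0 ?(ltW C0)//.
- by lra.
- by move=> x; exact: pker_ge0.
- exact: measurable_pker_dist_fst.
move=> j; have j0 : (0 < 2 ^+ j :> R)%R by rewrite exprn_gt0.
have jz : (0 < 2 ^+ j + dist o z)%R by rewrite ltr_wpDr.
apply: (le_trans (HC _ _ _ j0)).
rewrite lee_fin ler_wpM2l ?(ltW C0)// -powRX// powRB_pos//.
rewrite ler_wpM2l ?powR_ge0// powRN lef_pV2 ?posrE ?powR_gt0//.
by rewrite ge0_ler_powR ?nnegrE ?(ltW a0) ?(ltW jz) ?(ltW j0)// lerDl.
Qed.

End kernel_estimates.

(** * Potentials *)

Section epow.
Context {R : realType}.
Implicit Types (x : \bar R) (r u : R).

Lemma epow_ge0 x r : 0 <= epow x r.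
Proof. by rewrite /epow; case: ifP => _; rewrite ?inve_ge0 poweR_ge0. Qed.

Lemma epow_pos u r : (0 < u)%R -> epow u%:E r = (u `^ r)%:E.
Proof.
move=> u0; rewrite /epow; case: ifP => // _.
by rewrite poweR_EFin inver gt_eqF ?powR_gt0// powRN invrK.
Qed.

Lemma epow_nneg x r : (0 <= r)%R -> epow x r = x `^ r.
Proof. by rewrite /epow => ->. Qed.

Lemma measurable_inve d (T : measurableType d) (f : T -> \bar R) :
  (forall z, 0 <= f z) -> measurable_fun setT f ->
  measurable_fun setT (fun z => (f z)^-1).
Proof.
move=> f0 mf; rewrite (_ : (fun _ => _) = fun z => if f z == 0 then +oo else
    if f z == +oo then 0 else ((fine (f z)) `^ (- 1))%:E).
  apply: measurable_fun_ifT => //; first exact: measurable_fun_eqe.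
  apply: measurable_fun_ifT => //; first exact: measurable_fun_eqe.
  by apply: measurable_EFin_powR; exact: measurableT_comp.
apply/funext => z; have := f0 z; case: (f z) => [r r0| |]//.
by rewrite inver eqe; case: ifPn => //= _; rewrite powR_inv1.
Qed.

Lemma measurable_epow d (T : measurableType d) (f : T -> \bar R) r :
  measurable_fun setT f -> measurable_fun setT (fun z => epow (f z) r).
Proof.
move=> mf; rewrite /epow; case: (0 <= r)%R; first exact: measurable_poweRe.
apply: measurable_inve => [z|]; first exact: poweR_ge0.
exact: measurable_poweRe.
Qed.

End epow.

Section potential.
Context d (T : measurableType d) (R : realType).
Variables (mu : {sigma_finite_measure set T -> \bar R}) (dist : T -> T -> R).
Variables (N cL cU : R).
Hypothesis reg : ahlfors_regular mu dist N cL cU.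
Variables (o : T) (kap : R).
Hypothesis kapN : (0 < kap < N)%R.
Implicit Types (h f : T -> \bar R).

Let kap0 : (0 < kap)%R. Proof. by case/andP: kapN. Qed.
Let dist_ge0 := ar_ge0 reg.

Local Notation om := (wt dist o).

(* The Riesz potential up to its constant, for [r = 0]; a shift [r > 0] truncates
   the kernel, and stopping radii are defined through the shifted potential. *)
Definition pot (r : R) h x : \bar R :=
  \int[mu]_y (pker kap (r + dist x y) * h y).

Lemma measurable_pker_dist2 a r :
  measurable_fun setT (fun z : T * T => pker a (r + dist z.1 z.2)).
Proof.
by apply: measurable_pker; apply: measurable_funD => //; exact: ar_meas reg.
Qed.

Lemma measurable_pker_dist a r x :
  measurable_fun setT (fun y => pker a (r + dist x y)).
Proof. exact: (measurable_section x (measurable_pker_dist2 a r)). Qed.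

Lemma measurable_pot r h : (forall y, 0 <= h y) -> measurable_fun setT h ->
  measurable_fun setT (pot r h).
Proof.
move=> h0 mh; apply: measurable_integral_snd => [x y|].
  by rewrite mule_ge0// pker_ge0.
apply: emeasurable_funM; first exact: measurable_pker_dist2.
exact: measurable_snd_comp.
Qed.

Lemma pot_ge0 r h x : (forall y, 0 <= h y) -> 0 <= pot r h x.
Proof. by move=> h0; apply: integral_ge0 => y _; rewrite mule_ge0 ?pker_ge0. Qed.

Lemma le_pot r h h' x : (forall y, 0 <= h y) -> measurable_fun setT h ->
  measurable_fun setT h' -> (forall y, h y <= h' y) -> pot r h x <= pot r h' x.
Proof.
move=> h0 mh mh' hh'; apply: le_integralT => [y|||y].
- by rewrite mule_ge0 ?pker_ge0.
- by apply: emeasurable_funM => //; exact: measurable_pker_dist.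
- by apply: emeasurable_funM => //; exact: measurable_pker_dist.
- by rewrite lee_wpmul2l ?pker_ge0.
Qed.

Lemma eq_ae_pot r h h' x : (forall y, 0 <= h y) -> (forall y, 0 <= h' y) ->
  measurable_fun setT h -> measurable_fun setT h' ->
  (\forall y \ae mu, h y = h' y) -> pot r h x = pot r h' x.
Proof.
move=> h0 h'0 mh mh' hh'; apply: eq_ae_integralT => [y|y|||].
- by rewrite mule_ge0 ?pker_ge0.
- by rewrite mule_ge0 ?pker_ge0.
- by apply: emeasurable_funM => //; exact: measurable_pker_dist.
- by apply: emeasurable_funM => //; exact: measurable_pker_dist.
- by apply: filterS hh' => y ->.
Qed.

(* Finiteness of this weighted L^1 norm is what replaces membership of the space
   of the [O_norm]: it is equivalent to [pot 0 h] being finite somewhere. *)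
Definition vnorm h : \bar R := \int[mu]_y ((om kap y)%:E * h y).

Lemma wt_EFin_ge0 b x : 0 <= (om b x)%:E.
Proof. by rewrite lee_fin ltW// (wt_gt0 reg). Qed.

Lemma wtM_ge0 b h : (forall y, 0 <= h y) -> forall y, 0 <= (om b y)%:E * h y.
Proof. by move=> h0 y; rewrite mule_ge0 ?wt_EFin_ge0. Qed.

Lemma measurable_wtM b h : measurable_fun setT h ->
  measurable_fun setT (fun y => (om b y)%:E * h y).
Proof.
by move=> mh; apply: emeasurable_funM => //; exact: (measurable_EFin_wt reg).
Qed.

Lemma vnorm_ge0 h : (forall y, 0 <= h y) -> 0 <= vnorm h.
Proof. by move=> h0; apply: integral_ge0 => y _; rewrite mule_ge0 ?wt_EFin_ge0. Qed.

(** The triangle inequality gives [dist x y <= (1 + dist o x) (1 + dist o y)]. Thus the potential of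
    a nonzero [h] vanishes nowhere, with a lower bound that is uniform on bounded sets. *)
Lemma pot_ge_vnorm h x : (forall y, 0 <= h y) -> measurable_fun setT h ->
  (om kap x)%:E * vnorm h <= pot 0 h x.
Proof.
move=> h0 mh; rewrite -ge0_integralZl ?wt_EFin_ge0//; last 2 first.
- by apply: emeasurable_funM => //; exact: (measurable_EFin_wt reg).
- by move=> y _; rewrite mule_ge0 ?wt_EFin_ge0.
apply: le_integralT => [y|||y].
- by rewrite !mule_ge0 ?wt_EFin_ge0.
- by do 2 apply: emeasurable_funM => //; exact: (measurable_EFin_wt reg).
- by apply: emeasurable_funM => //; exact: measurable_pker_dist.
rewrite muleA lee_wpmul2r// /wt -EFinM.
have bx := wt_base reg o x; have by' := wt_base reg o y.
rewrite -powRM ?(ltW bx) ?(ltW by')// -pker_gt0E ?mulr_gt0// add0r.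
apply: pker_anti => //; first exact: ltW.
have := ar_tri reg x o y; rewrite (ar_sym reg x o) => /le_trans; apply.
have := mulr_ge0 (dist_ge0 o x) (dist_ge0 o y); lra.
Qed.

Lemma ae_eq0_of_vnorm h : (forall y, 0 <= h y) -> measurable_fun setT h ->
  vnorm h = 0 -> \forall y \ae mu, h y = 0.
Proof.
move=> h0 mh vh0; have := ae_eq0_integral (wtM_ge0 kap h0) (measurable_wtM kap mh) vh0.
apply: filterS => y /eqP; rewrite mule_eq0 => /orP[|/eqP//].
by rewrite eqe gt_eqF// (wt_gt0 reg).
Qed.

Lemma ae_fin_of_vnorm h : (forall y, 0 <= h y) -> measurable_fun setT h ->
  vnorm h < +oo -> \forall y \ae mu, h y < +oo.
Proof.
move=> h0 mh vh0; have := ae_fin_integral (wtM_ge0 kap h0) (measurable_wtM kap mh) vh0.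
apply: filterS => y; case: (h y) => [r _||]; rewrite ?ltry//.
by rewrite gt0_muley ?ltxx// lte_fin (wt_gt0 reg).
Qed.

(** As [kap p < N], [wt_pker_integral] applies to the [p]-th power of the kernel and yields
    [om (kap p)], the [p]-th power of [om kap]; this is what [kernel_power_bound] asks for with
    [k = om kap]. *)
Lemma wt_pot_power_le p b : (1 < p)%R -> (kap * p < N)%R -> (N < b)%R ->
  exists2 C : R, (0 < C)%R & forall h, (forall y, 0 <= h y) ->
    measurable_fun setT h ->
    \int[mu]_x ((om b x)%:E * pot 0 h x `^ p) <= C%:E * vnorm h `^ p.
Proof.
move=> p1 kp Nb; have p0 : (0 < p)%R by lra.
have kp' : (0 < kap * p < N)%R by rewrite mulr_gt0.
have [C C0 HC] := wt_pker_integral reg o kp' Nb.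
exists C => // h h0 mh; apply: kernel_power_bound => //.
- by rewrite lee_fin ltW.
- by move=> x z; exact: pker_ge0.
- exact: measurable_pker_dist2.
- exact: (wt_gt0 reg).
- exact: (measurable_wt reg).
- exact: wt_EFin_ge0.
- exact: (measurable_EFin_wt reg).
move=> z; under eq_integral do rewrite add0r pker_poweR//.
apply: (le_trans (HC z)); rewrite lee_fin ler_wpM2l ?(ltW C0)//.
by rewrite /wt -powRrM mulNr.
Qed.

End potential.

(** * The energy *)

(** For [y <= lam] the first term suffices, since [lam ^ th <= lam]; beyond, [y ^ th <= y] and
    [(y / lam) ^ (p - 1) >= 1]. *)
Lemma powR_le_split (R : realType) (y th p lam : R) :
  (0 <= y)%R -> (0 <= th <= 1)%R -> (1 < p)%R -> (1 <= lam)%R ->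
  (y `^ th <= lam + lam `^ (1 - p) * y `^ p)%R.
Proof.
move=> y0 /andP[th0 th1] p1 lam1; have lam0 : (0 < lam)%R by lra.
have c0 : (0 <= lam `^ (1 - p) * y `^ p)%R by rewrite mulr_ge0 ?powR_ge0.
have [ylam|lamy] := leP y lam.
  apply: (@le_trans _ _ lam); last by rewrite lerDl.
  apply: (@le_trans _ _ (lam `^ th)%R); first by rewrite ge0_ler_powR ?nnegrE// ltW.
  by rewrite -[leRHS](powRr1 (ltW lam0)) ler_powR.
have {}y0 : (0 < y)%R by lra.
apply: (@le_trans _ _ y).
  by rewrite -[leRHS](powRr1 (ltW y0)) ler_powR//; lra.
apply: (@le_trans _ _ (lam `^ (1 - p) * y `^ p)%R); last by rewrite lerDr; lra.
have -> : (1 - p = - (p - 1))%R by ring.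
rewrite powRN mulrC ler_pdivlMr ?powR_gt0//.
have -> : (y `^ p = y * y `^ (p - 1))%R.
  by rewrite mulr_powRB1// ?ltW//; lra.
rewrite ler_wpM2l ?(ltW y0)//.
by rewrite ge0_ler_powR ?nnegrE ?subr_ge0; lra.
Qed.

Section energy.
Context d (T : measurableType d) (R : realType).
Variables (mu : {sigma_finite_measure set T -> \bar R}) (dist : T -> T -> R).
Variables (N cL cU : R).
Hypothesis reg : ahlfors_regular mu dist N cL cU.
Variables (o : T) (kap s q : R).
Hypothesis kapN : (0 < kap < N)%R.
Hypothesis s1 : (1 < s)%R.
Hypothesis qs : (1 <= q < s)%R.
Hypothesis crit : ((N - kap) * s < N)%R.
Implicit Types (h f : T -> \bar R).

Local Notation om := (wt dist o).
Local Notation pot := (pot mu dist kap).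
Local Notation vnorm := (vnorm mu dist o kap).

(* Chosen so that [wt kap] to the power [s' = s / (s - 1)] is [wt cexp], which is
   integrable because [kap > N / s']. *)
Definition cexp : R := (kap * (s / (s - 1)))%R.

(** The power of the potential left in the second factor by Hölder's inequality with exponents [s]
    and [s']: it is [(s - q) / s] times [s']. *)
Definition theta : R := ((s - q) / (s - 1))%R.

Lemma theta_itv : (0 < theta <= 1)%R.
Proof.
case/andP: qs => q1 q_s; rewrite /theta divr_gt0/=; try lra.
by rewrite ler_pdivrMr; lra.
Qed.

Lemma N_lt_cexp : (N < cexp)%R.
Proof.
have cr := crit; rewrite /cexp mulrA ltr_pdivlMr ?subr_gt0//; lra.
Qed.

Definition ener_density h x : \bar R :=
  if h x == 0 then 0 else h x `^ s * epow (pot 0 h x) (q - s).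

Definition ener h : \bar R := \int[mu]_x ener_density h x.

Lemma ener_density_ge0 h x : 0 <= ener_density h x.
Proof.
by rewrite /ener_density; case: ifP => // _; rewrite mule_ge0 ?poweR_ge0 ?epow_ge0.
Qed.

Lemma measurable_ener_density h : (forall y, 0 <= h y) ->
  measurable_fun setT h -> measurable_fun setT (ener_density h).
Proof.
move=> h0 mh; apply: measurable_fun_ifT => //; first exact: measurable_fun_eqe.
apply: emeasurable_funM; first exact: measurable_poweRe.
by apply: measurable_epow; exact: (measurable_pot reg).
Qed.

Lemma ener_ge0 h : 0 <= ener h.
Proof. by apply: integral_ge0 => x _; exact: ener_density_ge0. Qed.

Lemma ener_eq0 h : (forall y, 0 <= h y) -> measurable_fun setT h ->
  (\forall y \ae mu, h y = 0) -> ener h = 0.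
Proof.
move=> h0 mh hE; apply: eq0_integral => [x||].
- exact: ener_density_ge0.
- exact: measurable_ener_density.
- by apply: filterS hE => x hx; rewrite /ener_density hx eqxx.
Qed.

Lemma wt_cexp x : ((om kap x) `^ (s / (s - 1)) = om cexp x)%R.
Proof. by rewrite /wt -powRrM mulNr. Qed.

Lemma pot_gt0 h x : (forall y, 0 <= h y) -> measurable_fun setT h ->
  0 < vnorm h -> 0 < pot 0 h x.
Proof.
move=> h0 mh v0; apply: lt_le_trans (pot_ge_vnorm reg o kapN x h0 mh).
by rewrite mule_gt0// lte_fin (wt_gt0 reg).
Qed.

Lemma exists_pot_power : exists p : R, (1 < p)%R /\ (kap * p < N)%R.
Proof.
case/andP: kapN => k0 kN; exists ((1 + N / kap) / 2)%R; split.
  have : (1 < N / kap)%R by rewrite ltr_pdivlMr// mul1r.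
  lra.
have kE : (kap * (N / kap) = N)%R by rewrite mulrC divfK// gt_eqF.
rewrite mulrA mulrDr kE mulr1; lra.
Qed.

Lemma pot_ae_fin h : (forall y, 0 <= h y) -> measurable_fun setT h ->
  vnorm h < +oo -> \forall x \ae mu, pot 0 h x < +oo.
Proof.
move=> h0 mh vh; have [p [p1 kp]] := exists_pot_power.
have p0 : (0 < p)%R by lra.
have [C C0 HC] := wt_pot_power_le reg o kapN p1 kp N_lt_cexp.
have mu_pot := measurable_pot reg kap 0%R h0 mh.
have v_ge0 := vnorm_ge0 reg o kap h0.
have : C%:E * vnorm h `^ p < +oo.
  by rewrite lte_mul_pinfty ?lee_fin ?(ltW C0)// poweR_lty.
move=> /(le_lt_trans (HC h h0 mh)).
move=> /(ae_fin_integral (wtM_ge0 reg o cexp (fun x => poweR_ge0 (pot 0 h x) p))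
  (measurable_wtM reg o cexp (measurable_poweRe p mu_pot))).
apply: filterS => x; case: (pot 0 h x) => [r _||]; rewrite ?ltry//.
by rewrite poweRyr ?gt_eqF// gt0_muley ?ltxx// lte_fin (wt_gt0 reg).
Qed.

(** With [P = pot 0 h], Hölder's inequality is applied to the product of
    [(h ^ s P ^ (q - s)) ^ (1 / s)] and [om P ^ ((s - q) / s)]; the second factor to the power [s']
    is [om cexp P ^ theta]. The threshold [lam] is free: [lam = 1] bounds [vnorm] by the energy, and
    large [lam] gives uniform integrability. *)
Lemma vnorm_restrict_le p : (1 < p)%R -> (kap * p < N)%R ->
  exists2 C : R, (0 < C)%R & forall h (A : T -> bool) (lam : R),
    (forall y, 0 <= h y) -> measurable_fun setT h -> measurable_fun setT A ->
    vnorm h < +oo -> (1 <= lam)%R ->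
    \int[mu]_y ((om kap y)%:E * (ind (A y) * h y)) <=
    ener h `^ s^-1 * (vnorm h `^ theta *
      (lam%:E * \int[mu]_y ((om cexp y)%:E * ind (A y)) +
       (lam `^ (1 - p) * C)%:E)) `^ ((s - 1) / s).
Proof.
move=> p1 kp; have p0 : (0 < p)%R by lra.
have [C C0 HC] := wt_pot_power_le reg o kapN p1 kp N_lt_cexp.
exists C => // h A lam h0 mh mA voo lam1.
case/andP: theta_itv => th0 th1; case/andP: (qs) => q1 q_s.
have s1' := s1; have s0 : (0 < s)%R by lra.
have mI : measurable_fun setT (fun y => ind (A y) : \bar R) by exact: measurable_ind.
have I0 y : 0 <= ind (A y) :> \bar R by exact: ind_ge0.
have RHS0 (X : \bar R) (a : R) : 0 <= ener h `^ s^-1 * X `^ a.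
  by rewrite mule_ge0 ?poweR_ge0.
have mwI b : measurable_fun setT (fun y => (om b y)%:E * ind (A y)).
  exact: (measurable_wtM reg o b mI).
have wI0 b y : 0 <= (om b y)%:E * ind (A y) := wtM_ge0 reg o b I0 y.
have [v0|vn0] := eqVneq (vnorm h) 0.
  have h00 := ae_eq0_of_vnorm reg h0 mh v0.
  rewrite eq0_integral//.
  - by move=> y; rewrite mule_ge0 ?mule_ge0// (wt_EFin_ge0 reg).
  - by apply: (measurable_wtM reg o kap); exact: emeasurable_funM.
  - by apply: filterS h00 => y ->; rewrite !mule0.
have vge0 := vnorm_ge0 reg o kap h0.
have vpos : 0 < vnorm h by rewrite lt0e vn0.
have [M vM M0] : exists2 M : R, vnorm h = M%:E & (0 < M)%R.
  exists (fine (vnorm h)); first by rewrite fineK// ge0_fin_numE.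
  by rewrite fine_gt0// vpos.
pose u := pot 0 h.
have u0 x : 0 < u x by exact: pot_gt0.
have mupot : measurable_fun setT u := measurable_pot reg kap 0%R h0 mh.
have ufin : \forall x \ae mu, u x < +oo by exact: pot_ae_fin.
have hfin := ae_fin_of_vnorm reg h0 mh voo.
pose s' := (s / (s - 1))%R.
have s'0 : (0 < s')%R by rewrite divr_gt0//; lra.
have ss' : (s^-1 + s'^-1 = 1)%R by rewrite /s' invf_div; field; lra.
have s'V : (s'^-1 = (s - 1) / s)%R by rewrite /s' invf_div.
pose f x := ener_density h x `^ s^-1.
pose g x := (om kap x)%:E * ind (A x) * u x `^ ((s - q) / s).
have mf : measurable_fun setT f.
  by apply: measurable_poweRe; exact: measurable_ener_density.
have mg : measurable_fun setT g.
  by apply: emeasurable_funM => //; exact: measurable_poweRe.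
have g0 x : 0 <= g x by rewrite mule_ge0 ?poweR_ge0.
have f0 x : 0 <= f x by exact: poweR_ge0.
have mwIh : measurable_fun setT (fun y => (om kap y)%:E * (ind (A y) * h y)).
  by apply: (measurable_wtM reg o kap); exact: emeasurable_funM.
apply: (@le_trans _ _ (\int[mu]_x (f x * g x))).
  apply: le_ae_integralT => //.
  - by move=> y; rewrite mule_ge0 ?mule_ge0// (wt_EFin_ge0 reg).
  - by move=> x; rewrite mule_ge0.
  - exact: emeasurable_funM.
  apply: filterS2 ufin hfin => x ux hx; rewrite /f /g /ener_density.
  have := u0 x; have := h0 x; rewrite -/(u x).
  case: (u x) ux => [ur _|//|//].
  case: (h x) hx => [hr _|//|//]; rewrite lee_fin lte_fin eqe => hr0 ur0.
  case: ifPn => [/eqP ->|hn0]; first by rewrite !mule0 mule_ge0 ?poweR_ge0// mule_ge0 ?poweR_ge0.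
  have {}hr0 : (0 < hr)%R by rewrite lt0r hn0.
  rewrite epow_pos// !poweR_EFin -!EFinM ?poweR_EFin -?EFinM lee_fin.
  rewrite powRM ?powR_ge0// -!powRrM mulfV ?gt_eqF// powRr1 ?(ltW hr0)//.
  rewrite [leRHS](_ : _ = om kap x * (A x)%:R * hr *
    (ur `^ ((q - s) / s) * ur `^ ((s - q) / s)))%R; last by ring.
  rewrite -powRD_pos// -mulrDl (_ : (q - s + (s - q) = 0)%R); last by ring.
  by rewrite mul0r powRr0 mulr1 mulrA.
apply: (le_trans (hoelder_ereal mu f0 g0 mf mg s0 s'0 ss')).
have -> : \int[mu]_x f x `^ s = ener h.
  by apply: eq_integral => x _; rewrite /f poweR_invK// ener_density_ge0.
rewrite s'V lee_wpmul2l ?poweR_ge0// le_poweR//.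
- by rewrite divr_ge0; lra.
- by apply: integral_ge0 => x _; exact: poweR_ge0.
rewrite vM.
have muu : measurable_fun setT (fun x => u x `^ p) by exact: measurable_poweRe.
(* The potential is measured in units of [M = vnorm h], and [powR_le_split] is applied to the
   quotient; the integral of [om cexp] times its [p]-th power is at most [C M ^ p], which
   [M ^ (- p)] cancels. *)
pose G x := (M `^ theta)%:E * (lam%:E * ((om cexp x)%:E * ind (A x)) +
  (lam `^ (1 - p) * M `^ (- p))%:E * ((om cexp x)%:E * u x `^ p)).
have wu0 x : 0 <= (om cexp x)%:E * u x `^ p by rewrite mule_ge0 ?poweR_ge0 ?(wt_EFin_ge0 reg).
have lam0 : 0 <= lam%:E by rewrite lee_fin; lra.
have c0 (a b : R) : 0 <= (lam `^ a * M `^ b)%:E.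
  by rewrite lee_fin mulr_ge0 ?powR_ge0.
have mwu : measurable_fun setT (fun x => (om cexp x)%:E * u x `^ p).
  exact: (measurable_wtM reg o cexp muu).
have G1 x : 0 <= lam%:E * ((om cexp x)%:E * ind (A x)) +
    (lam `^ (1 - p) * M `^ (- p))%:E * ((om cexp x)%:E * u x `^ p).
  by apply: adde_ge0; apply: mule_ge0.
apply: (@le_trans _ _ (\int[mu]_x G x)).
  apply: le_ae_integralT => [x|x|||].
  - exact: poweR_ge0.
  - by apply: mule_ge0 => //; rewrite lee_fin powR_ge0.
  - exact: measurable_poweRe.
  - apply: emeasurable_funM => //; apply: emeasurable_funD => //.
      exact: emeasurable_funM.
    exact: emeasurable_funM.
  apply: filterS ufin => x ux; rewrite /g /G.
  have := u0 x; case: (u x) ux => [ur _|//|//]; rewrite lte_fin => ur0.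
  have om0 : (0 <= om kap x)%R by rewrite ltW// (wt_gt0 reg).
  rewrite poweRM ?poweR_ge0// poweR_EFin -EFinM.
  rewrite powRM// wt_cexp -powRrM.
  have -> : ((s - q) / s * s' = theta)%R by rewrite /s' /theta; field; lra.
  rewrite -?EFinM -?EFinD -?EFinM lee_fin.
  have omc : (0 <= om cexp x)%R by rewrite ltW// (wt_gt0 reg).
  have th01 : (0 <= theta <= 1)%R by rewrite (ltW th0) th1.
  have e := powR_le_split (divr_ge0 (ltW ur0) (ltW M0)) th01 p1 lam1.
  have Mp : (0 < M `^ theta)%R by rewrite powR_gt0.
  have uE : (ur `^ theta = M `^ theta * (ur / M) `^ theta)%R.
    rewrite -powRM ?divr_ge0 ?(ltW M0) ?(ltW ur0)//.
    by rewrite mulrCA divff ?gt_eqF// mulr1.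
  have upE : ((ur / M) `^ p = ur `^ p * M `^ (- p))%R.
    by rewrite powRM ?invr_ge0 ?(ltW M0) ?(ltW ur0)// powRV ?(ltW M0)// powRN.
  move: e; rewrite upE uE => e.
  case: (A x); rewrite /= ?powR1; last first.
    rewrite powR0 ?gt_eqF// mulr0 mul0r !mulr0 add0r.
    by rewrite !mulr_ge0 ?powR_ge0.
  rewrite !mulr1.
  have -> : (M `^ theta * (lam * om cexp x + lam `^ (1 - p) * M `^ (- p) *
     (om cexp x * ur `^ p)) = om cexp x * (M `^ theta *
     (lam + lam `^ (1 - p) * (ur `^ p * M `^ (- p)))))%R by ring.
  by rewrite ler_wpM2l// ler_wpM2l// ltW.
rewrite /G ge0_integralZl//; last 2 first.
- by apply: emeasurable_funD; exact: emeasurable_funM.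
- by rewrite lee_fin powR_ge0.
rewrite lee_wpmul2l ?lee_fin ?powR_ge0//.
rewrite ge0_integralD//; last 4 first.
- by move=> x _; rewrite mule_ge0.
- exact: emeasurable_funM.
- by move=> x _; rewrite mule_ge0.
- exact: emeasurable_funM.
rewrite !ge0_integralZl// leeD2l//.
apply: (le_trans (lee_wpmul2l (c0 _ _) (HC h h0 mh))).
rewrite vM poweR_EFin -!EFinM lee_fin.
rewrite powRN [leLHS](_ : _ = lam `^ (1 - p) * C * ((M `^ p)^-1 * M `^ p))%R; last by ring.
by rewrite mulVf ?gt_eqF ?powR_gt0// mulr1.
Qed.

End energy.

(** * Stopping radii *)

Lemma measurable_fun_rays d (T : measurableType d) (R : realType) (f : T -> R) :
  (forall r, measurable [set x | (f x < r)%R]) -> measurable_fun setT f.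
Proof.
move=> mf; apply: (measurability (@RGenInftyO.G R)).
  exact: RGenInftyO.measurableE.
move=> _ [_ [r ->] <-]; rewrite setTI.
rewrite (_ : _ @^-1` _ = [set x | (f x < r)%R]); first exact: mf.
by apply/seteqP; split => x /=; rewrite in_itv.
Qed.

Section radius.
Context d (T : measurableType d) (R : realType).
Variables (mu : {sigma_finite_measure set T -> \bar R}) (dist : T -> T -> R).
Variables (N cL cU : R).
Hypothesis reg : ahlfors_regular mu dist N cL cU.
Variables (o : T) (kap : R).
Hypothesis kapN : (0 < kap < N)%R.
Variable h : T -> \bar R.
Hypothesis h0 : forall y, 0 <= h y.
Hypothesis mh : measurable_fun setT h.
Hypothesis voo : vnorm mu dist o kap h < +oo.

Local Notation om := (wt dist o).
Local Notation pot := (pot mu dist kap).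

Let kap0 : (0 < kap)%R. Proof. by case/andP: kapN. Qed.
Let dist_ge0 := ar_ge0 reg.

Lemma mpot r : measurable_fun setT (pot r h).
Proof. exact: (measurable_pot reg). Qed.

Lemma measurable_pker_h r x :
  measurable_fun setT (fun y => pker kap (r + dist x y) * h y).
Proof. by apply: emeasurable_funM => //; exact: (measurable_pker_dist reg). Qed.

(** [dist x' y <= dist x' x + dist x y], so the larger shift makes up for the change of centre. *)
Lemma pot_shift r r' x x' : (0 <= r)%R -> (r + dist x' x <= r')%R ->
  pot r' h x <= pot r h x'.
Proof.
move=> r0 rr'; have d0 := dist_ge0 x' x.
apply: le_integralT => [y|||y].
- by rewrite mule_ge0 ?pker_ge0.
- exact: measurable_pker_h.
- exact: measurable_pker_h.
rewrite lee_wpmul2r//; apply: pker_anti; rewrite ?addr_ge0 ?(ltW kap0)//.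
by have := ar_tri reg x' x y; lra.
Qed.

Lemma pot_anti r r' x : (0 <= r)%R -> (r <= r')%R -> pot r' h x <= pot r h x.
Proof.
move=> r0 rr'; apply: le_integralT => [y|||y].
- by rewrite mule_ge0 ?pker_ge0.
- exact: measurable_pker_h.
- exact: measurable_pker_h.
rewrite lee_wpmul2r//; apply: pker_anti; rewrite ?addr_ge0 ?(ltW kap0)//.
by rewrite lerD2r.
Qed.

Lemma pot_double r x : (0 < r)%R ->
  pot r h x <= (2 `^ kap)%:E * pot (2 * r)%R h x.
Proof.
move=> r0; rewrite -ge0_integralZl//; last 2 first.
- exact: measurable_pker_h.
- by move=> y _; rewrite mule_ge0 ?pker_ge0.
apply: le_integralT => [y|||y].
- by rewrite mule_ge0 ?pker_ge0.
- exact: measurable_pker_h.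
- by apply: emeasurable_funM => //; exact: measurable_pker_h.
have dxy := dist_ge0 x y; rewrite muleA lee_wpmul2r//.
apply: (@le_trans _ _ (pker kap (2^-1 * (2 * r + dist x y)))).
  apply: pker_anti; rewrite ?mulr_ge0 ?invr_ge0 ?(ltW kap0)//; lra.
rewrite pker_scale ?invr_gt0//; last by rewrite addr_ge0//; lra.
by rewrite powRV// powRN invrK.
Qed.

(** Dominated convergence along the shifts [n + 1]: since [1 + dist o y <= (1 + dist o x) (n + 1 +
    dist x y)], the integrands are at most [om kap h] times a constant depending on [x]. *)
Lemma pot_vanishes t x : (0 < t)%R -> exists2 r : R, (0 < r)%R & pot r h x <= t%:E.
Proof.
move=> t0.
pose f n y : \bar R := pker kap (n.+1%:R + dist x y) * h y.
pose g y := ((1 + dist o x) `^ kap)%:E * ((om kap y)%:E * h y).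
have mw := measurable_wtM reg o kap mh.
have g0 y : 0 <= (om kap y)%:E * h y by exact: (wtM_ge0 reg).
have ig : mu.-integrable setT g.
  apply: (integrableZl measurableT); apply/integrableP; split => //.
  by under eq_integral do rewrite gee0_abs//.
have hfin := ae_fin_of_vnorm reg h0 mh voo.
have fg : \forall y \ae mu, forall n : nat, setT y -> `|f n y| <= g y.
  apply: nearW => y n _; rewrite gee0_abs ?mule_ge0 ?pker_ge0//.
  rewrite /g muleA lee_wpmul2r//.
  have dxy := dist_ge0 x y.
  have bx : (0 < 1 + dist o x)%R := wt_base reg o x.
  have by' : (0 < 1 + dist o y)%R := wt_base reg o y.
  have n1 : (1 <= n.+1%:R :> R)%R by rewrite ler1n.
  apply: (@le_trans _ _ (pker kap ((1 + dist o x)^-1 * (1 + dist o y)))).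
    apply: pker_anti; rewrite ?mulr_ge0 ?invr_ge0 ?(ltW kap0) ?(ltW bx) ?(ltW by')//.
    rewrite ler_pdivrMl//; have tri := ar_tri reg o x y.
    have := mulr_ge0 (dist_ge0 o x) dxy.
    have : (1 <= n.+1%:R :> R)%R by [].
    have -> : ((1 + dist o x) * (n.+1%:R + dist x y) =
      (1 + dist o x) * (n.+1%:R - 1) + 1 + dist o x + dist x y +
      dist o x * dist x y)%R by ring.
    have := mulr_ge0 (ltW bx) (_ : 0 <= n.+1%:R - 1)%R; rewrite subr_ge0.
    move=> /(_ n1); lra.
  rewrite pker_scale ?invr_gt0// ?(ltW by')// powRV ?(ltW bx)// powRN invrK.
  by rewrite pker_gt0E.
have cvf : \forall y \ae mu, setT y -> f n y @[n --> \oo] --> (cst 0 : T -> \bar R) y.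
  apply: filterS hfin => y hy _; rewrite /f.
  have hE : h y = (fine (h y))%:E by rewrite fineK// ge0_fin_numE.
  rewrite hE.
  rewrite (_ : (fun n => _) = EFin \o (fun n =>
     (n.+1%:R + dist x y) `^ (- kap) * fine (h y)))%R; last first.
    apply/funext => n /=; rewrite pker_gt0E -?EFinM//.
    by rewrite ltr_pwDl.
  apply: cvg_EFin; first exact: nearW.
  rewrite /= -[X in _ --> X](mul0r (fine (h y))).
  apply: cvgMl.
  apply/cvgrPdist_lt => e e0; near=> n.
  rewrite sub0r normrN ger0_norm ?powR_ge0// powRN.
  have B : (0 < n.+1%:R + dist x y)%R by rewrite ltr_pwDl.
  rewrite invf_plt ?posrE ?powR_gt0//.
  have -> : (e^-1 = (e^-1 `^ kap^-1) `^ kap)%R.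
    by rewrite -powRrM mulVf ?gt_eqF// powRr1// invr_ge0 ltW.
  apply: gt0_ltr_powR => //; rewrite ?nnegrE ?powR_ge0 ?(ltW B)//.
  apply: (@lt_le_trans _ _ n.+1%:R); last by rewrite lerDl.
  apply: (lt_le_trans (truncnS_gt _)); rewrite ler_nat ltnS.
  by near: n; exact: nbhs_infty_ge.
have [_ _] := dominated_convergence measurableT
  (fun n => measurable_pker_h n.+1%:R x) (measurable_cst _) cvf ig fg.
rewrite integral0 => cv0.
have te0 : 0 < t%:E by rewrite lte_fin.
have [n _ /(_ n (leqnn n)) /= /ltW] := cv0 _ (open_ereal_lt' te0).
by exists n.+1%:R.
Unshelve. all: by end_near. Qed.

Variable t : R.
Hypothesis t0 : (0 < t)%R.

Definition rad_set z : set R := [set r | (0 < r)%R /\ pot r h z <= t%:E].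

(* The radius at which the truncated potential at [z] drops to the level [t]; it
   vanishes where the potential is already at most [t], and it is 1-Lipschitz. *)
Definition rad z : R := inf (rad_set z).

Lemma rad_set_has_inf z : has_inf (rad_set z).
Proof.
split; last by exists 0%R => r [/ltW].
by have [r r0 rt] := pot_vanishes z t0; exists r.
Qed.

Lemma rad_ge0 z : (0 <= rad z)%R.
Proof. by apply: lb_le_inf; [exact: (rad_set_has_inf z).1|move=> r [/ltW]]. Qed.

Lemma rad_le r z : (0 < r)%R -> pot r h z <= t%:E -> (rad z <= r)%R.
Proof. by move=> r0 rt; apply: ge_inf; [exact: (rad_set_has_inf z).2|]. Qed.

Lemma pot_gt_of_lt_rad r z : (0 < r)%R -> (r < rad z)%R -> t%:E < pot r h z.
Proof. by move=> r0 rr; rewrite ltNge; apply/negP => /(rad_le r0); rewrite leNgt rr. Qed.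

Lemma pot_le_of_rad_lt r z : (rad z < r)%R -> pot r h z <= t%:E.
Proof.
move=> rr; have e0 : (0 < r - rad z)%R by rewrite subr_gt0.
have [r' [r'0 r't]] := inf_adherent e0 (rad_set_has_inf z).
by rewrite -/(rad z) subrKC => /ltW /(pot_anti z (ltW r'0)) /le_trans; apply.
Qed.

Lemma rad_lipschitz x z : (rad z <= rad x + dist x z)%R.
Proof.
apply/ler_addgt0Pr => e e0; rewrite addrAC.
have re : (0 < rad x + e)%R by rewrite ltr_wpDl// rad_ge0.
apply: rad_le; first by rewrite ltr_wpDr.
apply: (le_trans (pot_shift (ltW re) (lexx _))).
by apply: pot_le_of_rad_lt; rewrite ltrDl.
Qed.

(** [rad x < r] exactly when the level bound holds at some positive shift [r - 1 / (n + 1)], which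
    writes the set as a countable union. *)
Lemma measurable_rad : measurable_fun setT rad.
Proof.
apply: measurable_fun_rays => r.
rewrite (_ : [set x | _] = \bigcup_(n : nat)
   ([set x | pot (r - n.+1%:R^-1)%R h x <= t%:E] `&`
    [set x | 0 < r - n.+1%:R^-1]%R)); last first.
  apply/seteqP; split => [x /= xr|x [n _ [/= pt r0]]]; last first.
    by apply: (le_lt_trans (rad_le r0 pt)); rewrite ltrBlDr ltrDl invr_gt0.
  have e0 : (0 < (r - rad x)^-1)%R by rewrite invr_gt0 subr_gt0.
  have nr : ((Num.trunc (r - rad x)^-1).+1%:R^-1 < r - rad x)%R.
    by rewrite invf_plt ?posrE ?subr_gt0//; exact: truncnS_gt.
  exists (Num.trunc (r - rad x)^-1) => //; split => /=.
    by apply: pot_le_of_rad_lt; rewrite ltrBrDr -ltrBrDl.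
  by rewrite subr_gt0 (lt_le_trans nr)// gerBl rad_ge0.
apply: bigcupT_measurable => n; apply: measurableI.
  rewrite -[X in measurable X]setTI.
  exact: (emeasurable_fun_infty_c measurableT (mpot _)).
have [r0|r0] := ltP 0%R (r - n.+1%:R^-1)%R.
  by rewrite (_ : [set x | _] = setT)//; apply/seteqP; split.
by rewrite (_ : [set x | _] = set0)//; apply/seteqP; split.
Qed.

Lemma dist_eq0_negligible z : mu [set y | (dist z y <= 0)%R] = 0.
Proof.
have mE r : measurable [set y | (dist z y <= r)%R].
  by apply: measurable_bool_set; apply: measurable_fun_ler => //; exact: (measurable_dist reg).
have mB r : measurable [set y | (dist z y < r)%R].
  by apply: measurable_bool_set; apply: measurable_fun_ltr => //; exact: (measurable_dist reg).
have N0 := ar_dim reg; have cU0 := ar_cU reg.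
apply/eqP; rewrite eq_le measure_ge0 andbT.
apply/lee_addgt0Pr => e e0; rewrite add0e.
(* This radius makes [cU r ^ N] equal to [e]. *)
pose r := ((e / cU) `^ N^-1)%R.
have r0 : (0 < r)%R by rewrite powR_gt0// divr_gt0.
apply: (@le_trans _ _ (mu [set y | (dist z y < r)%R])).
  by apply: le_measure; rewrite ?inE// => y /= yz; exact: le_lt_trans r0.
apply: (le_trans (ar_upper reg z r0)); rewrite lee_fin /r -powRrM.
rewrite mulVf ?gt_eqF// powRr1 ?divr_ge0 ?(ltW e0) ?(ltW cU0)//.
by rewrite mulrC divfK// gt_eqF.
Qed.

(** Where [dist z y >= e] the untruncated kernel is at most [2 ^ kap] times the kernel shifted by
    [e], because [dist z y >= (e + dist z y) / 2]. All positive shifts satisfy the level bound here,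
    so [e = 1 / (n + 1)] and monotone convergence give the estimate off the set [dist z y <= 0],
    which is null. *)
Lemma pot_le_of_rad_eq0 z : (rad z <= 0)%R -> pot 0 h z <= (2 `^ kap * t)%:E.
Proof.
move=> z0.
have md n : measurable_fun setT (fun y => n.+1%:R^-1 <= dist z y)%R.
  by apply: measurable_fun_ler => //; exact: (measurable_dist reg).
have md0 : measurable_fun setT (fun y => 0 < dist z y)%R.
  by apply: measurable_fun_ltr => //; exact: (measurable_dist reg).
pose F y := pker kap (0 + dist z y) * h y.
have F0 y : 0 <= F y by rewrite mule_ge0 ?pker_ge0.
have mF : measurable_fun setT F by exact: measurable_pker_h.
pose g n y : \bar R := ind (n.+1%:R^-1 <= dist z y)%R * F y.
have mg n : measurable_fun setT (g n).
  by apply: emeasurable_funM => //; exact: measurable_ind.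
have g0 n y : setT y -> 0 <= g n y by rewrite mule_ge0 ?ind_ge0.
have ndg y : setT y -> {homo g ^~ y : n m / (n <= m)%N >-> n <= m}.
  move=> _ n m nm; rewrite lee_wpmul2r// lee_fin ler_nat.
  case: (leP (n.+1%:R^-1)%R (dist z y)) => // yn; rewrite lt0n eqb0 negbK.
  apply: le_trans yn; rewrite lef_pV2 ?posrE//.
  by rewrite ler_nat ltnS.
have gn n : \int[mu]_y g n y <= (2 `^ kap * t)%:E.
  have n0 : (0 < n.+1%:R^-1 :> R)%R by rewrite invr_gt0.
  have tn : pot n.+1%:R^-1 h z <= t%:E.
    by apply: pot_le_of_rad_lt; exact: le_lt_trans n0.
  apply: (@le_trans _ _ ((2 `^ kap)%:E * pot n.+1%:R^-1 h z)); last first.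
    by rewrite EFinM lee_wpmul2l// lee_fin powR_ge0.
  rewrite -ge0_integralZl//; last 2 first.
  - exact: measurable_pker_h.
  - by move=> y _; rewrite mule_ge0 ?pker_ge0.
  apply: le_integralT => // [y||y].
  - exact: g0.
  - by apply: emeasurable_funM => //; exact: measurable_pker_h.
  rewrite /g; case: (leP (n.+1%:R^-1)%R (dist z y)) => yn; last first.
    by rewrite mul0e !mule_ge0 ?pker_ge0 ?lee_fin ?powR_ge0.
  rewrite mul1e /F muleA lee_wpmul2r//.
  have := dist_ge0 z y => dzy; clear tn.
  move: (n.+1%:R^-1)%R n0 yn => e n0 yn.
  apply: (@le_trans _ _ (pker kap (2^-1 * (e + dist z y)))).
    apply: pker_anti; rewrite ?mulr_ge0 ?invr_ge0 ?addr_ge0 ?(ltW kap0) ?(ltW n0)//; lra.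
  rewrite pker_scale ?invr_gt0 ?addr_ge0 ?(ltW n0)//.
  by rewrite powRV// powRN invrK.
have cvg_g := @cvg_monotone_convergence _ _ _ mu _ measurableT _ mg g0 ndg.
apply: (@le_trans _ _ (\int[mu]_y limn (g ^~ y))).
  have limE y : limn (g ^~ y) = ind (0 < dist z y)%R * F y.
    apply/cvg_lim => //; apply: cvg_near_cst.
    near=> n; rewrite /g; congr (ind _ * _).
    case: ltP => [zy|zy].
      rewrite -[leRHS]invrK lef_pV2 ?posrE ?invr_gt0//.
      apply: (le_trans (ltW (truncnS_gt _))); rewrite ler_nat ltnS.
      by near: n; exact: nbhs_infty_ge.
    by apply/negbTE; rewrite -ltNge (le_lt_trans zy)// invr_gt0.
  apply: le_ae_integralT => //.
  - by move=> y; rewrite limE mule_ge0 ?ind_ge0.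
  - rewrite (_ : (fun _ => _) = fun y => ind (0 < dist z y)%R * F y).
      by apply: emeasurable_funM => //; exact: measurable_ind.
    by apply/funext => y; rewrite limE.
  exists [set y | (dist z y <= 0)%R]; split.
  - by apply: measurable_bool_set; apply: measurable_fun_ler => //; exact: (measurable_dist reg).
  - exact: dist_eq0_negligible.
  move=> y /= nle; rewrite leNgt; apply/negP => zy.
  by apply: nle; rewrite limE zy mul1e.
rewrite -(cvg_lim _ cvg_g)//; apply: lime_le; last exact: nearW.
by apply/cvg_ex; eexists; exact: cvg_g.
Unshelve. all: by end_near. Qed.

Lemma pot_gt_of_rad_gt0 z : (0 < rad z)%R -> t%:E < pot 0 h z.
Proof.
move=> z0; have z2 : (0 < rad z / 2)%R by rewrite divr_gt0.
apply: (lt_le_trans (pot_gt_of_lt_rad z2 _)); first by lra.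
by apply: pot_anti => //; exact: ltW.
Qed.

(** Shifts beyond the infimum satisfy the level bound; [2 * rad y] is one, and halving it costs
    [2 ^ kap]. *)
Lemma pot_rad_le y : (0 < rad y)%R -> pot (rad y) h y <= (2 `^ kap * t)%:E.
Proof.
move=> y0; apply: (le_trans (pot_double _ y0)).
rewrite EFinM lee_wpmul2l ?lee_fin ?powR_ge0//.
by apply: pot_le_of_rad_lt; lra.
Qed.

End radius.

(** * Sweeping *)

Section ereal_power.
Context {R : realType}.

Lemma poweR_add_le (x y : \bar R) (s : R) : (0 < s)%R -> 0 <= x -> 0 <= y ->
  (x + y) `^ s <= (2 `^ s)%:E * (x `^ s + y `^ s).
Proof.
move=> s0; wlog xy : x y / x <= y => [H x0 y0|x0 y0].
  by have [/H|/ltW/H] := leP x y; [|rewrite addeC [_ `^ _ + _]addeC]; exact.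
apply: (@le_trans _ _ ((2%:E * y) `^ s)).
  apply: le_poweR; rewrite ?adde_ge0 ?(ltW s0)//.
  by rewrite mule_natl mule2n leeD2r.
rewrite poweRM// lee_wpmul2l ?lee_fin ?powR_ge0//.
by rewrite leeDr// poweR_ge0.
Qed.

Lemma poweR_le_split (x : \bar R) (th p t : R) : (0 < th <= p)%R -> (0 < t)%R ->
  0 <= x -> x `^ th <= (t `^ th)%:E * (1 + (t `^ (- p))%:E * x `^ p).
Proof.
move=> /andP[th0 thp] t0; have p0 : (0 < p)%R by exact: lt_le_trans thp.
case: x => [x||//]; last first.
  move=> _; rewrite !poweRyr ?gt_eqF// gt0_muley ?lte_fin ?powR_gt0//.
  by rewrite addey// gt0_muley// lte_fin powR_gt0.
rewrite lee_fin => x0; rewrite !poweR_EFin -!EFinM lee_fin.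
have -> : (x `^ th = t `^ th * (x / t) `^ th)%R.
  rewrite -powRM ?divr_ge0 ?(ltW t0)//.
  by rewrite mulrCA divff ?gt_eqF// mulr1.
have -> : (t `^ (- p) * x `^ p = (x / t) `^ p)%R.
  by rewrite powRM ?invr_ge0 ?(ltW t0)// powRV ?(ltW t0)// powRN mulrC.
rewrite ler_wpM2l ?powR_ge0//.
have y0 : (0 <= x / t)%R by rewrite divr_ge0 ?(ltW t0).
move: (x / t)%R y0 => y y0; have [y1|y1] := leP y 1%R.
  apply: (@le_trans _ _ 1%R); last by rewrite lerDl powR_ge0.
  apply: (@le_trans _ _ (1 `^ th)%R); last by rewrite powR1.
  by rewrite ge0_ler_powR ?nnegrE// ltW.
apply: (@le_trans _ _ (y `^ p)%R); last by rewrite lerDr.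
by rewrite ler_powR// ltW.
Qed.

End ereal_power.

(** Here [r] and [e] are the stopping radii at [x] and [z], and [y] runs through the ball over which
    the mass at [z] is spread. Seen from [x], spreading moves it at most to three times the distance
    shifted by [r / 2]. *)
Lemma sweep_arith (R : realFieldType) (dxz dxy dzy e r : R) :
  (0 <= dxz -> 0 < r -> dxy <= dxz + dzy -> dzy < e / 2 -> e <= r + dxz ->
  dxy <= 3 * (r / 2 + dxz))%R.
Proof. by move=> *; lra. Qed.

Section sweeping.
Context d (T : measurableType d) (R : realType).
Variables (mu : {sigma_finite_measure set T -> \bar R}) (dist : T -> T -> R).
Variables (N cL cU : R).
Hypothesis reg : ahlfors_regular mu dist N cL cU.
Variables (o : T) (kap : R).
Hypothesis kapN : (0 < kap < N)%R.

Local Notation om := (wt dist o).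
Local Notation pot := (pot mu dist kap).
Local Notation vnorm := (vnorm mu dist o kap).
Local Notation rad := (rad mu dist kap).

Let kap0 : (0 < kap)%R. Proof. by case/andP: kapN. Qed.
Let dist_ge0 := ar_ge0 reg.
Let N0 := ar_dim reg.
Let cL0 := ar_cL reg.
Let cU0 := ar_cU reg.

(** The ball about [z] has half the stopping radius, so that by the Lipschitz bound the radii at [y]
    and [z] are comparable wherever the kernel is nonzero. The power [- N] normalises the mass in
    [y] up to constants. *)
Definition spread h t y z : \bar R :=
  ind (2 * dist y z < rad h t z)%R * (rad h t z `^ (- N))%:E.

(* The part of [h] where the potential exceeds [t] is averaged over balls of the
   stopping radius; the potential stays above a multiple of [t] while the [L^s]
   norm becomes controlled by the energy. *)
Definition sweep h t y : \bar R :=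
  ind (rad h t y <= 0)%R * h y + \int[mu]_z (spread h t y z * h z).

Lemma spread_ge0 h t y z : 0 <= spread h t y z.
Proof. by rewrite mule_ge0 ?ind_ge0 ?lee_fin ?powR_ge0. Qed.

Section fixed.
Variable h : T -> \bar R.
Hypothesis h0 : forall y, 0 <= h y.
Hypothesis mh : measurable_fun setT h.
Hypothesis voo : vnorm h < +oo.
Variable t : R.
Hypothesis t0 : (0 < t)%R.

Lemma mrad : measurable_fun setT (rad h t).
Proof. exact: (measurable_rad reg kapN h0 mh voo t0). Qed.

Lemma measurable_spread : measurable_fun setT (fun p : T * T => spread h t p.1 p.2).
Proof.
have mr2 : measurable_fun setT (fun p : T * T => rad h t p.2).
  exact: (measurable_snd_comp mrad).
apply: emeasurable_funM; last exact: measurable_EFin_powR.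
apply: measurable_ind; apply: measurable_fun_ltr => //.
by apply: measurable_funM => //; exact: (ar_meas reg).
Qed.

Lemma measurable_spread_h :
  measurable_fun setT (fun p : T * T => spread h t p.1 p.2 * h p.2).
Proof.
by apply: emeasurable_funM; [exact: measurable_spread|exact: measurable_snd_comp].
Qed.

Lemma spread_h_ge0 y z : 0 <= spread h t y z * h z.
Proof. by rewrite mule_ge0 ?spread_ge0. Qed.

Lemma sweep_ge0 y : 0 <= sweep h t y.
Proof.
rewrite adde_ge0 ?mule_ge0 ?ind_ge0//.
by apply: integral_ge0 => z _; exact: spread_h_ge0.
Qed.

Lemma measurable_ind_rad : measurable_fun setT
  (fun y => ind (rad h t y <= 0)%R : \bar R).
Proof. by apply: measurable_ind; apply: measurable_fun_ler => //; exact: mrad. Qed.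

Lemma measurable_ind_rad_gt0 : measurable_fun setT
  (fun y => ind (0 < rad h t y)%R : \bar R).
Proof. by apply: measurable_ind; apply: measurable_fun_ltr => //; exact: mrad. Qed.

Lemma measurable_swept : measurable_fun setT
  (fun y => \int[mu]_z (spread h t y z * h z)).
Proof. exact: (measurable_integral_snd mu spread_h_ge0 measurable_spread_h). Qed.

Lemma measurable_sweep : measurable_fun setT (sweep h t).
Proof.
apply: emeasurable_funD; last exact: measurable_swept.
by apply: emeasurable_funM => //; exact: measurable_ind_rad.
Qed.

Lemma spread_mass z :
  \int[mu]_y spread h t y z <= cU%:E * ind (0 < rad h t z)%R.
Proof.
have [rz|rz] := ltP 0%R (rad h t z); last first.
  rewrite mule0 integral0_eq// => y _; rewrite /spread.
  case: ltP => [yz|_]; last by rewrite mul0e.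
  by exfalso; have := dist_ge0 y z; lra.
rewrite mule1 ge0_integralZr//; last 3 first.
- apply: measurable_ind; apply: measurable_fun_ltr => //.
  by apply: measurable_funM => //; exact: (measurable_dist_fst reg).
- by move=> y _; exact: ind_ge0.
- by rewrite lee_fin powR_ge0.
have rz2 : (0 < rad h t z / 2)%R by rewrite divr_gt0.
have -> : \int[mu]_y ind (2 * dist y z < rad h t z)%R =
    \int[mu]_y ind (dist z y < rad h t z / 2)%R.
  apply: eq_integral => y _; congr ind.
  by rewrite (ar_sym reg) ltr_pdivlMr// mulrC.
apply: (le_trans (lee_wpmul2r _ (integral_ind_ball reg z rz2))).
  by rewrite lee_fin powR_ge0.
rewrite -EFinM lee_fin powRM ?(ltW rz)// powRN -mulrA.
rewrite mulrAC mulfV ?gt_eqF ?powR_gt0// mul1r.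
rewrite ger_pMr// powRV// invf_le1 ?powR_gt0//.
apply: (@le_trans _ _ (1 `^ N)%R); first by rewrite powR1.
by rewrite ge0_ler_powR ?nnegrE ?(ltW N0)// ler1n.
Qed.

End fixed.

(** Mass at [z] stays in place or moves by less than half of [rad z]; by [sweep_arith] the swept
    potential at [x] is then at least a multiple of the potential of [h] shifted by half of [rad x].
    The latter exceeds [t], being taken below the stopping radius, which is positive by
    [pot_le_of_rad_eq0]. *)
Lemma sweep_lower : exists2 c : R, (0 < c)%R & forall h t x,
  (forall y, 0 <= h y) -> measurable_fun setT h -> vnorm h < +oo ->
  (0 < t)%R -> (2 `^ kap * t)%:E < pot 0 h x ->
  (c * t)%:E <= pot 0 (sweep h t) x.
Proof.
(* [3 ^ (- kap)] is the loss in the kernel and [cL 2 ^ (- N)] the least mass of [spread] about [z];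
   the [1] in the minimum below is for points that are not moved. *)
pose c1 := (3 `^ (- kap) * (cL * 2^-1 `^ N))%R.
have c10 : (0 < c1)%R by rewrite !mulr_gt0 ?powR_gt0 ?cL0// invr_gt0.
pose c := Order.min 1%R c1.
have c0 : (0 < c)%R by rewrite lt_min c10 ltr01.
exists c => // h t x h0 mh voo t0 tx.
have mr := mrad h0 mh voo t0.
have xr : (0 < rad h t x)%R.
  rewrite ltNge; apply/negP => xr; move: tx.
  by rewrite ltNge (pot_le_of_rad_eq0 reg kapN h0 mh voo t0 xr).
have [r rE] : exists r, rad h t x = r by exists (rad h t x).
rewrite rE in xr.
have r2 : (0 < r / 2)%R by rewrite divr_gt0.
have tr : t%:E < pot (r / 2) h x.
  apply: (pot_gt_of_lt_rad reg kapN h0 mh voo t0 r2).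
  by rewrite rE; lra.
have mI := measurable_ind_rad h0 mh voo t0.
have mI' := measurable_ind_rad_gt0 h0 mh voo t0.
have mSh := measurable_spread_h h0 mh voo t0.
have Sh0 := spread_h_ge0 h0 t.
have mpk a : measurable_fun setT (fun y => pker kap (a + dist x y)).
  exact: (measurable_pker_dist reg).
have mpk2 : measurable_fun setT (fun p : T * T =>
    pker kap (0 + dist x p.1) * (spread h t p.1 p.2 * h p.2)).
  by apply: emeasurable_funM => //; exact: (measurable_fst_comp (mpk 0%R)).
have pk20 y z : 0 <= pker kap (0 + dist x y) * (spread h t y z * h z).
  by rewrite mule_ge0 ?pker_ge0.
have potE : pot 0 (sweep h t) x =
    \int[mu]_z (pker kap (0 + dist x z) * (ind (rad h t z <= 0)%R * h z)) +
    \int[mu]_z \int[mu]_y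
      (pker kap (0 + dist x y) * (spread h t y z * h z)).
  rewrite -tonelli// -ge0_integralD//; last 4 first.
  - by move=> z _; rewrite !mule_ge0 ?pker_ge0 ?ind_ge0.
  - by do 2 apply: emeasurable_funM => //.
  - by move=> y _; exact: integral_ge0.
  - exact: (measurable_integral_snd mu pk20 mpk2).
  apply: eq_integral => y _; rewrite /sweep ge0_muleDr ?mule_ge0 ?ind_ge0//.
    rewrite ge0_integralZl ?pker_ge0//.
    exact: (measurable_section y mSh).
  exact: integral_ge0.
rewrite potE -ge0_integralD//; last 4 first.
- by move=> z _; rewrite !mule_ge0 ?pker_ge0 ?ind_ge0.
- by do 2 apply: emeasurable_funM => //.
- by move=> z _; exact: integral_ge0.
- exact: (measurable_integral_fst mu pk20 mpk2).
apply: (@le_trans _ _ (c%:E * pot (r / 2) h x)).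
  by rewrite EFinM lee_wpmul2l ?lee_fin ?ltW.
rewrite -ge0_integralZl//; last 3 first.
- by apply: emeasurable_funM.
- by move=> z _; rewrite mule_ge0 ?pker_ge0.
- by rewrite lee_fin ltW.
apply: le_integralT => [z|||z].
- by apply: mule_ge0; [rewrite lee_fin ltW|rewrite mule_ge0 ?pker_ge0].
- by do 2 apply: emeasurable_funM => //.
- apply: emeasurable_funD; first by do 2 apply: emeasurable_funM => //.
  exact: (measurable_integral_fst mu pk20 mpk2).
have dxz := dist_ge0 x z.
have [rz|rz] := leP (rad h t z) 0%R.
  rewrite mul1e; apply: (@le_trans _ _ (pker kap (0 + dist x z) * h z)); last first.
    by rewrite leeDl//; exact: integral_ge0.
  rewrite muleA lee_wpmul2r//.
  apply: (@le_trans _ _ (1 * pker kap (r / 2 + dist x z))).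
    by rewrite lee_wpmul2r ?pker_ge0// lee_fin ge_min lexx.
  have r20 : (0 <= r / 2)%R by exact: ltW.
  by rewrite mul1e; apply: pker_anti; rewrite ?add0r ?lerDr// ltW.
rewrite mul0e mule0 add0e.
have lip : (rad h t z <= r + dist x z)%R.
  by rewrite -rE; exact: (rad_lipschitz reg kapN h0 mh voo t0).
have [e eE] : exists e, rad h t z = e by exists (rad h t z).
rewrite eE in lip rz.
have rz2 : (0 < e / 2)%R by rewrite divr_gt0.
have P0 : (0 < r / 2 + dist x z)%R by rewrite ltr_pwDl.
apply: (@le_trans _ _ (\int[mu]_y
   (((3 * (r / 2 + dist x z)) `^ (- kap) * e `^ (- N))%:E * h z *
    ind (dist z y < e / 2)%R))); last first.
  apply: le_integralT => [y|||y].
  - by rewrite !mule_ge0 ?ind_ge0// lee_fin mulr_ge0 ?powR_ge0.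
  - by apply: emeasurable_funM => //; exact: (measurable_ind_ball reg).
  - exact: (measurable_section_fst z mpk2).
  have dzy := dist_ge0 z y.
  case: ltP => yz; last by rewrite mule0 mule_ge0 ?pker_ge0.
  rewrite mule1 /spread eE (ar_sym reg y z).
  rewrite (_ : (2 * dist z y < e)%R = true); last by rewrite mulrC -ltr_pdivlMr.
  rewrite mul1e muleA lee_wpmul2r// EFinM lee_wpmul2r ?lee_fin ?powR_ge0//.
  rewrite -pker_gt0E ?mulr_gt0// add0r; apply: pker_anti => //; first exact: ltW.
  exact: (sweep_arith dxz xr (ar_tri reg x z y) yz lip).
rewrite ge0_integralZl//; last 3 first.
- exact: (measurable_ind_ball reg).
- by move=> y _; exact: ind_ge0.
- by rewrite mule_ge0// lee_fin mulr_ge0 ?powR_ge0.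
apply: (@le_trans _ _ (((3 * (r / 2 + dist x z)) `^ (- kap) *
    e `^ (- N))%:E * h z * (cL * (e / 2) `^ N)%:E)); last first.
  rewrite lee_wpmul2l ?mule_ge0 ?lee_fin ?mulr_ge0 ?powR_ge0//.
  exact: (integral_ind_ball_ge reg).
rewrite muleA [leRHS]muleAC lee_wpmul2r// pker_gt0E// -!EFinM lee_fin.
apply: (@le_trans _ _ (c1 * (r / 2 + dist x z) `^ (- kap))%R).
  by rewrite ler_wpM2r ?powR_ge0// ge_min lexx orbT.
rewrite powRM ?(ltW P0)// (powRM _ (ltW rz)) ?invr_ge0// /c1.
rewrite [leRHS](_ : _ = 3 `^ (- kap) * (cL * 2^-1 `^ N) *
  (r / 2 + dist x z) `^ (- kap) * (e `^ (- N) * e `^ N))%R; last by ring.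
by rewrite -powRD_pos// addNr powRr0 mulr1.
Qed.

End sweeping.

(** * The [L^s] norm of the swept function *)

Section sweep_upper.
Context d (T : measurableType d) (R : realType).
Variables (mu : {sigma_finite_measure set T -> \bar R}) (dist : T -> T -> R).
Variables (N cL cU : R).
Hypothesis reg : ahlfors_regular mu dist N cL cU.
Variables (o : T) (kap s q p : R).
Hypothesis kapN : (0 < kap < N)%R.
Hypothesis s1 : (1 < s)%R.
Hypothesis qs : (1 <= q < s)%R.
Hypothesis p1 : (1 < p)%R.
Hypothesis kp : (kap * p < N)%R.

Local Notation om := (wt dist o).
Local Notation pot := (pot mu dist kap).
Local Notation vnorm := (vnorm mu dist o kap).
Local Notation rad := (rad mu dist kap).
Local Notation spread := (spread mu dist N kap).
Local Notation sweep := (sweep mu dist N kap).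

Let kap0 : (0 < kap)%R. Proof. by case/andP: kapN. Qed.
Let dist_ge0 := ar_ge0 reg.
Let N0 := ar_dim reg.
Let cU0 := ar_cU reg.

(** The largest surplus for which [aexp / (s - 1) <= p] holds for every [q >= 1]; its positivity
    makes the sum over the levels below the potential converge. *)
Definition gain : R := ((p - 1) * (s - 1))%R.

Lemma gain_gt0 : (0 < gain)%R.
Proof. by rewrite mulr_gt0 ?subr_gt0. Qed.

Definition aexp : R := (s - q + gain)%R.

Lemma aexp_gt0 : (0 < aexp)%R.
Proof. by case/andP: qs => q1 q_s; rewrite addr_gt0 ?gain_gt0 ?subr_gt0. Qed.

(** By [pker_integral_ball_off] the average over the ball of the kernel to the power [p] is at most
    a multiple of the kernel shifted by [r], to the power [p]; [kernel_power_bound] carries this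
    reverse Hölder inequality over to potentials. *)
Lemma pot_power_ball : exists2 C : R, (0 < C)%R & forall h y r,
  (forall y, 0 <= h y) -> measurable_fun setT h -> (0 < r)%R ->
  \int[mu]_x (ind (dist y x < r)%R * pot 0 h x `^ p) <=
  (C * r `^ N)%:E * pot r h y `^ p.
Proof.
have p0 : (0 < p)%R by have := p1; lra.
have kp' : (0 < kap * p < N)%R by rewrite mulr_gt0.
have [C C0 HC] := pker_integral_ball_off reg kp'.
exists C => // h y r h0 mh r0.
have rd z : (0 < r + dist y z)%R by rewrite ltr_wpDr.
have -> : pot r h y = \int[mu]_z (((r + dist y z) `^ (- kap))%:E * h z).
  by apply: eq_integral => z _; rewrite pker_gt0E.
apply: (@kernel_power_bound _ _ _ mu p _ (fun x z => pker kap (0 + dist x z))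
  (fun z => (r + dist y z) `^ (- kap))%R) => //.
- by rewrite lee_fin mulr_ge0 ?powR_ge0 ?ltW.
- by move=> x z; exact: pker_ge0.
- exact: (measurable_pker_dist2 reg).
- by move=> z; rewrite powR_gt0.
- apply/measurable_EFinP; apply: measurable_EFin_powR.
  by apply: measurable_funD => //; exact: (measurable_dist reg).
- by move=> x; exact: ind_ge0.
- exact: (measurable_ind_ball reg).
move=> z; under eq_integral do rewrite add0r pker_poweR//.
apply: (le_trans (HC y z r r0)); rewrite -EFinM lee_fin.
by rewrite -powRrM mulNr mulrA.
Qed.

(** By the Lipschitz bound, all [z] with nonzero [spread h t y z] lie in the ball about [y] of
    radius [r = rad h t y] and satisfy [rad h t z >= r / 2]; if [r] vanishes there are none. The
    reverse Hölder inequality applies on that ball, and [pot r h y] is at most a multiple of [t]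
    because [r] is the stopping radius. *)
Lemma spread_pot_power : exists2 C : R, (0 < C)%R & forall h t y th,
  (forall y, 0 <= h y) -> measurable_fun setT h -> vnorm h < +oo ->
  (0 < t)%R -> (0 < th <= p)%R ->
  \int[mu]_z (spread h t y z * pot 0 h z `^ th) <= (C * t `^ th)%:E.
Proof.
have p0 : (0 < p)%R by have := p1; lra.
have [C C0 HC] := pot_power_ball.
pose K := ((2^-1 `^ (- N)) * (cU + C * 2 `^ (kap * p)))%R.
have K0 : (0 < K)%R.
  by rewrite mulr_gt0 ?powR_gt0 ?invr_gt0// addr_gt0// mulr_gt0// powR_gt0.
exists K => // h t y th h0 mh voo t0 thp.
have mu_ : measurable_fun setT (pot 0 h) by exact: (measurable_pot reg).
have u0 z : 0 <= pot 0 h z by exact: (pot_ge0 mu dist).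
have mSp := measurable_spread reg kapN h0 mh voo t0.
have Sp0 z : 0 <= spread h t y z by exact: spread_ge0.
have mr := mrad reg kapN h0 mh voo t0.
have r0 z : (0 <= rad h t z)%R by exact: (rad_ge0 reg kapN h0 mh voo t0).
have lip x z : (rad h t z <= rad h t x + dist x z)%R.
  exact: (rad_lipschitz reg kapN h0 mh voo t0).
have [ry|ry] := leP (rad h t y) 0%R.
  have Kt : 0 <= (K * t `^ th)%:E by rewrite lee_fin mulr_ge0 ?powR_ge0// ltW.
  rewrite integral0_eq// => z _.
  rewrite /spread; case: ltP => [yz|_]; last by rewrite !mul0e.
  have lyz := lip y z; have dyz := dist_ge0 y z.
  by exfalso; move: (rad h t z) (rad h t y) yz lyz ry => a b; lra.
have [r rE] : exists r, rad h t y = r by exists (rad h t y).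
rewrite rE in ry.
have t00 : 0 <= t%:E by rewrite lee_fin ltW.
have th0 : (0 < th)%R by case/andP: thp.
pose B z : \bar R := ind (dist y z < r)%R.
have mB : measurable_fun setT B by exact: (measurable_ind_ball reg).
have B0 z : 0 <= B z by exact: ind_ge0.
have mup : measurable_fun setT (fun z => pot 0 h z `^ p) by exact: measurable_poweRe.
pose c1 := ((2^-1 * r) `^ (- N))%R.
have c10 : 0 <= (c1 * t `^ th)%:E by rewrite lee_fin mulr_ge0 ?powR_ge0.
pose G z := (c1 * t `^ th)%:E * (B z + (t `^ (- p))%:E * (B z * pot 0 h z `^ p)).
have tp0 : 0 <= (t `^ (- p))%:E by rewrite lee_fin powR_ge0.
have Bu0 z : 0 <= B z * pot 0 h z `^ p by rewrite mule_ge0 ?poweR_ge0.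
have mBu : measurable_fun setT (fun z => B z * pot 0 h z `^ p).
  exact: emeasurable_funM.
have mBBu : measurable_fun setT
    (fun z => B z + (t `^ (- p))%:E * (B z * pot 0 h z `^ p)).
  by apply: emeasurable_funD => //; exact: emeasurable_funM.
have BBu0 z : 0 <= B z + (t `^ (- p))%:E * (B z * pot 0 h z `^ p).
  by apply: adde_ge0 => //; apply: mule_ge0.
apply: (@le_trans _ _ (\int[mu]_z G z)).
  apply: le_integralT => [z|||z].
  - by rewrite mule_ge0 ?poweR_ge0.
  - apply: emeasurable_funM; first exact: (measurable_section y mSp).
    exact: measurable_poweRe.
  - exact: emeasurable_funM.
  have lyz := lip y z; have lzy := lip z y; have dyz := dist_ge0 y z.
  rewrite (ar_sym reg z y) rE in lzy; rewrite rE in lyz.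
  rewrite /spread; move: (rad h t z) lyz lzy => e lyz lzy.
  case: ltP => [yz|_]; last by rewrite !mul0e mule_ge0.
  have Bz : B z = 1 by rewrite /B (_ : (_ < _)%R = true)//; lra.
  rewrite mul1e /G Bz mul1e EFinM -muleA; apply: lee_pmul => //.
  - by rewrite lee_fin powR_ge0.
  - exact: poweR_ge0.
  - rewrite lee_fin /c1 !powRN lef_pV2 ?posrE ?powR_gt0//; try lra.
    by rewrite ge0_ler_powR ?nnegrE ?(ltW N0)//; lra.
  exact: poweR_le_split.
rewrite /G ge0_integralZl// ge0_integralD//; last exact: emeasurable_funM.
  rewrite ge0_integralZl//.
  apply: (@le_trans _ _ ((c1 * t `^ th)%:E * ((cU * r `^ N)%:E + (t `^ (- p))%:E *
     ((C * r `^ N)%:E * (((2 `^ kap * t)%:E) `^ p))))).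
    rewrite lee_wpmul2l// leeD//; first exact: (integral_ind_ball reg).
    rewrite lee_wpmul2l//; apply: (le_trans (HC h y r h0 mh ry)).
    rewrite lee_wpmul2l ?lee_fin ?mulr_ge0 ?powR_ge0 ?(ltW C0)// le_poweR ?(ltW p0)//.
      exact: pot_ge0.
    have := pot_rad_le reg kapN h0 mh voo t0 (y := y).
    by rewrite rE; exact.
  rewrite poweR_EFin -?EFinM -?EFinD -?EFinM lee_fin.
  rewrite (powRM _ (powR_ge0 _ _) (ltW t0)) -powRrM /c1 powRM ?(ltW ry)//.
  rewrite [leLHS](_ : _ = (2^-1 `^ (- N) * (cU + C * 2 `^ (kap * p) *
     (t `^ (- p) * t `^ p))) * t `^ th * (r `^ (- N) * r `^ N))%R; last by ring.
  by rewrite -!powRD_pos// !addNr !powRr0 !mulr1 /K.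
by move=> z _; apply: mule_ge0.
Qed.

(** The energy density with exponent [- aexp = q - s - gain] in place of [q - s]; the missing [gain]
    is restored by summing [t ^ gain] over the levels [t] below the potential. *)
Definition pow_density h z : \bar R :=
  if h z == 0 then 0 else h z `^ s * epow (pot 0 h z) (- aexp).

Lemma pow_density_ge0 h z : 0 <= pow_density h z.
Proof.
by rewrite /pow_density; case: ifP => // _; rewrite mule_ge0 ?poweR_ge0 ?epow_ge0.
Qed.

Lemma measurable_pow_density h : (forall y, 0 <= h y) ->
  measurable_fun setT h -> measurable_fun setT (pow_density h).
Proof.
move=> h0 mh; apply: measurable_fun_ifT => //; first exact: measurable_fun_eqe.
apply: emeasurable_funM; first exact: measurable_poweRe.
by apply: measurable_epow; exact: (measurable_pot reg).
Qed.

Hypothesis crit : ((N - kap) * s < N)%R.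

(** With [P = pot 0 h], [h] is split as [(h ^ s P ^ (- aexp)) ^ (1 / s)] times [P ^ (aexp / s)] in
    Hölder's inequality for the measure [spread h t y z dz]. The second factor then carries [P] to
    the power [aexp / (s - 1) <= p], which [spread_pot_power] bounds by a power of [t]. *)
Lemma swept_power_le : exists2 C : R, (0 < C)%R & forall h t y,
  (forall y, 0 <= h y) -> measurable_fun setT h -> vnorm h < +oo ->
  0 < vnorm h -> (0 < t)%R ->
  (\int[mu]_z (spread h t y z * h z)) `^ s <=
  (C * t `^ aexp)%:E * \int[mu]_z (spread h t y z * pow_density h z).
Proof.
have [C C0 HC] := spread_pot_power.
exists (C `^ (s - 1))%R; first by rewrite powR_gt0.
move=> h t y h0 mh voo vpos t0.
have s1' := s1; have p1' := p1.
case/andP: (qs) => q1 q_s.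
have s0 : (0 < s)%R by lra.
have a0 := aexp_gt0.
have mu_ : measurable_fun setT (pot 0 h) by exact: (measurable_pot reg).
have u0 x : 0 < pot 0 h x by exact: (pot_gt0 reg kapN x h0 mh vpos).
have mSp : measurable_fun setT (spread h t y).
  exact: (measurable_section y (measurable_spread reg kapN h0 mh voo t0)).
have Sp0 z : 0 <= spread h t y z by exact: spread_ge0.
have mD := measurable_pow_density h0 mh.
have D0 := pow_density_ge0 h.
pose s' := (s / (s - 1))%R.
have s'0 : (0 < s')%R by rewrite divr_gt0//; lra.
have ss' : (s^-1 + s'^-1 = 1)%R by rewrite /s' invf_div; field; lra.
pose f z := spread h t y z `^ s^-1 * pow_density h z `^ s^-1.
pose g z := spread h t y z `^ s'^-1 * pot 0 h z `^ (aexp / s).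
have f0 z : 0 <= f z by rewrite mule_ge0 ?poweR_ge0.
have g0 z : 0 <= g z by rewrite mule_ge0 ?poweR_ge0.
have mf : measurable_fun setT f by apply: emeasurable_funM; exact: measurable_poweRe.
have mg : measurable_fun setT g by apply: emeasurable_funM; exact: measurable_poweRe.
have le1 : \int[mu]_z (spread h t y z * h z) <= \int[mu]_z (f z * g z).
  apply: le_ae_integralT => [z|z|||].
  - by rewrite mule_ge0.
  - by rewrite mule_ge0.
  - exact: emeasurable_funM.
  - exact: emeasurable_funM.
  have ufin : \forall x \ae mu, pot 0 h x < +oo.
    exact: (pot_ae_fin reg kapN s1 crit h0 mh voo).
  have hfin := ae_fin_of_vnorm reg h0 mh voo.
  apply: filterS2 ufin hfin => z uz hz; rewrite /f /g muleACA.
  rewrite poweRD_pos ?invr_gt0// ss' poweRe1// lee_wpmul2l// /pow_density.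
  have := u0 z; have := h0 z.
  case: (pot 0 h z) uz => [ur _|//|//].
  case: (h z) hz => [hr _|//|//]; rewrite lee_fin lte_fin eqe => hr0 ur0.
  case: ifPn => [/eqP ->|hn0]; first by rewrite mule_ge0 ?poweR_ge0.
  have {}hr0 : (0 < hr)%R by rewrite lt0r hn0.
  rewrite epow_pos// !poweR_EFin -!EFinM ?poweR_EFin -?EFinM lee_fin.
  rewrite powRM ?powR_ge0// -!powRrM mulfV ?gt_eqF// powRr1 ?(ltW hr0)//.
  by rewrite -mulrA -powRD_pos// mulNr addNr powRr0 mulr1.
have I0 (F : T -> \bar R) : (forall z, 0 <= F z) -> 0 <= \int[mu]_z F z.
  by move=> F0; exact: integral_ge0.
apply: (@le_trans _ _ ((\int[mu]_z (f z * g z)) `^ s)).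
  by apply: le_poweR; rewrite ?(ltW s0) ?I0// => z; rewrite mule_ge0.
have := hoelder_ereal mu f0 g0 mf mg s0 s'0 ss'.
have -> : \int[mu]_z f z `^ s = \int[mu]_z (spread h t y z * pow_density h z).
  by apply: eq_integral => z _; rewrite /f poweRM ?poweR_ge0// !poweR_invK.
have -> : \int[mu]_z g z `^ s' =
    \int[mu]_z (spread h t y z * pot 0 h z `^ (aexp / (s - 1))).
  apply: eq_integral => z _; rewrite /g poweRM ?poweR_ge0// poweR_invK//.
  by rewrite -poweRrM; congr (_ * _ `^ _); rewrite /s'; field; lra.
have th : (0 < aexp / (s - 1) <= p)%R.
  rewrite divr_gt0 ?a0//=; last by lra.
  rewrite ler_pdivrMr; last by lra.
  by rewrite /aexp /gain; lra.
move=> /(le_poweR (ltW s0) (I0 _ (fun z => mule_ge0 (f0 z) (g0 z)))).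
move=> /le_trans; apply; rewrite poweRM ?poweR_ge0// poweR_invK//; last first.
  by apply: I0 => z; rewrite mule_ge0.
rewrite muleC lee_wpmul2r//; first by apply: I0 => z; rewrite mule_ge0.
rewrite -poweRrM.
have -> : (s'^-1 * s = s - 1)%R by rewrite /s' invf_div; field; lra.
have s10 : (0 <= s - 1)%R by lra.
have G0 : 0 <= \int[mu]_z (spread h t y z * pot 0 h z `^ (aexp / (s - 1))).
  by apply: I0 => z; rewrite mule_ge0 ?poweR_ge0.
apply: (le_trans (le_poweR s10 G0 (HC h t y _ h0 mh voo t0 th))).
rewrite poweR_EFin lee_fin powRM ?powR_ge0 ?(ltW C0)// -powRrM divfK//.
by rewrite gt_eqF//; lra.
Qed.

(** Integrating [swept_power_le] in [y] and exchanging integrals leaves the mass of [spread] in [y],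
    which is at most [cU] and is zero where the stopping radius vanishes. *)
Lemma sweep_upper : exists2 C : R, (0 < C)%R & forall h t,
  (forall y, 0 <= h y) -> measurable_fun setT h -> vnorm h < +oo ->
  0 < vnorm h -> (0 < t)%R ->
  \int[mu]_y (sweep h t y `^ s) <=
  C%:E * (\int[mu]_z (ind (rad h t z <= 0)%R * h z `^ s) +
    (t `^ aexp)%:E * \int[mu]_z (ind (0 < rad h t z)%R * pow_density h z)).
Proof.
have [C C0 HC] := swept_power_le.
have s1' := s1; have s0 : (0 < s)%R by lra.
pose K := (2 `^ s * (1 + C * cU))%R.
have K0 : (0 < K)%R by rewrite mulr_gt0 ?powR_gt0// addr_gt0// mulr_gt0.
exists K => // h t h0 mh voo vpos t0.
have mSw := measurable_swept reg kapN h0 mh voo t0.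
have mSp := measurable_spread reg kapN h0 mh voo t0.
have mI := measurable_ind_rad reg kapN h0 mh voo t0.
have mI' := measurable_ind_rad_gt0 reg kapN h0 mh voo t0.
have mhs : measurable_fun setT (fun z => h z `^ s) by exact: measurable_poweRe.
have Sh0 y : 0 <= \int[mu]_z (spread h t y z * h z).
  by apply: integral_ge0 => z _; rewrite mule_ge0 ?spread_ge0.
have mD := measurable_pow_density h0 mh.
have D0 := pow_density_ge0 h.
have mSD : measurable_fun setT (fun z : T * T => spread h t z.1 z.2 * pow_density h z.2).
  exact: (emeasurable_funM mSp (measurable_snd_comp mD)).
have SD0 y z : 0 <= spread h t y z * pow_density h z.
  by rewrite mule_ge0 ?spread_ge0.
have mIh : measurable_fun setT (fun z => ind (rad h t z <= 0)%R * h z `^ s).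
  exact: emeasurable_funM.
have Ih0 z : 0 <= ind (rad h t z <= 0)%R * h z `^ s.
  by rewrite mule_ge0 ?ind_ge0 ?poweR_ge0.
pose X := \int[mu]_z (ind (rad h t z <= 0)%R * h z `^ s).
pose Y := \int[mu]_z (ind (0 < rad h t z)%R * pow_density h z).
have X0 : 0 <= X by exact: integral_ge0.
have Y0 : 0 <= Y by apply: integral_ge0 => z _; rewrite mule_ge0 ?ind_ge0.
have ta0 : 0 <= (t `^ aexp)%:E by rewrite lee_fin powR_ge0.
have Ct0 : 0 <= (C * t `^ aexp)%:E by rewrite lee_fin mulr_ge0 ?powR_ge0 ?ltW.
have mS1 := measurable_integral_snd mu SD0 mSD.
have S10 y : 0 <= \int[mu]_z (spread h t y z * pow_density h z).
  exact: integral_ge0.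
apply: (@le_trans _ _ (\int[mu]_y ((2 `^ s)%:E * (ind (rad h t y <= 0)%R * h y `^ s +
   (C * t `^ aexp)%:E * \int[mu]_z (spread h t y z * pow_density h z))))).
  apply: le_integralT => [y|||y].
  - exact: poweR_ge0.
  - by apply: measurable_poweRe; exact: (measurable_sweep reg kapN h0 mh voo t0).
  - apply: emeasurable_funM => //; apply: emeasurable_funD => //.
    exact: emeasurable_funM.
  apply: (le_trans (poweR_add_le s0 _ (Sh0 y))); first by rewrite mule_ge0 ?ind_ge0.
  rewrite lee_wpmul2l ?lee_fin ?powR_ge0// leeD//; last exact: HC.
  by rewrite /ind; case: (_ <= _)%R; rewrite ?mul1e// !mul0e poweR0r// gt_eqF.
rewrite ge0_integralZl//; last 2 first.
- by apply: emeasurable_funD => //; exact: emeasurable_funM.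
- by move=> y _; apply: adde_ge0 => //; exact: mule_ge0.
rewrite ge0_integralD//; last 2 first.
- by move=> y _; exact: mule_ge0.
- exact: emeasurable_funM.
rewrite ge0_integralZl// tonelli//.
have YS : \int[mu]_z \int[mu]_y (spread h t y z * pow_density h z) <= cU%:E * Y.
  rewrite -ge0_integralZl//; last 3 first.
  - exact: emeasurable_funM.
  - by move=> y _; rewrite mule_ge0 ?ind_ge0.
  - by rewrite lee_fin ltW.
  apply: le_integralT => [z|||z].
  - exact: integral_ge0.
  - exact: (measurable_integral_fst mu SD0 mSD).
  - by apply: emeasurable_funM => //; exact: emeasurable_funM.
  rewrite ge0_integralZr//; last 2 first.
  - exact: (measurable_section_fst z mSp).
  - by move=> y _; exact: spread_ge0.
  rewrite muleA lee_wpmul2r//.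
  exact: (spread_mass reg).
apply: (@le_trans _ _ ((2 `^ s)%:E * (X + (C * t `^ aexp)%:E * (cU%:E * Y)))).
  by rewrite lee_wpmul2l ?lee_fin ?powR_ge0// leeD2l// lee_wpmul2l.
rewrite /K [in leRHS]EFinM -[leRHS]muleA lee_wpmul2l ?lee_fin ?powR_ge0//.
rewrite -/X -/Y; clearbody X Y.
have CcU : 0 <= (C * cU)%:E by rewrite lee_fin mulr_ge0 ?ltW.
rewrite EFinD ge0_muleDl// mul1e ge0_muleDr ?mule_ge0//.
apply: (@le_trans _ _ (X + (t `^ aexp)%:E * Y + (C * cU)%:E * ((t `^ aexp)%:E * Y))).
  rewrite -addeA leeD2l// addeC; apply: (@le_trans _ _ ((C * cU)%:E * ((t `^ aexp)%:E * Y))).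
    by rewrite !muleA -!EFinM (mulrAC C).
  by rewrite leeDl// mule_ge0.
by rewrite leeD2l// leeDr// mule_ge0.
Qed.

End sweep_upper.

(** * The capacitary strong-type inequality *)

Section geometric_levels.
Context {R : realType}.
Variables (e w b : R).
Hypotheses (e0 : (0 < e)%R) (w0 : (0 < w)%R) (b0 : (0 < b)%R).

Lemma pow2N_lt1 : (2 `^ (- b) < 1 :> R)%R.
Proof. by have := powR2_mulN_lt1 b0; rewrite powRr0 mulr1. Qed.

(** The induction runs on a telescoping bound with [min (e 2 ^ m / 2) w] in place of [w]; the half
    points at the last level summed. *)
Lemma sum_levels_below m :
  (\sum_(0 <= k < m) (e * 2 ^+ k) `^ b * (e * 2 ^+ k < w)%R%:R <=
   w `^ b / (1 - 2 `^ (- b)))%R.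
Proof.
have lt1 := pow2N_lt1.
have c0 : (0 < 1 - 2 `^ (- b) :> R)%R by rewrite subr_gt0.
rewrite ler_pdivlMr//.
apply: (@le_trans _ _ (Order.min (e * 2 ^+ m / 2) w `^ b)%R); last first.
  have m0 : (0 < e * 2 ^+ m / 2 :> R)%R by rewrite divr_gt0// mulr_gt0// exprn_gt0.
  rewrite ge0_ler_powR ?nnegrE ?(ltW b0) ?(ltW w0)// ?ge_min ?lexx ?orbT//.
  by rewrite le_min !ltW.
elim: m => [|m ih]; first by rewrite big_nil mul0r powR_ge0.
have t0 : (0 < e * 2 ^+ m)%R by rewrite mulr_gt0// exprn_gt0.
rewrite big_nat_recr//= exprSr mulrA.
have -> : (e * 2 ^+ m * 2 / 2 = e * 2 ^+ m)%R by field.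
move: (e * 2 ^+ m)%R t0 ih => t t0 ih.
have t2 : (0 < t / 2)%R by rewrite divr_gt0.
have minle : (Order.min (t / 2) w <= Order.min t w)%R.
  rewrite le_min ge_min ge_min lexx orbT andbT; apply/orP; left; lra.
have min0 (x : R) : (0 < x)%R -> (0 <= Order.min x w)%R.
  by move=> x0; rewrite le_min (ltW x0) (ltW w0).
have [tw|wt] := ltP t w.
  rewrite mulr1 mulrDl; apply: (@le_trans _ _ ((t / 2) `^ b + t `^ b * (1 - 2 `^ (- b)))%R).
    rewrite lerD2r (le_trans ih)// ge0_ler_powR ?nnegrE ?min0 ?(ltW b0) ?(ltW t2)//.
    by rewrite ge_min lexx.
  rewrite powRM ?(ltW t0)// powRV// powRN.
  by rewrite le_eqVlt; apply/orP; left; apply/eqP; ring.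
rewrite mulr0 addr0 (le_trans ih)//.
by apply: ge0_ler_powR; rewrite ?nnegrE ?min0 ?ge_min ?lexx ?orbT// ltW.
Qed.

(** The telescoping quantity is now [w ^ (- b)] minus the power [- b] of [max (e 2 ^ m) w]. *)
Lemma sum_levels_above m :
  (\sum_(0 <= k < m) (e * 2 ^+ k) `^ (- b) * (w <= e * 2 ^+ k)%R%:R <=
   w `^ (- b) / (1 - 2 `^ (- b)))%R.
Proof.
have lt1 := pow2N_lt1.
have c0 : (0 < 1 - 2 `^ (- b) :> R)%R by rewrite subr_gt0.
rewrite ler_pdivlMr//.
apply: (@le_trans _ _ (w `^ (- b) - Order.max (e * 2 ^+ m) w `^ (- b))%R); last first.
  by rewrite gerBl powR_ge0.
have anti (x y : R) : (0 < x)%R -> (x <= y)%R -> (y `^ (- b) <= x `^ (- b))%R.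
  move=> x0 xy; have y0 : (0 < y)%R by exact: lt_le_trans xy.
  rewrite !powRN lef_pV2 ?posrE ?powR_gt0//.
  by rewrite ge0_ler_powR ?nnegrE ?(ltW b0) ?(ltW x0) ?(ltW y0).
elim: m => [|m ih].
  by rewrite big_nil mul0r subr_ge0 anti// le_max lexx orbT.
have t0 : (0 < e * 2 ^+ m)%R by rewrite mulr_gt0// exprn_gt0.
rewrite big_nat_recr//= exprSr mulrA.
move: (e * 2 ^+ m)%R t0 ih => t t0 ih.
have [wt|tw] := leP w t.
  rewrite mulr1 mulrDl; apply: (le_trans (lerD ih (lexx _))).
  have -> : (Order.max t w = t)%R by apply/max_idPl.
  have -> : (Order.max (t * 2) w = t * 2)%R by apply/max_idPl; lra.
  rewrite powRM ?(ltW t0)// mulrBr mulr1.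
  by rewrite le_eqVlt; apply/orP; left; apply/eqP; ring.
rewrite mulr0 addr0 (le_trans ih)// lerD2l lerN2 anti//.
  by rewrite lt_max t0.
by rewrite ge_max !le_max lexx orbT andbT; apply/orP; left; lra.
Qed.

End geometric_levels.

Section capacity.
Context d (T : measurableType d) (R : realType).
Variables (mu : {sigma_finite_measure set T -> \bar R}) (dist : T -> T -> R).
Variables (N cL cU : R).
Hypothesis reg : ahlfors_regular mu dist N cL cU.
Variables (o : T) (kap s q g : R).
Hypothesis kapN : (0 < kap < N)%R.
Hypothesis s1 : (1 < s)%R.
Hypothesis qs : (1 <= q < s)%R.
Hypothesis crit : ((N - kap) * s < N)%R.
Hypothesis g0 : (0 < g)%R.

Local Notation pot := (pot mu dist kap).
Local Notation vnorm := (vnorm mu dist o kap).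
Local Notation rad := (rad mu dist kap).
Local Notation ener := (ener mu dist kap s q).

(** [riesz_cap] over the abstract space, with [g] for the Riesz constant and the [L^s] norm written
    out for nonnegative [f]. *)
Definition cap (A : set T) : \bar R :=
  ereal_inf [set \int[mu]_x (f x `^ s) | f in
    [set f : T -> \bar R | (measurable_fun setT f /\ forall x, 0 <= f x) /\
       forall x, A x -> 1 <= g%:E * pot 0 f x]].

Lemma cap_ge0 A : 0 <= cap A.
Proof.
apply/ereal_infP => _ [f _ <-]; apply: integral_ge0 => x _.
exact: poweR_ge0.
Qed.

Lemma cap_le (A B : set T) : A `<=` B -> cap A <= cap B.
Proof.
move=> AB; apply: ereal_inf_le_tmp => _ [f [ff fB] <-].
by exists f => //; split => // x /AB /fB.
Qed.

Lemma potZ r (c : R) f x : (0 <= c)%R -> (forall y, 0 <= f y) ->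
  measurable_fun setT f ->
  pot r (fun y => c%:E * f y) x = c%:E * pot r f x.
Proof.
move=> c0 f0 mf; rewrite -ge0_integralZl ?lee_fin//.
- by apply: eq_integral => y _; rewrite muleCA.
- by apply: emeasurable_funM => //; exact: (measurable_pker_dist reg).
- by move=> y _; rewrite mule_ge0 ?pker_ge0.
Qed.

Variable p : R.
Hypothesis p1 : (1 < p)%R.
Hypothesis kp : (kap * p < N)%R.

(** By [sweep_lower], the swept function divided by [g c t] is a test function for this level set,
    and [sweep_upper] bounds its norm. *)
Lemma cap_level : exists2 C : R, (0 < C)%R & forall h t,
  (forall y, 0 <= h y) -> measurable_fun setT h -> vnorm h < +oo ->
  0 < vnorm h -> (0 < t)%R ->
  cap [set x | (2 `^ kap * t)%:E < pot 0 h x] <=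
  (C * t `^ (- s))%:E * (\int[mu]_z (ind (rad h t z <= 0)%R * h z `^ s) +
    (t `^ aexp s q p)%:E *
      \int[mu]_z (ind (0 < rad h t z)%R * pow_density mu dist kap s q p h z)).
Proof.
have s0 : (0 < s)%R by have := s1; lra.
have [c c0 Hc] := sweep_lower reg o kapN.
have [C C0 HC] := sweep_upper reg o kapN s1 qs p1 kp crit.
exists ((g * c) `^ (- s) * C)%R; first by rewrite mulr_gt0// powR_gt0// mulr_gt0.
move=> h t h0 mh voo vpos t0.
set F := sweep mu dist N kap h t.
have mF : measurable_fun setT F by exact: (measurable_sweep reg kapN h0 mh voo t0).
have F0 x : 0 <= F x by exact: sweep_ge0.
pose k := ((g * c * t)^-1)%R.
have gct : (0 < g * c * t)%R by rewrite !mulr_gt0.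
have k0 : (0 < k)%R by rewrite invr_gt0.
apply: (@le_trans _ _ (\int[mu]_x ((k%:E * F x) `^ s))).
  apply: ge_ereal_inf; eexists; last exact: lexx.
  exists (fun x => k%:E * F x) => //; split.
    split; first exact: emeasurable_funM.
    by move=> x; rewrite mule_ge0 ?lee_fin ?(ltW k0).
  move=> x /= /(Hc h t x h0 mh voo t0) ctx.
  rewrite potZ ?(ltW k0)//; apply: (@le_trans _ _ (g%:E * (k%:E * (c * t)%:E))).
    rewrite -!EFinM lee_fin /k.
    by rewrite le_eqVlt; apply/orP; left; apply/eqP; field; rewrite !gt_eqF.
  by rewrite lee_wpmul2l ?lee_fin ?(ltW g0)// lee_wpmul2l ?lee_fin ?(ltW k0).
have -> : \int[mu]_x ((k%:E * F x) `^ s) = (k `^ s)%:E * \int[mu]_x (F x `^ s).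
  rewrite -ge0_integralZl ?lee_fin ?powR_ge0//.
  - by apply: eq_integral => x _; rewrite poweRM ?lee_fin ?(ltW k0).
  - exact: measurable_poweRe.
  - by move=> x _; exact: poweR_ge0.
apply: (@le_trans _ _ ((k `^ s)%:E * (C%:E * (\int[mu]_z (ind (rad h t z <= 0)%R * h z `^ s) +
    (t `^ aexp s q p)%:E *
      \int[mu]_z (ind (0 < rad h t z)%R * pow_density mu dist kap s q p h z))))).
  by rewrite lee_wpmul2l ?lee_fin ?powR_ge0//; exact: HC.
rewrite muleA -EFinM /k powRV ?(ltW gct)// -powRN.
by rewrite (powRM _ _ (ltW t0)) ?mulr_ge0 ?(ltW g0) ?(ltW c0)// mulrAC.
Qed.

(** At a point where the potential is [P], the radius vanishes only for levels with
    [P <= 2 ^ kap t], over which [t ^ (q - s)] sums to a multiple of [P ^ (q - s)]. It is positive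
    only for [t < P], over which [t ^ gain] sums to a multiple of [P ^ gain], and
    [P ^ gain P ^ (- aexp)] is again [P ^ (q - s)]. Both parts of [cap_level] thus recover the
    energy density. *)
Lemma cap_level_sum : exists2 C : R, (0 < C)%R & forall h (e : R) m,
  (forall y, 0 <= h y) -> measurable_fun setT h -> vnorm h < +oo ->
  0 < vnorm h -> (0 < e)%R ->
  (\sum_(0 <= k < m) ((e * 2 ^+ k) `^ q)%:E *
    cap [set x | (2 `^ kap * (e * 2 ^+ k))%:E < pot 0 h x]) <= C%:E * ener h.
Proof.
have [C C0 HC] := cap_level.
have s1' := s1; case/andP: (qs) => q1 q_s.
have s0 : (0 < s)%R by lra.
have sq0 : (0 < s - q)%R by lra.
have d0 : (0 < gain s p)%R by exact: gain_gt0.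
(* The geometric sums over levels with vanishing and with positive radius; [(2 ^ kap) ^ (s - q)]
   appears because the former compare [P] with [2 ^ kap t]. *)
pose K1 := ((2 `^ kap) `^ (s - q) / (1 - 2 `^ (- (s - q))))%R.
pose K2 := (1 / (1 - 2 `^ (- gain s p)) : R)%R.
have K10 : (0 < K1)%R.
  by rewrite divr_gt0 ?powR_gt0// subr_gt0 pow2N_lt1.
have K20 : (0 < K2)%R by rewrite divr_gt0// subr_gt0 pow2N_lt1.
exists (C * (K1 + K2))%R; first by rewrite mulr_gt0// addr_gt0.
move=> h e m h0 mh voo vpos e0.
pose t k := (e * 2 ^+ k)%R.
have t0 k : (0 < t k)%R by rewrite mulr_gt0// exprn_gt0.
pose D := pow_density mu dist kap s q p h.
have D0 z : 0 <= D z by exact: pow_density_ge0.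
have mD : measurable_fun setT D by exact: (measurable_pow_density reg).
have mhs : measurable_fun setT (fun z => h z `^ s) by exact: measurable_poweRe.
have mI k := measurable_ind_rad reg kapN h0 mh voo (t0 k).
have mI' k := measurable_ind_rad_gt0 reg kapN h0 mh voo (t0 k).
pose G k z : \bar R := (t k `^ (q - s))%:E * (ind (rad h (t k) z <= 0)%R * h z `^ s) +
  (t k `^ gain s p)%:E * (ind (0 < rad h (t k) z)%R * D z).
have mG1 k : measurable_fun setT
    (fun z => (t k `^ (q - s))%:E * (ind (rad h (t k) z <= 0)%R * h z `^ s)).
  by apply: emeasurable_funM => //; exact: emeasurable_funM.
have mG2 k : measurable_fun setT
    (fun z => (t k `^ gain s p)%:E * (ind (0 < rad h (t k) z)%R * D z)).
  by apply: emeasurable_funM => //; exact: emeasurable_funM.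
have G10 k z : 0 <= (t k `^ (q - s))%:E * (ind (rad h (t k) z <= 0)%R * h z `^ s).
  by rewrite !mule_ge0 ?ind_ge0 ?poweR_ge0// lee_fin powR_ge0.
have G20 k z : 0 <= (t k `^ gain s p)%:E * (ind (0 < rad h (t k) z)%R * D z).
  by rewrite !mule_ge0 ?ind_ge0// lee_fin powR_ge0.
have mG k : measurable_fun setT (G k) by exact: emeasurable_funD.
have G0 k z : 0 <= G k z by exact: adde_ge0.
have termE k : ((t k) `^ q)%:E * cap [set x | (2 `^ kap * t k)%:E < pot 0 h x] <=
    C%:E * \int[mu]_z G k z.
  apply: (le_trans (lee_wpmul2l _ (HC h (t k) h0 mh voo vpos (t0 k)))).
    by rewrite lee_fin powR_ge0.
  rewrite ge0_integralD// !ge0_integralZl//; last 6 first.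
  - exact: emeasurable_funM.
  - by move=> z _; rewrite mule_ge0 ?ind_ge0.
  - by rewrite lee_fin powR_ge0.
  - exact: emeasurable_funM.
  - by move=> z _; rewrite mule_ge0 ?ind_ge0 ?poweR_ge0.
  - by rewrite lee_fin powR_ge0.
  have X0 : 0 <= \int[mu]_z (ind (rad h (t k) z <= 0)%R * h z `^ s).
    by apply: integral_ge0 => z _; rewrite mule_ge0 ?ind_ge0 ?poweR_ge0.
  have Y0 : 0 <= \int[mu]_z (ind (0 < rad h (t k) z)%R * D z).
    by apply: integral_ge0 => z _; rewrite mule_ge0 ?ind_ge0.
  rewrite -/D; move: (\int[mu]_z _) (\int[mu]_z _) X0 Y0 => X Y X0 Y0.
  have tk p' : 0 <= (t k `^ p')%:E by rewrite lee_fin powR_ge0.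
  rewrite muleA -EFinM mulrCA EFinM -powRD_pos// -muleA.
  rewrite lee_wpmul2l ?lee_fin ?(ltW C0)// ge0_muleDr ?mule_ge0//.
  rewrite muleA -EFinM -powRD_pos//.
  by rewrite (_ : (q - s + aexp s q p = gain s p)%R)// /aexp; ring.
apply: (@le_trans _ _ (\sum_(0 <= k < m) C%:E * \int[mu]_z G k z)).
  by apply: lee_sum => k _; exact: termE.
rewrite -ge0_sume_distrr; last by move=> k _; exact: integral_ge0.
rewrite EFinM -muleA lee_wpmul2l ?lee_fin ?(ltW C0)//.
rewrite -ge0_integral_sum// -ge0_integralZl//; last 3 first.
- exact: (measurable_ener_density reg).
- by move=> z _; exact: ener_density_ge0.
- by rewrite lee_fin addr_ge0 ?(ltW K10) ?(ltW K20).
apply: le_ae_integralT => [z|z|||].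
- exact: sume_ge0.
- by rewrite mule_ge0 ?ener_density_ge0// lee_fin addr_ge0 ?(ltW K10) ?(ltW K20).
- exact: emeasurable_sum.
- apply: emeasurable_funM => //; exact: (measurable_ener_density reg).
have ufin : \forall x \ae mu, pot 0 h x < +oo.
  exact: (pot_ae_fin reg kapN s1 crit h0 mh voo).
have hfin := ae_fin_of_vnorm reg h0 mh voo.
apply: filterS2 ufin hfin => z uz hz.
have u0 : 0 < pot 0 h z by exact: (pot_gt0 reg kapN z h0 mh vpos).
have [hz0|hzn0] := eqVneq (h z) 0.
  rewrite big1 ?mule_ge0 ?ener_density_ge0 ?lee_fin ?addr_ge0 ?(ltW K10) ?(ltW K20)//.
  move=> k _; rewrite /G /D /pow_density hz0 eqxx poweR0r ?gt_eqF//.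
  by rewrite !mule0 adde0.
have rad0 k : (rad h (t k) z <= 0)%R -> pot 0 h z <= (2 `^ kap * t k)%:E.
  exact: (pot_le_of_rad_eq0 reg kapN h0 mh voo (t0 k)).
have radp k : (0 < rad h (t k) z)%R -> (t k)%:E < pot 0 h z.
  exact: (pot_gt_of_rad_gt0 reg kapN h0 mh voo (t0 k)).
have [a aE] : exists a, forall k, rad h (t k) z = a k by exists (fun k => rad h (t k) z).
have [ur uE] : exists ur, pot 0 h z = ur%:E.
  by exists (fine (pot 0 h z)); rewrite fineK// ge0_fin_numE// ltW.
have [hr hE] : exists hr, h z = hr%:E.
  by exists (fine (h z)); rewrite fineK// ge0_fin_numE.
rewrite uE lte_fin in u0.
rewrite /ener_density (negbTE hzn0) uE hE epow_pos//.
have GE k : G k z <= (hr `^ s * ((2 `^ kap) `^ (s - q) *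
     ((2 `^ kap * t k) `^ (- (s - q)) * (ur <= 2 `^ kap * t k)%R%:R) +
   ur `^ (- aexp s q p) * (t k `^ gain s p * (t k < ur)%R%:R)))%:E.
  rewrite /G /D /pow_density (negbTE hzn0) uE hE epow_pos// /ind -?EFinM -?EFinD.
  rewrite lee_fin mulrDr; apply: lerD.
    have -> : ((2 `^ kap * t k) `^ (- (s - q)) =
        (2 `^ kap) `^ (- (s - q)) * t k `^ (q - s))%R.
      by rewrite powRM ?powR_ge0 ?(ltW (t0 k))// opprB.
    have E1 : ((2 `^ kap) `^ (s - q) * (2 `^ kap) `^ (- (s - q)) = 1 :> R)%R.
      by rewrite -powRD_pos ?powR_gt0// subrr powRr0.
    rewrite [leRHS](_ : _ = ((2 `^ kap) `^ (s - q) * (2 `^ kap) `^ (- (s - q))) *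
       (t k `^ (q - s) * ((ur <= 2 `^ kap * t k)%R%:R * hr `^ s)))%R; last by ring.
    rewrite E1 mul1r ler_wpM2l ?powR_ge0// ler_wpM2r ?powR_ge0// ler_nat.
    by case: (leP (rad h (t k) z) 0%R) => // /rad0; rewrite uE lee_fin => ->.
  rewrite [leRHS](_ : _ = t k `^ gain s p * ((t k < ur)%R%:R *
    (hr `^ s * ur `^ (- aexp s q p))))%R; last by ring.
  rewrite ler_wpM2l ?powR_ge0// ler_wpM2r ?mulr_ge0 ?powR_ge0// ler_nat.
  by case: (ltP 0%R (rad h (t k) z)) => // /radp; rewrite uE lte_fin => ->.
apply: (le_trans (lee_sum _ (fun k _ => GE k))).
rewrite sumEFin -EFinM lee_fin -mulr_sumr.
rewrite [leRHS](_ : _ = hr `^ s * ((K1 + K2) * ur `^ (q - s)))%R; last by ring.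
rewrite ler_wpM2l ?powR_ge0// big_split/= -!mulr_sumr mulrDl lerD//.
  apply: (@le_trans _ _ ((2 `^ kap) `^ (s - q) *
     (ur `^ (- (s - q)) / (1 - 2 `^ (- (s - q)))))%R).
    rewrite ler_wpM2l ?powR_ge0//.
    have ke0 : (0 < 2 `^ kap * e)%R by rewrite mulr_gt0// powR_gt0.
    apply: le_trans (sum_levels_above ke0 u0 sq0 m).
    by rewrite le_eqVlt; apply/orP; left; apply/eqP/eq_bigr => k _; rewrite /t !mulrA.
  by rewrite /K1 opprB; rewrite le_eqVlt; apply/orP; left; apply/eqP; ring.
apply: (@le_trans _ _ (ur `^ (- aexp s q p) * (ur `^ gain s p / (1 - 2 `^ (- gain s p))))%R).
  by rewrite ler_wpM2l ?powR_ge0// sum_levels_below.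
rewrite mulrA -powRD_pos//.
rewrite (_ : (- aexp s q p + gain s p = q - s)%R); last by rewrite /aexp; ring.
by rewrite /K2 div1r mulrC.
Qed.

End capacity.

(** * Dyadic bounds for integrals of antitone functions *)

Section antitone_integral.
Context {R : realType}.
Variable phi : R -> \bar R.
Hypothesis phi0 : forall t, 0 <= phi t.
Hypothesis anti : forall t u, (t <= u)%R -> phi u <= phi t.

Lemma measurable_antitone (D : set R) : measurable_fun D phi.
Proof.
apply: (@measurable_funS _ _ _ _ setT) => //.
apply: (measurability _ (ErealGenOInfty.measurableE R)).
move=> /= _ [_ [a ->]] <-; apply: measurableI => //.
rewrite preimage_itvoy; apply: is_interval_measurable => x y /= ax ay z.
by move=> /andP[_ zy]; exact: lt_le_trans (anti zy).
Qed.

Lemma integral_antitone_itv (a b : R) : (a <= b)%R ->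
  \int[lebesgue_measure]_(t in `]a, b]) phi t <= (b - a)%:E * phi a.
Proof.
move=> ab; apply: (@le_trans _ _ (\int[lebesgue_measure]_(t in `]a, b]) cst (phi a) t)).
  apply: ge0_le_integral => //=; first exact: measurable_antitone.
  by move=> t; rewrite in_itv/= => /andP[/ltW /anti].
rewrite integral_cst//.
rewrite [X in _ * X]lebesgue_measure_itv/= lte_fin muleC.
case: ltP => // ba; rewrite (_ : b = a) ?subrr//; exact/le_anti/andP.
Qed.

Variable q : R.
Hypothesis q0 : (0 < q)%R.

(** The [k]-th dyadic interval has length at most [2 ^ q (e 2 ^ k) ^ q], and [phi] is largest at its
    left end. *)
Lemma integral_antitone_dyadic (e : R) m : (0 < e)%R ->
  \int[lebesgue_measure]_(t in `](e `^ q)%R, ((e * 2 ^+ m) `^ q)%R]) phi t <=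
  (2 `^ q)%:E *
    \sum_(0 <= k < m) ((e * 2 ^+ k) `^ q)%:E * phi ((e * 2 ^+ k) `^ q)%R.
Proof.
move=> e0; elim: m => [|m ih].
  by rewrite big_nil mule0 expr0 mulr1 set_itvoc0 integral_set0.
have t0 : (0 < e * 2 ^+ m)%R by rewrite mulr_gt0// exprn_gt0.
have et : (e <= e * 2 ^+ m)%R by rewrite ler_peMr ?(ltW e0)// exprn_ege1// ler1n.
have le1 : (e `^ q <= (e * 2 ^+ m) `^ q)%R.
  by rewrite ge0_ler_powR ?nnegrE ?(ltW q0) ?(ltW e0) ?(ltW t0).
have le2 : ((e * 2 ^+ m) `^ q <= (e * 2 ^+ m.+1) `^ q)%R.
  rewrite ge0_ler_powR ?nnegrE ?(ltW q0) ?(ltW t0)//.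
    by rewrite mulr_ge0 ?(ltW e0)// exprn_ge0.
  by rewrite exprS mulrCA ler_peMl ?(ltW t0)// ler1n.
rewrite big_nat_recr//= ge0_muleDr; last 2 first.
- by apply: sume_ge0 => k _; rewrite mule_ge0// lee_fin powR_ge0.
- by rewrite mule_ge0// lee_fin powR_ge0.
have -> : `](e `^ q)%R, ((e * 2 ^+ m.+1) `^ q)%R]%classic =
    `](e `^ q)%R, ((e * 2 ^+ m) `^ q)%R] `|` `]((e * 2 ^+ m) `^ q)%R, ((e * 2 ^+ m.+1) `^ q)%R].
  apply/seteqP; split => x /=; rewrite !in_itv/=.
    move=> /andP[ex xt]; have [xm|xm] := leP x ((e * 2 ^+ m) `^ q)%R.
      by left; rewrite ex.
    by right.
  case=> /andP[ex xt]; first by rewrite ex (le_trans xt).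
  by rewrite xt andbT (le_lt_trans le1).
rewrite ge0_integral_setU//; last 2 first.
- exact: measurable_antitone.
- apply/disj_setPS => x [] /=; rewrite !in_itv/= => /andP[_ xm] /andP[mx _].
  by move: (lt_le_trans mx xm); rewrite ltxx.
apply: leeD => //; apply: (le_trans (integral_antitone_itv le2)).
rewrite muleA lee_wpmul2r// -EFinM lee_fin.
rewrite exprS mulrCA (powRM _ (ler0n _ _) (ltW t0)).
by rewrite gerBl powR_ge0.
Qed.

Lemma integral_antitone_le (B : \bar R) :
  (forall (e : R) m, (0 < e)%R ->
    \sum_(0 <= k < m) ((e * 2 ^+ k) `^ q)%:E * phi ((e * 2 ^+ k) `^ q)%R <= B) ->
  \int[lebesgue_measure]_(t in `]0%R, +oo[) phi t <= (2 `^ q)%:E * B.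
Proof.
(* Starting at [2 ^ (- n)] with [2 n] levels, the intervals increase to the open half-line. *)
move=> bnd; pose e n := ((2 ^+ n)^-1 : R)%R.
have e0 n : (0 < e n)%R by rewrite invr_gt0 exprn_gt0.
have eE n : (e n * 2 ^+ (n + n) = 2 ^+ n)%R.
  by rewrite exprD mulrA mulVf ?mul1r// gt_eqF// exprn_gt0.
pose F n := `](e n `^ q)%R, ((e n * 2 ^+ (n + n)) `^ q)%R]%classic.
have ndF : nondecreasing_seq F.
  apply/nondecreasing_seqP => n; apply/subsetPset => x /=; rewrite /F !eE /= !in_itv/=.
  move=> /andP[ex xe]; apply/andP; split.
    apply: le_lt_trans ex; rewrite ge0_ler_powR ?nnegrE ?(ltW q0) ?(ltW (e0 _))//.
    by rewrite /e lef_pV2 ?posrE ?exprn_gt0// ler_weXn2l// ler1n.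
  apply: (le_trans xe); rewrite ge0_ler_powR ?nnegrE ?(ltW q0) ?exprn_ge0//.
  by rewrite ler_weXn2l// ler1n.
have UF : \bigcup_n F n = `]0%R, +oo[%classic.
  apply/seteqP; split => [x [n _]|x] /=; rewrite /F /= in_itv/= ?eE.
    by move=> /andP[ex _]; rewrite in_itv/= andbT (le_lt_trans _ ex)// powR_ge0.
  rewrite andbT => x0; pose y := (x `^ q^-1)%R.
  have y0 : (0 < y)%R by rewrite powR_gt0.
  have yq : (y `^ q = x)%R by rewrite -powRrM mulVf ?gt_eqF// powRr1 ?ltW.
  have [n1 h1] : exists n1 : nat, (y <= 2 ^+ n1)%R.
    exists (Num.trunc y).+1; rewrite ltW// (lt_le_trans (truncnS_gt _))//.
    by rewrite -natrX ler_nat ltnW// ltn_expl.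
  have [n2 h2] : exists n2 : nat, (y^-1 < 2 ^+ n2)%R.
    exists (Num.trunc y^-1).+1; rewrite (lt_le_trans (truncnS_gt _))//.
    by rewrite -natrX ler_nat ltnW// ltn_expl.
  exists (maxn n1 n2) => //=; rewrite in_itv/= eE -yq; apply/andP; split.
    apply: gt0_ltr_powR => //; rewrite ?nnegrE ?(ltW (e0 _)) ?(ltW y0)//.
    rewrite /e invf_plt ?posrE ?exprn_gt0//; apply: (lt_le_trans h2).
    by rewrite ler_weXn2l ?ler1n// leq_maxr.
  rewrite ge0_ler_powR ?nnegrE ?(ltW q0) ?(ltW y0) ?exprn_ge0//.
  by apply: (le_trans h1); rewrite ler_weXn2l ?ler1n// leq_maxl.
have mF n : measurable (F n) by exact: measurable_itv.
have cv : \int[lebesgue_measure]_(t in F n) phi t @[n --> \oo] -->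
    \int[lebesgue_measure]_(t in \bigcup_n F n) phi t.
  by apply: ge0_nondecreasing_set_cvg_integral => // n; exact: measurable_antitone.
rewrite UF in cv; rewrite -(cvg_lim _ cv)//; apply: lime_le.
  by apply/cvg_ex; eexists; exact: cv.
apply: nearW => n; apply: (le_trans (integral_antitone_dyadic _ (e0 n))).
by rewrite lee_wpmul2l ?lee_fin ?powR_ge0// bnd.
Qed.

End antitone_integral.

Section strong_type.
Context d (T : measurableType d) (R : realType).
Variables (mu : {sigma_finite_measure set T -> \bar R}) (dist : T -> T -> R).
Variables (N cL cU : R).
Hypothesis reg : ahlfors_regular mu dist N cL cU.
Variables (o : T) (kap s q g : R).
Hypothesis kapN : (0 < kap < N)%R.
Hypothesis s1 : (1 < s)%R.
Hypothesis qs : (1 <= q < s)%R.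
Hypothesis crit : ((N - kap) * s < N)%R.
Hypothesis g0 : (0 < g)%R.

Local Notation pot := (pot mu dist kap).
Local Notation vnorm := (vnorm mu dist o kap).
Local Notation ener := (ener mu dist kap s q).
Local Notation cap := (cap mu dist kap s g).

Lemma cap_set0 : cap set0 = 0.
Proof.
apply/eqP; rewrite eq_le cap_ge0 andbT; apply: ge_ereal_inf.
exists 0 => //; exists (cst 0); first by split => //; split.
by apply: integral0_eq => x _; rewrite poweR0r// gt_eqF//; have := s1; lra.
Qed.

Lemma capacitary_strong_type : exists2 C : R, (0 < C)%R & forall h,
  (forall y, 0 <= h y) -> measurable_fun setT h -> vnorm h < +oo ->
  \int[lebesgue_measure]_(t in `]0%R, +oo[)
    cap [set x | t%:E < `|pot 0 h x| `^ q] <= C%:E * ener h.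
Proof.
case/andP: (qs) => q1 q_s; have q0 : (0 < q)%R by lra.
have [p [p1 kp]] := exists_pot_power kapN.
have [C C0 HC] := cap_level_sum reg o kapN s1 qs crit g0 p1 kp.
exists (2 `^ q * ((2 `^ kap) `^ q * C))%R; first by rewrite !mulr_gt0 ?powR_gt0.
move=> h h0 mh voo.
have u0 x : 0 <= pot 0 h x by exact: pot_ge0.
have [v0|vn0] := eqVneq (vnorm h) 0.
  have u00 x : pot 0 h x = 0.
    rewrite (@eq_ae_pot _ _ _ _ _ _ _ _ reg _ 0 h (cst 0))//.
      by apply: integral0_eq => y _; rewrite mule0.
    exact: (ae_eq0_of_vnorm reg h0 mh v0).
  rewrite integral0_eq ?mule_ge0 ?ener_ge0 ?lee_fin ?mulr_ge0 ?powR_ge0 ?ltW// => t /=.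
  rewrite in_itv/= andbT => t0; rewrite (_ : [set x | _] = set0) ?cap_set0//.
  apply/seteqP; split => // x /=; rewrite u00 abse0 poweR0r ?gt_eqF// lte_fin.
  by move=> /(lt_trans t0); rewrite ltxx.
have vpos : 0 < vnorm h by rewrite lt0e vn0/= (vnorm_ge0 reg).
rewrite EFinM -muleA; apply: integral_antitone_le => //.
- by move=> t; exact: cap_ge0.
- move=> t u tu; apply: cap_le => x /=; apply: le_lt_trans.
  by rewrite lee_fin.
(* Starting the levels at [e / 2 ^ kap] absorbs the factor [2 ^ kap] in the level sets of
   [cap_level_sum]. *)
move=> e m e0; pose e' := (e / 2 `^ kap)%R.
have kp0 : (0 < 2 `^ kap :> R)%R by rewrite powR_gt0.
have e'0 : (0 < e')%R by rewrite divr_gt0.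
have := HC h e' m h0 mh voo vpos e'0.
have eE k : (e * 2 ^+ k = 2 `^ kap * (e' * 2 ^+ k))%R.
  by rewrite /e' mulrA [in RHS]mulrCA mulfV ?mulr1// gt_eqF.
rewrite EFinM -muleA => HS.
apply: le_trans (lee_wpmul2l _ HS); last by rewrite lee_fin powR_ge0.
rewrite ge0_sume_distrr; last first.
  by move=> k _; rewrite mule_ge0 ?cap_ge0// lee_fin powR_ge0.
apply: lee_sum => k _; have t0 : (0 < e' * 2 ^+ k)%R by rewrite mulr_gt0// exprn_gt0.
rewrite muleA eE (powRM _ (ltW kp0) (ltW t0)) -EFinM lee_wpmul2l//.
  by rewrite lee_fin mulr_ge0 ?powR_ge0.
apply: cap_le => x /=; rewrite gee0_abs// -powRM ?(ltW kp0) ?(ltW t0)//.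
have a0 : (0 <= 2 `^ kap * (e' * 2 ^+ k))%R by rewrite mulr_ge0 ?ltW.
move: (2 `^ kap * (e' * 2 ^+ k))%R a0 => a a0.
apply: contraTT; rewrite -!leNgt => ua.
by rewrite -[leRHS]poweR_EFin; apply: le_poweR; rewrite ?(ltW q0).
Qed.

End strong_type.

(** * The trace inequality *)

Section layer_cake.
Context {R : realType}.

Lemma integral_below (a : \bar R) : 0 <= a ->
  \int[lebesgue_measure]_(t in [set: measurableTypeR R])
    (ind (0 < t)%R * ind (t%:E < a)) = a.
Proof.
move=> a0; pose I := match a with r%:E => `]0%R, r[ | _ => `]0%R, +oo[ end.
have mI : measurable ([set` I] : set (measurableTypeR R)) by exact: measurable_itv.
transitivity (\int[lebesgue_measure]_(t in [set: measurableTypeR R])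
    (\1_[set` I] t)%:E).
  apply: eq_integral => t _; rewrite indicE mem_setE /I.
  case: a a0 {I mI} => [r _| _|//]; rewrite in_itv/= /ind -EFinM ?lte_fin ?ltry ?andbT.
    by case: (0 < t)%R; case: (t < r)%R; rewrite /= ?mulr0 ?mulr1 ?mul0r.
  by rewrite mulr1.
rewrite integral_indic// setIT.
rewrite /I; case: a a0 {I mI} => [r|_|//].
  rewrite lee_fin => r0; rewrite [LHS]lebesgue_measure_itv/= lte_fin.
  by case: ltP => [_|]; rewrite ?sube0// => r0'; congr _%:E; apply/le_anti/andP.
by rewrite [LHS]lebesgue_measure_itv/= ltry.
Qed.

End layer_cake.

Section trace.
Context d (T : measurableType d) (R : realType).
Variables (mu : {sigma_finite_measure set T -> \bar R}) (dist : T -> T -> R).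
Variables (N cL cU : R).
Hypothesis reg : ahlfors_regular mu dist N cL cU.
Variables (o : T) (kap s q g : R).
Hypothesis kapN : (0 < kap < N)%R.
Hypothesis s1 : (1 < s)%R.
Hypothesis qs : (1 <= q < s)%R.
Hypothesis crit : ((N - kap) * s < N)%R.
Hypothesis g0 : (0 < g)%R.

Local Notation om := (wt dist o).
Local Notation pot := (pot mu dist kap).
Local Notation vnorm := (vnorm mu dist o kap).
Local Notation cap := (cap mu dist kap s g).
Local Notation cexp := (cexp kap s).

Lemma conj_exp_gt0 : (0 < s / (s - 1))%R.
Proof. by have s1' := s1; rewrite divr_gt0//; lra. Qed.

Lemma conj_expE : (s^-1 + (s / (s - 1))^-1 = 1)%R.
Proof. by have s1' := s1; rewrite invf_div; field; lra. Qed.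

(** [Q], the potential of [om cexp] restricted to [b], is at most [C2 om kap] because [cexp > N]. In
    [Q ^ s' = Q Q ^ (s' - 1)] only the second factor is estimated in this way; exchanging integrals
    then leaves the potential of [om (kap (s' - 1))], which is bounded since
    [kap (s' - 1) > N - kap], a restatement of [crit]. *)
Lemma trace_energy : exists2 C : R, (0 < C)%R & forall b : T -> bool,
  measurable_fun setT b ->
  \int[mu]_y ((\int[mu]_x ((om cexp x)%:E * ind (b x) * pker kap (0 + dist x y)))
     `^ (s / (s - 1))) <= C%:E * \int[mu]_x ((om cexp x)%:E * ind (b x)).
Proof.
have s1' := s1; have cr := crit; case/andP: (kapN) => k0 kN.
have Nc : (N < cexp)%R by exact: N_lt_cexp.
have [C2 C20 HC2] := wt_pker_integral reg o kapN Nc.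
pose s' := (s / (s - 1))%R.
have s'0 : (0 < s')%R := conj_exp_gt0.
have s'1 : (0 < s' - 1)%R.
  by rewrite /s' subr_gt0 ltr_pdivlMr; lra.
have be : (N - kap < kap * (s' - 1))%R.
  rewrite (_ : (kap * (s' - 1) = kap / (s - 1))%R); last by rewrite /s'; field; lra.
  rewrite ltr_pdivlMr; last lra.
  by move: cr; rewrite mulrBl mulrBr mulr1 mulrBl; lra.
have [C3 C30 HC3] := wt_pker_integral_bounded reg o kapN be.
exists (C2 `^ (s' - 1) * C3)%R; first by rewrite mulr_gt0 ?powR_gt0.
move=> b mb.
pose w x : \bar R := (om cexp x)%:E * ind (b x).
have mw : measurable_fun setT w.
  apply: emeasurable_funM; first exact: (measurable_EFin_wt reg).
  exact: measurable_ind.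
have w0 x : 0 <= w x by rewrite mule_ge0 ?ind_ge0 ?(wt_EFin_ge0 reg).
have mk2 : measurable_fun setT (fun z : T * T => pker kap (0 + dist z.1 z.2)).
  exact: (measurable_pker_dist2 reg).
have mwk : measurable_fun setT (fun z : T * T => w z.1 * pker kap (0 + dist z.1 z.2)).
  by apply: emeasurable_funM => //; exact: measurable_fst_comp.
have wk0 x y : 0 <= w x * pker kap (0 + dist x y) by rewrite mule_ge0 ?pker_ge0.
pose Q y := \int[mu]_x (w x * pker kap (0 + dist x y)).
have mQ : measurable_fun setT Q := measurable_integral_fst mu wk0 mwk.
have Q0 y : 0 <= Q y by exact: integral_ge0.
have QC y : Q y <= (C2 * om kap y)%:E.
  apply: le_trans (HC2 y); apply: le_integralT => [x|||x].
  - exact: wk0.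
  - exact: (measurable_section_fst y mwk).
  - apply: emeasurable_funM; first exact: (measurable_EFin_wt reg).
    exact: (measurable_pker_dist_fst reg).
  rewrite add0r lee_wpmul2r ?pker_ge0// /w -[leRHS]mule1 lee_wpmul2l ?ind_le1//.
  exact: (wt_EFin_ge0 reg).
have om0 y : (0 < om kap y)%R by exact: (wt_gt0 reg).
have omE y : ((C2 * om kap y) `^ (s' - 1) =
    C2 `^ (s' - 1) * om (kap * (s' - 1)) y)%R.
  by rewrite powRM ?(ltW C20) ?(ltW (om0 y))// /wt -powRrM mulNr.
have C2p : 0 <= (C2 `^ (s' - 1))%:E by rewrite lee_fin powR_ge0.
pose G x y : \bar R := w x * (pker kap (0 + dist x y) * (om (kap * (s' - 1)) y)%:E).
have mom : measurable_fun setT (fun y => (om (kap * (s' - 1)) y)%:E).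
  exact: (measurable_EFin_wt reg).
have momk x : measurable_fun setT
    (fun y => pker kap (0 + dist x y) * (om (kap * (s' - 1)) y)%:E).
  by apply: emeasurable_funM => //; exact: (measurable_section x mk2).
have G0 x y : 0 <= G x y.
  apply: mule_ge0 => //.
  by apply: mule_ge0; [exact: pker_ge0|exact: (wt_EFin_ge0 reg)].
have mG : measurable_fun setT (fun z : T * T => G z.1 z.2).
  apply: emeasurable_funM; first exact: (measurable_fst_comp mw).
  by apply: emeasurable_funM => //; exact: (measurable_snd_comp mom).
apply: (@le_trans _ _ (\int[mu]_y ((C2 `^ (s' - 1))%:E * \int[mu]_x G x y))).
  apply: le_integralT => [y|||y].
  - exact: poweR_ge0.
  - exact: measurable_poweRe.
  - by apply: emeasurable_funM => //; exact: measurable_integral_fst.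
  rewrite -/s' -/(Q y).
  have -> : Q y `^ s' = Q y * Q y `^ (s' - 1).
    by rewrite -{2}(poweRe1 (Q0 y)) poweRD_pos// subrKC.
  apply: (@le_trans _ _ (Q y * (C2 `^ (s' - 1) * om (kap * (s' - 1)) y)%:E)).
    rewrite lee_wpmul2l// -omE -poweR_EFin; apply: le_poweR => //.
    exact: ltW.
  rewrite EFinM muleCA lee_wpmul2l// muleC -ge0_integralZl//; last 2 first.
  - exact: (measurable_section_fst y mwk).
  - exact: (wt_EFin_ge0 reg).
  rewrite (@eq_integral _ _ _ mu setT (G ^~ y))// => x _.
  by rewrite /G muleC -muleA.
rewrite ge0_integralZl//; last 2 first.
- exact: measurable_integral_fst.
- by move=> y _; exact: integral_ge0.
rewrite EFinM -muleA lee_wpmul2l// -tonelli// -ge0_integralZl//; last 2 first.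
- by move=> x _; exact: w0.
- by rewrite lee_fin ltW.
apply: le_integralT => [x|||x].
- exact: integral_ge0.
- exact: measurable_integral_snd.
- exact: emeasurable_funM.
rewrite /G ge0_integralZl//; last first.
  by move=> y _; rewrite mule_ge0 ?pker_ge0 ?(wt_EFin_ge0 reg).
rewrite muleC lee_wpmul2r//; apply: le_trans (HC3 x).
rewrite le_eqVlt; apply/orP; left; apply/eqP; apply: eq_integral => y _.
by rewrite add0r muleC (ar_sym reg).
Qed.

(** For a test function [f] of the capacity, exchanging integrals, Hölder's inequality and
    [trace_energy] give [V <= g X ^ (1 / s) (C4 V) ^ (1 / s')], where [V] is the left side and [X]
    the integral of [f ^ s]. As [V] is finite, and positive in the case of interest, [V ^ (1 / s')]
    can be divided out. *)
Lemma trace_capacity : exists2 C : R, (0 < C)%R & forall b : T -> bool,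
  measurable_fun setT b ->
  \int[mu]_x ((om cexp x)%:E * ind (b x)) <= C%:E * cap [set x | b x].
Proof.
have s1' := s1; have s0 : (0 < s)%R by lra.
have Nc : (N < cexp)%R by exact: N_lt_cexp.
have [C1 C10 HC1] := wt_integral_fin reg o Nc.
have [C4 C40 HC4] := trace_energy.
pose s' := (s / (s - 1))%R.
have s'0 : (0 < s')%R := conj_exp_gt0.
pose C := ((g * C4 `^ s'^-1) `^ s)%R.
have C0 : (0 < C)%R by rewrite powR_gt0// mulr_gt0// powR_gt0.
exists C => // b mb.
pose w x : \bar R := (om cexp x)%:E * ind (b x).
have mw : measurable_fun setT w.
  apply: emeasurable_funM; first exact: (measurable_EFin_wt reg).
  exact: measurable_ind.
have w0 x : 0 <= w x by rewrite mule_ge0 ?ind_ge0 ?(wt_EFin_ge0 reg).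
have V0 : 0 <= \int[mu]_x w x by exact: integral_ge0.
have Voo : \int[mu]_x w x < +oo.
  apply: le_lt_trans (ltry C1); apply: le_trans HC1.
  apply: le_integralT => [x|||x] //; first exact: (measurable_EFin_wt reg).
  by rewrite -[leRHS]mule1 lee_wpmul2l ?ind_le1 ?(wt_EFin_ge0 reg).
rewrite -/(w _).
have [V00|Vn0] := eqVneq (\int[mu]_x w x) 0.
  by rewrite V00 mule_ge0 ?cap_ge0// lee_fin ltW.
have [V VE V_gt0] : exists2 V : R, \int[mu]_x w x = V%:E & (0 < V)%R.
  exists (fine (\int[mu]_x w x)); first by rewrite fineK// ge0_fin_numE.
  by rewrite fine_gt0// Voo andbT lt0e Vn0.
rewrite -lee_pdivrMl// VE; apply/ereal_infP => _ [f [[mf f0] fb] <-].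
rewrite lee_pdivrMl//.
pose X := \int[mu]_x f x `^ s.
have X0 : 0 <= X by apply: integral_ge0 => x _; exact: poweR_ge0.
pose Q y := \int[mu]_x (w x * pker kap (0 + dist x y)).
have mk2 : measurable_fun setT (fun z : T * T => pker kap (0 + dist z.1 z.2)).
  exact: (measurable_pker_dist2 reg).
have mwk : measurable_fun setT (fun z : T * T => w z.1 * pker kap (0 + dist z.1 z.2)).
  by apply: emeasurable_funM => //; exact: measurable_fst_comp.
have wk0 x y : 0 <= w x * pker kap (0 + dist x y) by rewrite mule_ge0 ?pker_ge0.
have mQ : measurable_fun setT Q := measurable_integral_fst mu wk0 mwk.
have Q0 y : 0 <= Q y by exact: integral_ge0.
have mp : measurable_fun setT (pot 0 f) by exact: (measurable_pot reg).
have p0 x : 0 <= pot 0 f x by exact: pot_ge0.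
have mF : measurable_fun setT (fun z : T * T =>
    w z.1 * (pker kap (0 + dist z.1 z.2) * f z.2)).
  apply: emeasurable_funM; first exact: measurable_fst_comp.
  by apply: emeasurable_funM => //; exact: measurable_snd_comp.
have F0 x y : 0 <= w x * (pker kap (0 + dist x y) * f y).
  by apply: mule_ge0 => //; rewrite mule_ge0 ?pker_ge0.
have g0' : 0 <= g%:E by rewrite lee_fin ltW.
have le1 : V%:E <= g%:E * \int[mu]_y (f y * Q y).
  rewrite -VE; apply: (@le_trans _ _ (\int[mu]_x (g%:E * (w x * pot 0 f x)))).
    apply: le_integralT => [x|||x] //.
      by apply: emeasurable_funM => //; exact: emeasurable_funM.
    rewrite muleCA -[leLHS]mule1.
    have [bx|bx] := boolP (b x); first by rewrite lee_wpmul2l// fb.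
    by rewrite /w (negbTE bx) mule0 !mul0e.
  rewrite ge0_integralZl//; last 2 first.
  - exact: emeasurable_funM.
  - by move=> x _; exact: mule_ge0.
  rewrite lee_wpmul2l//.
  have -> : \int[mu]_x (w x * pot 0 f x) =
      \int[mu]_x \int[mu]_y (w x * (pker kap (0 + dist x y) * f y)).
    apply: eq_integral => x _; rewrite ge0_integralZl//.
      by apply: emeasurable_funM => //; exact: (measurable_section x mk2).
    by move=> y _; rewrite mule_ge0 ?pker_ge0.
  rewrite tonelli// le_eqVlt; apply/orP; left; apply/eqP.
  apply: eq_integral => y _; rewrite -ge0_integralZl//; last 1 first.
    exact: (measurable_section_fst y mwk).
  by apply: eq_integral => x _; rewrite muleA muleC.
have hold := hoelder_ereal mu f0 Q0 mf mQ s0 s'0 conj_expE.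
have QV : \int[mu]_y Q y `^ s' <= (C4 * V)%:E.
  by rewrite EFinM -VE; exact: HC4.
have le2 : V%:E <= g%:E * (X `^ s^-1 * ((C4 * V) `^ s'^-1)%:E).
  apply: (le_trans le1); rewrite lee_wpmul2l//; apply: (le_trans hold).
  rewrite lee_wpmul2l ?poweR_ge0// -poweR_EFin; apply: le_poweR => //.
    by rewrite invr_ge0 ltW.
  by apply: integral_ge0 => y _; exact: poweR_ge0.
rewrite -/X; move: X X0 le2 => {V0 Voo Vn0 VE le1 hold QV} X X0.
case: X X0 => [x|_ _|//]; last by rewrite gt0_muley ?leey// lte_fin.
rewrite lee_fin poweR_EFin -!EFinM !lee_fin => x0.
rewrite (powRM _ (ltW C40) (ltW V_gt0)).
have VV : (V = V `^ s^-1 * V `^ s'^-1)%R.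
  by rewrite -powRD_pos// conj_expE powRr1// ltW.
rewrite {1}VV [leRHS](_ : _ = g * C4 `^ s'^-1 * x `^ s^-1 * V `^ s'^-1)%R; last by ring.
rewrite ler_pM2r ?powR_gt0// => le3.
have : ((V `^ s^-1) `^ s <= (g * C4 `^ s'^-1 * x `^ s^-1) `^ s)%R.
  rewrite ge0_ler_powR ?nnegrE ?powR_ge0 ?(ltW s0)//.
  by rewrite !mulr_ge0 ?powR_ge0 ?ltW.
rewrite powRM ?mulr_ge0 ?powR_ge0 ?(ltW g0)// -!powRrM mulVf ?gt_eqF//.
by rewrite !powRr1// ltW.
Qed.

(** The layer cake formula writes the left side as an integral over the levels [t], at each of which
    [trace_capacity] applies. *)
Lemma weight_integral : exists2 C : R, (0 < C)%R & forall w : T -> \bar R,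
  measurable_fun setT w ->
  \int[mu]_x ((om cexp x)%:E * `|w x| `^ q) <=
  C%:E * \int[lebesgue_measure]_(t in `]0%R, +oo[) cap [set x | t%:E < `|w x| `^ q].
Proof.
have [C C0 HC] := trace_capacity; exists C => // w mw.
pose a x := `|w x| `^ q.
have ma : measurable_fun setT a.
  by apply: measurable_poweRe; exact: measurableT_comp.
have a0 x : 0 <= a x by exact: poweR_ge0.
pose phi t := cap [set x | t%:E < a x].
have phi0 t : 0 <= phi t by exact: cap_ge0.
have phi_anti t u : (t <= u)%R -> phi u <= phi t.
  by move=> tu; apply: cap_le => x /=; apply: le_lt_trans; rewrite lee_fin.
have mphi D : measurable_fun D phi by exact: measurable_antitone.
have mpos : measurable_fun setT (fun t : measurableTypeR R => ind (0 < t)%R : \bar R).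
  by apply: measurable_ind; exact: measurable_fun_ltr.
have mlt : measurable_fun setT (fun z : T * measurableTypeR R => z.2%:E < a z.1).
  apply: measurable_fun_lte.
    by apply/measurable_EFinP; exact: measurable_snd.
  exact: (measurable_fst_comp ma).
pose F x (t : measurableTypeR R) : \bar R :=
  (om cexp x)%:E * (ind (0 < t)%R * ind (t%:E < a x)).
have F0 x t : 0 <= F x t by rewrite !mule_ge0 ?ind_ge0 ?(wt_EFin_ge0 reg).
have mF : measurable_fun setT (fun z : T * measurableTypeR R => F z.1 z.2).
  apply: emeasurable_funM.
    exact: (measurable_fst_comp (measurable_EFin_wt reg o cexp)).
  apply: emeasurable_funM; first exact: (measurable_snd_comp mpos).
  exact: measurable_ind.
have -> : \int[mu]_x ((om cexp x)%:E * a x) =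
    \int[mu]_x \int[lebesgue_measure]_(t in [set: measurableTypeR R]) F x t.
  apply: eq_integral => x _; rewrite ge0_integralZl//.
  - by rewrite integral_below.
  - apply: emeasurable_funM => //.
    exact: (measurable_ind (measurable_section x mlt)).
  - by move=> t _; rewrite mule_ge0 ?ind_ge0.
  - exact: (wt_EFin_ge0 reg).
rewrite tonelli// [X in _ <= _ * X]integral_mkcond.
have mphiT : measurable_fun [set: measurableTypeR R] (phi \_ `]0%R, +oo[).
  by apply/(measurable_restrictT phi).
rewrite -ge0_integralZl//; last 2 first.
- by move=> t _; apply: erestrict_ge0 => *; exact: cap_ge0.
- by rewrite lee_fin ltW.
apply: ge0_le_integral => //.
- by move=> t _; exact: integral_ge0.
- exact: (measurable_integral_fst mu F0 mF).
- exact: emeasurable_funM.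
move=> t _; rewrite patchE mem_setE in_itv/= andbT.
have [t0|t0] := ltP 0%R t; last first.
  by rewrite mule0 integral0_eq// => x _; rewrite /F ltNge t0/= mul0e mule0.
have mb : measurable_fun setT (fun x => t%:E < a x).
  exact: (measurable_section_fst t mlt).
apply: le_trans (HC _ mb); rewrite le_eqVlt; apply/orP; left; apply/eqP.
by apply: eq_integral => x _; rewrite /F t0 mul1e.
Qed.

(** The splitting of [vnorm_restrict_le] with the weight in place of the potential;
    [om cexp |w| ^ theta] is integrable because [theta <= q] and [om cexp] is integrable. *)
Lemma vnorm_fin_of_weight (h w : T -> \bar R) :
  (forall y, 0 <= h y) -> measurable_fun setT h -> measurable_fun setT w ->
  (\forall x \ae mu, 0 <= w x) ->
  \int[mu]_x ((om cexp x)%:E * `|w x| `^ q) < +oo ->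
  \int[mu]_x (if h x == 0 then 0 else h x `^ s * epow (w x) (q - s)) < +oo ->
  vnorm h < +oo.
Proof.
move=> h0 mh mw wge0 woo hwoo.
have s1' := s1; case/andP: (qs) => q1 q_s; have s0 : (0 < s)%R by lra.
have Nc : (N < cexp)%R by exact: N_lt_cexp.
have [C1 C10 HC1] := wt_integral_fin reg o Nc.
pose s' := (s / (s - 1))%R.
have s'0 : (0 < s')%R := conj_exp_gt0.
have thE : ((s - q) / s * s' = theta s q)%R.
  by clear h0 mh mw wge0 woo hwoo; rewrite /s' /theta; field; lra.
pose D x : \bar R := if h x == 0 then 0 else h x `^ s * epow (w x) (q - s).
have D0 x : 0 <= D x by rewrite /D; case: ifP => // _; rewrite mule_ge0 ?poweR_ge0 ?epow_ge0.
have mD : measurable_fun setT D.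
  apply: measurable_fun_ifT => //; first exact: measurable_fun_eqe.
  by apply: emeasurable_funM; [exact: measurable_poweRe|exact: measurable_epow].
pose a := fun x => `|w x|.
have ma : measurable_fun setT a by exact: measurableT_comp.
have a0 x : 0 <= a x by exact: abse_ge0.
pose f x := D x `^ s^-1.
pose k x := (om kap x)%:E * a x `^ ((s - q) / s).
have f0 x : 0 <= f x by exact: poweR_ge0.
have k0 x : 0 <= k x by rewrite mule_ge0 ?poweR_ge0 ?(wt_EFin_ge0 reg).
have mf : measurable_fun setT f by exact: measurable_poweRe.
have mk : measurable_fun setT k.
  by apply: (measurable_wtM reg o kap); exact: measurable_poweRe.
have mwaq : measurable_fun setT (fun x => (om cexp x)%:E * a x `^ q).
  by apply: (measurable_wtM reg o cexp); exact: measurable_poweRe.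
have waq0 x : 0 <= (om cexp x)%:E * a x `^ q.
  by rewrite mule_ge0 ?poweR_ge0 ?(wt_EFin_ge0 reg).
have Dfin := ae_fin_integral D0 mD hwoo.
have wfin := ae_fin_integral waq0 mwaq woo.
have q0 : (0 < q)%R by lra.
apply: (@le_lt_trans _ _ (\int[mu]_x (f x * k x))).
  apply: le_ae_integralT => [x|x|||].
  - exact: (wtM_ge0 reg).
  - exact: mule_ge0.
  - exact: (measurable_wtM reg).
  - exact: emeasurable_funM.
  have ommul x (z : \bar R) : (om cexp x)%:E * z < +oo -> z < +oo.
    by case: z => [r||]; rewrite ?ltry// gt0_muley ?ltxx// lte_fin (wt_gt0 reg).
  apply: filterS3 wge0 Dfin wfin => x wx Dx /ommul /lty_poweRy.
  move=> /(_ (lt0r_neq0 q0)); rewrite /f /k /a.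
  have om0 : (0 < om kap x)%R by exact: (wt_gt0 reg).
  move: Dx; rewrite /D gee0_abs//; case: ifPn => [/eqP -> _ _|hn0].
    by rewrite mule0 mule_ge0 ?poweR_ge0// mule_ge0 ?poweR_ge0 ?(wt_EFin_ge0 reg).
  have {hn0}hpos : 0 < h x by rewrite lt0e hn0 h0.
  case: (w x) wx => [wr|//|//]; rewrite lee_fin => wr0 + _.
  (* Where [w] vanishes and [h] does not, the integrand is infinite, which its integrability
     excludes almost everywhere. *)
  have [->|wn0] := eqVneq wr 0%R.
    rewrite /epow leNgt subr_lt0 q_s/= opprB powR0 ?inve0; last by rewrite subr_eq0 gt_eqF.
    by rewrite gt0_muley ?ltxx// poweR_gt0.
  have {wn0}wr0' : (0 < wr)%R by rewrite lt0r wn0.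
  rewrite epow_pos//; case: (h x) hpos => [hr|_|//]; last first.
    by rewrite poweRyr ?gt_eqF// gt0_mulye ?ltxx// lte_fin powR_gt0.
  rewrite lte_fin => hr0 _.
  rewrite !poweR_EFin -!EFinM ?poweR_EFin -?EFinM lee_fin.
  rewrite powRM ?powR_ge0// -!powRrM mulfV ?gt_eqF// powRr1 ?(ltW hr0)//.
  rewrite [leRHS](_ : _ = om kap x * hr *
    (wr `^ ((q - s) / s) * wr `^ ((s - q) / s)))%R; last by ring.
  rewrite -powRD_pos// -mulrDl (_ : (q - s + (s - q) = 0)%R); last by ring.
  by rewrite mul0r powRr0 mulr1.
apply: (le_lt_trans (hoelder_ereal mu f0 k0 mf mk s0 s'0 conj_expE)).
have -> : \int[mu]_x f x `^ s = \int[mu]_x D x.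
  by apply: eq_integral => x _; rewrite /f poweR_invK.
have kE : \int[mu]_x k x `^ s' <= C1%:E + \int[mu]_x ((om cexp x)%:E * a x `^ q).
  apply: (@le_trans _ _ (\int[mu]_x ((om cexp x)%:E + (om cexp x)%:E * a x `^ q))).
    apply: le_integralT => [x|||x].
    - exact: poweR_ge0.
    - exact: measurable_poweRe.
    - by apply: emeasurable_funD => //; exact: (measurable_EFin_wt reg).
    have th := theta_itv qs.
    rewrite /k poweRM ?poweR_ge0 ?(wt_EFin_ge0 reg)// poweR_EFin wt_cexp -poweRrM.
    rewrite thE.
    rewrite -[X in X + _]mule1 -ge0_muleDr ?poweR_ge0//.
    rewrite lee_wpmul2l ?(wt_EFin_ge0 reg)//.
    have thq : (0 < theta s q <= q)%R by case/andP: th => -> th1; exact: le_trans th1 q1.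
    have := poweR_le_split thq ltr01 (a0 x).
    by rewrite !powR1 !mul1e.
  rewrite ge0_integralD//; last 2 first.
  - by move=> x _; exact: (wt_EFin_ge0 reg).
  - exact: (measurable_EFin_wt reg).
  by rewrite leeD2r.
rewrite lte_mul_pinfty ?poweR_ge0//.
  by rewrite ge0_fin_numE ?poweR_ge0// poweR_lty.
apply: poweR_lty; apply: (le_lt_trans kE).
by rewrite lte_add_pinfty ?ltry.
Qed.

End trace.

(** * Convexity and homogeneity of the energy *)

Section convexity.
Context {R : realType}.
Implicit Types a b x y u v : R.

Lemma powR_convex (p a b x y : R) : (1 <= p)%R -> (0 <= a)%R -> (0 <= b)%R ->
  (a + b = 1)%R -> (0 <= x)%R -> (0 <= y)%R ->
  ((a * x + b * y) `^ p <= a * x `^ p + b * y `^ p)%R.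
Proof.
move=> p1 a0 b0 ab x0 y0.
have a1 : (a <= 1)%R by lra.
have := @convex_powR R p p1 (Itv01 a0 a1) x y.
rewrite !inE/= !in_itv/= x0 y0 => /(_ isT isT).
have bE : (b = 1 - a)%R by lra.
by rewrite bE.
Qed.

(** With [p = s / q], the function [x ^ s u ^ (q - s)] is the [q]-th power of [u (x / u) ^ p], the
    perspective of a convex power. The perspective is convex and nonnegative, and since [q >= 1] its
    [q]-th power is convex too. *)
Lemma perspective_convex (s q a b x y u v : R) : (1 <= q < s)%R ->
  (0 <= a)%R -> (0 <= b)%R -> (a + b = 1)%R -> (0 <= x)%R -> (0 <= y)%R ->
  (0 < u)%R -> (0 < v)%R ->
  ((a * x + b * y) `^ s * (a * u + b * v) `^ (q - s) <=
   a * (x `^ s * u `^ (q - s)) + b * (y `^ s * v `^ (q - s)))%R.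
Proof.
move=> /andP[q1 q_s] a0 b0 ab x0 y0 u0 v0.
have q0 : (0 < q)%R by lra.
pose p := (s / q)%R.
have p1 : (1 <= p)%R by rewrite ler_pdivlMr//; lra.
pose F (h w : R) := (w * (h / w) `^ p)%R.
have F0 h w : (0 <= w)%R -> (0 <= F h w)%R by move=> w0; rewrite mulr_ge0 ?powR_ge0.
have FE h w : (0 <= h)%R -> (0 < w)%R -> (F h w `^ q = h `^ s * w `^ (q - s))%R.
  move=> h0 w0; have wV : (0 <= w^-1)%R by rewrite invr_ge0 ltW.
  rewrite /F powRM ?powR_ge0 ?(ltW w0)// -powRrM divfK ?gt_eqF//.
  by rewrite powRM// powRV ?(ltW w0)// powRB_pos// mulrCA.
have W0 : (0 < a * u + b * v)%R.
  have [a00|an0] := eqVneq a 0%R.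
    by rewrite a00 mul0r add0r mulr_gt0//; lra.
  by rewrite ltr_wpDr ?mulr_ge0 ?(ltW v0)// mulr_gt0// lt0r an0.
have H0 : (0 <= a * x + b * y)%R by rewrite addr_ge0// mulr_ge0.
rewrite -!FE//; set W := (a * u + b * v)%R in W0 *.
apply: (@le_trans _ _ ((a * F x u + b * F y v) `^ q)%R); last first.
  by apply: powR_convex => //; rewrite F0// ltW.
rewrite ge0_ler_powR ?nnegrE ?(ltW q0) ?F0 ?(ltW W0)//.
  by rewrite addr_ge0// mulr_ge0// F0 ?ltW.
rewrite {1}/F.
have -> : ((a * x + b * y) / W = (a * u / W) * (x / u) + (b * v / W) * (y / v))%R.
  by field; rewrite !gt_eqF.
have Wn0 : W != 0%R by rewrite gt_eqF.
apply: (@le_trans _ _ (W * (a * u / W * (x / u) `^ p + b * v / W * (y / v) `^ p))%R).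
  rewrite ler_wpM2l ?(ltW W0)//; apply: powR_convex => //.
  - by rewrite divr_ge0 ?mulr_ge0 ?(ltW u0) ?(ltW W0).
  - by rewrite divr_ge0 ?mulr_ge0 ?(ltW v0) ?(ltW W0).
  - by rewrite -mulrDl mulfV.
  - by rewrite divr_ge0// ltW.
  - by rewrite divr_ge0// ltW.
rewrite le_eqVlt; apply/orP; left; apply/eqP; rewrite /F.
by move: ((x / u) `^ p)%R ((y / v) `^ p)%R => c e; field.
Qed.

End convexity.

Section energy_norm.
Context d (T : measurableType d) (R : realType).
Variables (mu : {sigma_finite_measure set T -> \bar R}) (dist : T -> T -> R).
Variables (N cL cU : R).
Hypothesis reg : ahlfors_regular mu dist N cL cU.
Variables (o : T) (kap s q : R).
Hypothesis kapN : (0 < kap < N)%R.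
Hypothesis s1 : (1 < s)%R.
Hypothesis qs : (1 <= q < s)%R.
Hypothesis crit : ((N - kap) * s < N)%R.
Implicit Types (h : T -> \bar R).

Local Notation om := (wt dist o).
Local Notation pot := (pot mu dist kap).
Local Notation vnorm := (vnorm mu dist o kap).
Local Notation ener := (ener mu dist kap s q).

(** On the whole space and with [lam = 1], [vnorm_restrict_le] bounds [vnorm h] by its own power
    [(s - q) / s < 1] times a power of the energy; as [vnorm h] is finite, that power can be divided
    out. *)
Lemma vnorm_le_ener : exists2 C : R, (0 < C)%R & forall h,
  (forall y, 0 <= h y) -> measurable_fun setT h -> vnorm h < +oo ->
  vnorm h <= C%:E * ener h `^ q^-1.
Proof.
have s1' := s1; case/andP: (qs) => q1 q_s.
have q0 : (0 < q)%R by lra.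
have s0 : (0 < s)%R by lra.
have [p [p1 kp]] := exists_pot_power kapN.
have Nc : (N < cexp kap s)%R by exact: N_lt_cexp.
have [C1 C10 HC1] := wt_integral_fin reg o Nc.
have [C C0 HC] := vnorm_restrict_le reg o kapN s1 qs crit p1 kp.
pose K := (C1 + C)%R; have K0 : (0 < K)%R by rewrite addr_gt0.
have s10 : (0 < (s - 1) / s)%R by rewrite divr_gt0//; lra.
have thE : (theta s q * ((s - 1) / s) = (s - q) / s)%R.
  by rewrite /theta; field; lra.
have sumE : ((s - q) / s + q / s = 1)%R by field; lra.
have invE : (s^-1 * (s / q) = q^-1)%R by field; lra.
have invE2 : (q / s * (s / q) = 1)%R by field; lra.
exists ((K `^ ((s - 1) / s)) `^ (s / q))%R; first by rewrite !powR_gt0.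
move=> h h0 mh voo.
have v0 : 0 <= vnorm h by exact: (vnorm_ge0 reg).
have [v00|vn0] := eqVneq (vnorm h) 0.
  by rewrite v00 mule_ge0 ?poweR_ge0// lee_fin powR_ge0.
have [M vM M0] : exists2 M : R, vnorm h = M%:E & (0 < M)%R.
  exists (fine (vnorm h)); first by rewrite fineK// ge0_fin_numE.
  by rewrite fine_gt0// voo andbT lt0e vn0.
have := HC h (fun _ => true) 1%R h0 mh (measurable_cst _) voo (lexx _).
rewrite (_ : \int[mu]_y _ = vnorm h); last first.
  by apply: eq_integral => y _; rewrite mul1e.
have I1 : \int[mu]_y ((om (cexp kap s) y)%:E * ind true) <= C1%:E.
  by under eq_integral do rewrite mule1.
move=> le1; have {le1} : vnorm h <= ener h `^ s^-1 *
    (vnorm h `^ theta s q * K%:E) `^ ((s - 1) / s).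
  apply: (le_trans le1); rewrite lee_wpmul2l ?poweR_ge0//.
  apply: le_poweR; first exact: ltW.
    rewrite mule_ge0 ?poweR_ge0// mul1e adde_ge0 ?lee_fin ?mulr_ge0 ?powR_ge0 ?(ltW C0)//.
    by apply: integral_ge0 => y _; rewrite mule_ge0 ?ind_ge0 ?(wt_EFin_ge0 reg).
  by rewrite lee_wpmul2l ?poweR_ge0// mul1e powR1 mul1r EFinD leeD2r.
rewrite vM; have := ener_ge0 mu dist kap s q h.
case: (ener h) => [e|_|//]; last first.
  by rewrite !poweRyr ?invr_neq0 ?gt_eqF// gt0_muley ?leey// lte_fin !powR_gt0.
rewrite lee_fin => e0; rewrite !poweR_EFin -!EFinM ?poweR_EFin -?EFinM !lee_fin.
rewrite powRM ?powR_ge0 ?(ltW K0)// -powRrM thE => le2.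
have {le2} le3 : (M `^ (q / s) <= e `^ s^-1 * K `^ ((s - 1) / s))%R.
  have Ms : (0 < M `^ ((s - q) / s))%R by rewrite powR_gt0.
  rewrite -(ler_pM2l Ms) -powRD_pos// sumE powRr1 ?(ltW M0)//.
  by apply: (le_trans le2); rewrite le_eqVlt; apply/orP; left; apply/eqP; ring.
have sq0 : (0 <= s / q)%R by rewrite divr_ge0 ?ltW.
have := ge0_ler_powR sq0 (powR_ge0 _ _) _ le3.
rewrite nnegrE mulr_ge0 ?powR_ge0// => /(_ isT).
by rewrite -powRrM invE2 powRr1 ?(ltW M0)// powRM ?powR_ge0// -powRrM invE mulrC.
Qed.

(** With [del = lam ^ (- p) C] both summands in [vnorm_restrict_le] are of order [lam ^ (1 - p)].
    The whole bound becomes [B lam ^ (- c)], and [lam] is taken large enough to bring it below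
    [eps]. *)
Lemma vnorm_equi_integrable (E0 M0 : R) : (0 < E0)%R -> (0 < M0)%R ->
  forall eps : R, (0 < eps)%R -> exists2 del : R, (0 < del)%R &
  forall h (A : T -> bool), (forall y, 0 <= h y) -> measurable_fun setT h ->
    measurable_fun setT A -> ener h <= E0%:E -> vnorm h <= M0%:E ->
    \int[mu]_y ((om (cexp kap s) y)%:E * ind (A y)) <= del%:E ->
    \int[mu]_y ((om kap y)%:E * (ind (A y) * h y)) <= eps%:E.
Proof.
move=> E00 M00 eps eps0.
have s1' := s1; case/andP: (qs) => q1 q_s.
have s0 : (0 < s)%R by lra.
have [p [p1 kp]] := exists_pot_power kapN.
have [C C0 HC] := vnorm_restrict_le reg o kapN s1 qs crit p1 kp.
have s10 : (0 < (s - 1) / s)%R by rewrite divr_gt0//; lra.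
pose c := ((p - 1) * ((s - 1) / s))%R.
have c0 : (0 < c)%R by rewrite mulr_gt0//; lra.
pose B := (E0 `^ s^-1 * (M0 `^ theta s q * (2 * C)) `^ ((s - 1) / s))%R.
have B0 : (0 < B)%R by rewrite mulr_gt0 ?powR_gt0// !mulr_gt0 ?powR_gt0.
pose lam := Order.max 1%R ((B / eps) `^ c^-1)%R.
have lam1 : (1 <= lam)%R by rewrite le_max lexx.
have lam0 : (0 < lam)%R by exact: lt_le_trans lam1.
have lamc : (B / eps <= lam `^ c)%R.
  have -> : (B / eps = ((B / eps) `^ c^-1) `^ c)%R.
    by rewrite -powRrM mulVf ?gt_eqF// powRr1// divr_ge0 ?ltW.
  by rewrite ge0_ler_powR ?nnegrE ?powR_ge0 ?(ltW c0) ?(ltW lam0)// le_max lexx orbT.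
exists (lam `^ (- p) * C)%R; first by rewrite mulr_gt0 ?powR_gt0.
move=> h A h0 mh mA eE vM Adel.
have v0 : 0 <= vnorm h by exact: (vnorm_ge0 reg).
have voo : vnorm h < +oo by exact: (le_lt_trans vM (ltry _)).
apply: (le_trans (HC h A lam h0 mh mA voo lam1)).
apply: (@le_trans _ _ ((E0 `^ s^-1)%:E *
   (((M0 `^ theta s q) * (lam * (lam `^ (- p) * C) + lam `^ (1 - p) * C)) `^ ((s - 1) / s))%:E)).
  apply: lee_pmul; rewrite ?poweR_ge0//.
    by rewrite -poweR_EFin; apply: le_poweR; rewrite ?invr_ge0 ?(ltW s0) ?ener_ge0.
  rewrite -poweR_EFin; apply: le_poweR; first exact: ltW.
    rewrite mule_ge0 ?poweR_ge0// adde_ge0 ?lee_fin ?mulr_ge0 ?powR_ge0 ?(ltW C0)//.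
    rewrite mule_ge0 ?lee_fin ?(ltW lam0)//.
    by apply: integral_ge0 => y _; rewrite mule_ge0 ?ind_ge0 ?(wt_EFin_ge0 reg).
  rewrite (EFinM (M0 `^ theta s q)); apply: lee_pmul; rewrite ?poweR_ge0//.
  - rewrite adde_ge0 ?lee_fin ?mulr_ge0 ?powR_ge0 ?(ltW C0)//.
    rewrite mule_ge0 ?lee_fin ?(ltW lam0)//.
    by apply: integral_ge0 => y _; rewrite mule_ge0 ?ind_ge0 ?(wt_EFin_ge0 reg).
  - rewrite -poweR_EFin; apply: le_poweR => //.
    by case/andP: (theta_itv qs) => /ltW.
  by rewrite EFinD leeD2r// EFinM lee_wpmul2l// lee_fin ltW.
rewrite -EFinM lee_fin.
have -> : (lam * (lam `^ (- p) * C) + lam `^ (1 - p) * C = (2 * C) * lam `^ (1 - p))%R.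
  rewrite mulrA -{1}(powRr1 (ltW lam0)) -powRD_pos//.
  by move: (lam `^ (1 - p))%R => z; ring.
rewrite mulrA (powRM _ _ (powR_ge0 lam _)); last first.
  by rewrite !mulr_ge0 ?powR_ge0 ?(ltW C0).
rewrite mulrA -/B -powRrM (_ : ((1 - p) * ((s - 1) / s) = - c)%R); last first.
  by rewrite /c -mulNr opprB.
rewrite powRN mulrA -(mulrA (M0 `^ _)%R 2%R C) -[(_ * _)%R]/(B / _)%R ler_pdivrMr ?powR_gt0//.
by rewrite mulrC -ler_pdivrMr.
Qed.

Lemma potD h1 h2 x : (forall y, 0 <= h1 y) -> (forall y, 0 <= h2 y) ->
  measurable_fun setT h1 -> measurable_fun setT h2 ->
  pot 0 (fun y => h1 y + h2 y) x = pot 0 h1 x + pot 0 h2 x.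
Proof.
move=> h10 h20 mh1 mh2; rewrite -ge0_integralD//.
- by apply: eq_integral => y _; rewrite ge0_muleDr.
- by move=> y _; rewrite mule_ge0 ?pker_ge0.
- by apply: emeasurable_funM => //; exact: (measurable_pker_dist reg).
- by move=> y _; rewrite mule_ge0 ?pker_ge0.
- by apply: emeasurable_funM => //; exact: (measurable_pker_dist reg).
Qed.

Lemma vnormD h1 h2 : (forall y, 0 <= h1 y) -> (forall y, 0 <= h2 y) ->
  measurable_fun setT h1 -> measurable_fun setT h2 ->
  vnorm (fun y => h1 y + h2 y) = vnorm h1 + vnorm h2.
Proof.
move=> h10 h20 mh1 mh2; rewrite -ge0_integralD//.
- by apply: eq_integral => y _; rewrite ge0_muleDr.
- by move=> y _; exact: (wtM_ge0 reg).
- exact: (measurable_wtM reg).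
- by move=> y _; exact: (wtM_ge0 reg).
- exact: (measurable_wtM reg).
Qed.

Lemma vnormZ (c : R) h : (0 <= c)%R -> (forall y, 0 <= h y) ->
  measurable_fun setT h -> vnorm (fun y => c%:E * h y) = c%:E * vnorm h.
Proof.
move=> c0 h0 mh; rewrite -ge0_integralZl ?lee_fin//.
- by apply: eq_integral => y _; rewrite muleCA.
- exact: (measurable_wtM reg).
- by move=> y _; exact: (wtM_ge0 reg).
Qed.

Lemma epowZ (c : R) (x : \bar R) (r : R) : (0 < c)%R -> (r < 0)%R -> 0 <= x ->
  epow (c%:E * x) r = (c `^ r)%:E * epow x r.
Proof.
move=> c0 r0; have rn : (0 < - r)%R by rewrite oppr_gt0.
have e0 : epow 0 r = +oo :> \bar R.
  by rewrite /epow leNgt r0/= powR0 ?gt_eqF// inve0.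
have ey : epow +oo r = 0 :> \bar R.
  by rewrite /epow leNgt r0/= gt_eqF// invey.
case: x => [x|_|//]; last by rewrite gt0_muley ?lte_fin// ey mule0.
rewrite lee_fin => x0; have [->|xn0] := eqVneq x 0%R.
  by rewrite mule0 e0 gt0_muley// lte_fin powR_gt0.
have {xn0}xpos : (0 < x)%R by rewrite lt0r xn0.
by rewrite -EFinM !epow_pos ?mulr_gt0// powRM ?(ltW c0).
Qed.

Lemma enerZ (c : R) h : (0 < c)%R -> (forall y, 0 <= h y) ->
  measurable_fun setT h -> ener (fun y => c%:E * h y) = (c `^ q)%:E * ener h.
Proof.
move=> c0 h0 mh; case/andP: (qs) => q1 q_s.
rewrite -ge0_integralZl ?lee_fin ?powR_ge0//; last 2 first.
- exact: (measurable_ener_density reg).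
- by move=> y _; exact: ener_density_ge0.
apply: eq_integral => x _; rewrite /ener_density mule_eq0 eqe (gt_eqF c0)/=.
case: ifPn => hx0; first by rewrite mule0.
rewrite (potZ reg kap 0%R x (ltW c0) h0 mh)// poweRM ?lee_fin ?(ltW c0)// epowZ ?subr_lt0 ?pot_ge0//.
rewrite muleACA poweR_EFin -EFinM -powRD_pos// (_ : (s + (q - s) = q)%R)//; ring.
Qed.

Lemma eq_ae_ener h h' : (forall y, 0 <= h y) -> (forall y, 0 <= h' y) ->
  measurable_fun setT h -> measurable_fun setT h' ->
  (\forall y \ae mu, h y = h' y) -> ener h = ener h'.
Proof.
move=> h0 h'0 mh mh' hh'.
have pE x : pot 0 h x = pot 0 h' x by exact: (eq_ae_pot reg).
apply: eq_ae_integralT => [x|x|||].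
- exact: ener_density_ge0.
- exact: ener_density_ge0.
- exact: (measurable_ener_density reg).
- exact: (measurable_ener_density reg).
by apply: filterS hh' => x hx; rewrite /ener_density hx pE.
Qed.

Lemma ener_convex (a b : R) h1 h2 : (0 < a)%R -> (0 < b)%R -> (a + b = 1)%R ->
  (forall y, 0 <= h1 y) -> (forall y, 0 <= h2 y) ->
  measurable_fun setT h1 -> measurable_fun setT h2 ->
  vnorm h1 < +oo -> vnorm h2 < +oo ->
  ener (fun y => a%:E * h1 y + b%:E * h2 y) <= a%:E * ener h1 + b%:E * ener h2.
Proof.
move=> a0 b0 ab h10 h20 mh1 mh2 v1 v2; case/andP: (qs) => q1 q_s.
(* A function that vanishes almost everywhere has zero potential, outside the range of
   [perspective_convex]. In that case homogeneity suffices, as [c ^ q <= c] for [c <= 1 <= q]. *)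
have degenerate (c : R) h h' : (0 < c <= 1)%R -> (forall y, 0 <= h y) ->
    (forall y, 0 <= h' y) -> measurable_fun setT h -> measurable_fun setT h' ->
    vnorm h' = 0 -> forall b' : R, (0 < b')%R ->
    ener (fun y => c%:E * h y + b'%:E * h' y) <= c%:E * ener h.
  move=> /andP[c0 c1] h0 h'0 mh mh' v' b' b'0.
  have ah' := ae_eq0_of_vnorm reg h'0 mh' v'.
  have cge : 0 <= c%:E by rewrite lee_fin ltW.
  have bge : 0 <= b'%:E by rewrite lee_fin ltW.
  rewrite (@eq_ae_ener _ (fun y => c%:E * h y)).
  - rewrite enerZ// lee_wpmul2r ?ener_ge0// lee_fin.
    by rewrite -[leRHS](powRr1 (ltW c0)) ger_powR ?c0.
  - by move=> y; rewrite adde_ge0 ?mule_ge0.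
  - by move=> y; rewrite mule_ge0.
  - by apply: emeasurable_funD; exact: emeasurable_funM.
  - exact: emeasurable_funM.
  - by apply: filterS ah' => y ->; rewrite mule0 adde0.
have a01 : (0 < a <= 1)%R by rewrite a0/=; lra.
have b01 : (0 < b <= 1)%R by rewrite b0/=; lra.
have age : 0 <= a%:E by rewrite lee_fin ltW.
have bge : 0 <= b%:E by rewrite lee_fin ltW.
have [v10|v1n] := eqVneq (vnorm h1) 0.
  under eq_fun do rewrite addeC.
  apply: (le_trans (degenerate b h2 h1 b01 h20 h10 mh2 mh1 v10 a a0)).
  by rewrite leeDr// mule_ge0 ?ener_ge0.
have [v20|v2n] := eqVneq (vnorm h2) 0.
  apply: (le_trans (degenerate a h1 h2 a01 h10 h20 mh1 mh2 v20 b b0)).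
  by rewrite leeDl// mule_ge0 ?ener_ge0.
have v1p : 0 < vnorm h1 by rewrite lt0e v1n (vnorm_ge0 reg).
have v2p : 0 < vnorm h2 by rewrite lt0e v2n (vnorm_ge0 reg).
have mD1 := measurable_ener_density reg kap s q h10 mh1.
have mD2 := measurable_ener_density reg kap s q h20 mh2.
rewrite -!ge0_integralZl//; last 2 first.
- by move=> x _; exact: ener_density_ge0.
- by move=> x _; exact: ener_density_ge0.
rewrite -ge0_integralD//; last 4 first.
- by move=> x _; rewrite mule_ge0 ?ener_density_ge0.
- exact: emeasurable_funM.
- by move=> x _; rewrite mule_ge0 ?ener_density_ge0.
- exact: emeasurable_funM.
have mH : measurable_fun setT (fun y => a%:E * h1 y + b%:E * h2 y).
  by apply: emeasurable_funD; exact: emeasurable_funM.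
have H0 y : 0 <= a%:E * h1 y + b%:E * h2 y by rewrite adde_ge0 ?mule_ge0.
apply: le_ae_integralT => [x|x|||].
- exact: ener_density_ge0.
- by rewrite adde_ge0 ?mule_ge0 ?ener_density_ge0.
- exact: (measurable_ener_density reg).
- by apply: emeasurable_funD; exact: emeasurable_funM.
have u1f := pot_ae_fin reg kapN s1 crit h10 mh1 v1.
have u2f := pot_ae_fin reg kapN s1 crit h20 mh2 v2.
have h1f := ae_fin_of_vnorm reg h10 mh1 v1.
have h2f := ae_fin_of_vnorm reg h20 mh2 v2.
apply: filterS2 (filterI u1f u2f) (filterI h1f h2f) => x [u1x u2x] [h1x h2x].
have u1p := pot_gt0 reg kapN x h10 mh1 v1p.
have u2p := pot_gt0 reg kapN x h20 mh2 v2p.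
rewrite /ener_density (potD _ (fun y => mule_ge0 age (h10 y)) (fun y => mule_ge0 bge (h20 y)));
  [|exact: emeasurable_funM|exact: emeasurable_funM].
rewrite (potZ reg kap 0%R x (ltW a0) h10 mh1) (potZ reg kap 0%R x (ltW b0) h20 mh2).
have := h10 x; have := h20 x; move: u1p u2p u1x u2x h1x h2x.
case: (pot 0 h1 x) => [u1||]//; case: (pot 0 h2 x) => [u2||]//.
case: (h1 x) => [r1||]//; case: (h2 x) => [r2||]//.
rewrite !lte_fin !lee_fin => u10 u20 _ _ _ _ r20 r10.
have dens (r u : R) : (0 <= r)%R -> (0 < u)%R ->
    (if r%:E == 0 then 0 else r%:E `^ s * epow u%:E (q - s)) =
    (r `^ s * u `^ (q - s))%:E.
  move=> r0 u0; rewrite eqe; case: eqP => [->|_]; last by rewrite epow_pos.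
  have s1' := s1; by rewrite powR0 ?mul0r// gt_eqF//; lra.
rewrite -!EFinM -!EFinD !dens//.
- rewrite -!EFinM -EFinD lee_fin.
  by apply: perspective_convex => //; rewrite ?ltW ?q1 ?q_s.
- by rewrite addr_ge0// mulr_ge0// ltW.
- by rewrite addr_gt0// mulr_gt0.
Qed.

(** Convexity is applied to the normalised functions [h1 / x] and [h2 / y], of energy at most [1],
    with weights [x / (x + y)] and [y / (x + y)]; homogeneity of degree [q] restores the factor
    [x + y]. *)
Lemma ener_add (x y : R) h1 h2 : (0 < x)%R -> (0 < y)%R ->
  (forall y, 0 <= h1 y) -> (forall y, 0 <= h2 y) ->
  measurable_fun setT h1 -> measurable_fun setT h2 ->
  vnorm h1 < +oo -> vnorm h2 < +oo ->
  ener h1 <= (x `^ q)%:E -> ener h2 <= (y `^ q)%:E ->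
  ener (fun z => h1 z + h2 z) <= ((x + y) `^ q)%:E.
Proof.
move=> x0 y0 h10 h20 mh1 mh2 v1 v2 e1 e2.
have xy0 : (0 < x + y)%R by rewrite addr_gt0.
pose a := (x / (x + y))%R; pose b := (y / (x + y))%R.
have a0 : (0 < a)%R by rewrite divr_gt0.
have b0 : (0 < b)%R by rewrite divr_gt0.
have ab : (a + b = 1)%R by rewrite -mulrDl mulfV// gt_eqF.
have xV : (0 < x^-1)%R by rewrite invr_gt0.
have yV : (0 < y^-1)%R by rewrite invr_gt0.
pose k1 z := x^-1%:E * h1 z; pose k2 z := y^-1%:E * h2 z.
have k10 z : 0 <= k1 z by rewrite mule_ge0// lee_fin ltW.
have k20 z : 0 <= k2 z by rewrite mule_ge0// lee_fin ltW.
have mk1 : measurable_fun setT k1 by exact: emeasurable_funM.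
have mk2 : measurable_fun setT k2 by exact: emeasurable_funM.
have vk1 : vnorm k1 < +oo by rewrite vnormZ ?ltW// lte_mul_pinfty ?lee_fin ?ltW.
have vk2 : vnorm k2 < +oo by rewrite vnormZ ?ltW// lte_mul_pinfty ?lee_fin ?ltW.
have ek (z : R) h : (0 < z)%R -> (forall y, 0 <= h y) -> measurable_fun setT h ->
    ener h <= (z `^ q)%:E -> ener (fun w => z^-1%:E * h w) <= 1.
  move=> z0 h0 mh eh; rewrite enerZ ?invr_gt0//.
  apply: (le_trans (lee_wpmul2l _ eh)); first by rewrite lee_fin powR_ge0.
  by rewrite -EFinM powRV ?(ltW z0)// mulVf// gt_eqF// powR_gt0.
have E : ener (fun z => a%:E * k1 z + b%:E * k2 z) <= 1.
  apply: (le_trans (ener_convex a0 b0 ab k10 k20 mk1 mk2 vk1 vk2)).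
  apply: (@le_trans _ _ (a%:E * 1 + b%:E * 1)); last by rewrite !mule1 -EFinD ab.
  by apply: leeD; rewrite lee_wpmul2l ?lee_fin ?(ltW a0) ?(ltW b0)//; exact: ek.
have -> : (fun z => h1 z + h2 z) = (fun z => (x + y)%:E * (a%:E * k1 z + b%:E * k2 z)).
  apply/funext => z; rewrite /k1 /k2 ge0_muleDr ?mule_ge0 ?lee_fin ?(ltW a0) ?(ltW b0) ?(ltW xV) ?(ltW yV)//.
  rewrite !muleA -!EFinM /a /b.
  rewrite (_ : ((x + y) * (x / (x + y)) / x = 1)%R); last by field; rewrite !gt_eqF.
  by rewrite (_ : ((x + y) * (y / (x + y)) / y = 1)%R) ?mul1e//; field; rewrite !gt_eqF.
rewrite enerZ//.
- by rewrite -[leRHS]mule1 lee_wpmul2l// lee_fin powR_ge0.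
- by move=> z; apply: adde_ge0; apply: mule_ge0; rewrite ?k10 ?k20// lee_fin ltW.
- by apply: emeasurable_funD; exact: emeasurable_funM.
Qed.

End energy_norm.

(** * Convergent selections from nested convex sets *)

Section integralT.
Context d (T : measurableType d) (R : realType) (mu : {measure set T -> \bar R}).

Lemma integralT_add (f g : T -> \bar R) : (forall x, 0 <= f x) -> (forall x, 0 <= g x) ->
  measurable_fun setT f -> measurable_fun setT g ->
  \int[mu]_x (f x + g x) = \int[mu]_x f x + \int[mu]_x g x.
Proof. by move=> f0 g0 mf mg; rewrite ge0_integralD. Qed.

Lemma integralT_scale (k : R) (f : T -> \bar R) : (0 <= k)%R -> (forall x, 0 <= f x) ->
  measurable_fun setT f -> \int[mu]_x (k%:E * f x) = k%:E * \int[mu]_x f x.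
Proof. by move=> k0 f0 mf; rewrite ge0_integralZl// lee_fin. Qed.

End integralT.

Lemma cvgn_of_summable_steps (R : realType) (u : nat -> R) :
  \sum_(k <oo) `|u k.+1 - u k|%:E < +oo -> cvgn u.
Proof.
move=> uoo.
have s0 : 0 <= \sum_(k <oo) `|u k.+1 - u k|%:E.
  by apply: nneseries_ge0 => k _ _; rewrite lee_fin.
have : cvgn (series (telescope u)).
  apply: normed_cvg; apply: nondecreasing_is_cvgn.
    apply: (@nondecreasing_series _ (fun k => `|telescope u k|%R) predT 0) => k _ _.
    exact: normr_ge0.
  exists (fine (\sum_(k <oo) `|u k.+1 - u k|%:E)) => _ [k _ <-].
  rewrite -lee_fin fineK ?ge0_fin_numE// /series/= -sumEFin.
  by apply: nneseries_lim_ge => j _ _; rewrite lee_fin.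
move=> /cvg_ex[/= l ul]; apply/cvg_ex; exists (u 0%N + l)%R.
have : (fun k => u 0%N + series (telescope u) k)%R @ \oo --> (u 0%N + l)%R.
  by apply: (@cvgD _ R^o _ _ _ (fun=> u 0%N)) ul; exact: cvg_cst.
rewrite (_ : (fun k => _) = u)//; apply/funext => k.
by rewrite -eq_sum_telescope.
Qed.

(** The convexity defect of [exp (- g)] at midpoints is an exact square, the squared distance in the
    variable [exp (- g / 2)], which is bounded for nonnegative [g]. *)
Lemma expRN_midpoint (R : realType) (a b : R) :
  ((expR (- (a / 2)) - expR (- (b / 2))) ^+ 2 =
   expR (- a) + expR (- b) - 2 * expR (- ((a + b) / 2)))%R.
Proof.
have -> : (expR (- a) = expR (- (a / 2)) * expR (- (a / 2)))%R.
  by rewrite -expRD; congr expR; field.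
have -> : (expR (- b) = expR (- (b / 2)) * expR (- (b / 2)))%R.
  by rewrite -expRD; congr expR; field.
have -> : (expR (- ((a + b) / 2)) = expR (- (a / 2)) * expR (- (b / 2)))%R.
  by rewrite -expRD; congr expR; field.
by ring.
Qed.

Section limits.
Context d (T : measurableType d) (R : realType).
Variable mu : {measure set T -> \bar R}.

Lemma measurable_limn_einf (f : nat -> T -> \bar R) :
  (forall k, measurable_fun setT (f k)) ->
  measurable_fun setT (fun x => limn_einf (f ^~ x)).
Proof.
move=> mf; have fE x : limn_einf (f ^~ x) = - limn_esup (fun k => - f k x).
  by rewrite -[limn_esup _]/(limn_esup (-%E \o f ^~ x)) limn_esupN oppeK.
under eq_fun do rewrite fE.
by apply: measurableT_comp => //; apply: measurable_fun_limn_esup => k; exact: measurableT_comp.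
Qed.

Lemma limn_einf_ge0 (u : nat -> \bar R) : (forall k, 0 <= u k) -> 0 <= limn_einf u.
Proof.
move=> u0; rewrite limn_einf_lim; apply: lime_ge; first exact: is_cvg_einfs.
by apply: nearW => k; apply: le_ereal_inf_tmp => _ [i _ <-].
Qed.

Lemma limn_einf_le_bound (u : nat -> \bar R) B : (forall k, u k <= B) -> limn_einf u <= B.
Proof.
move=> uB; rewrite limn_einf_lim; apply: lime_le; first exact: is_cvg_einfs.
apply: nearW => k; apply: le_trans (uB k).
by apply: ereal_inf_lbound; exists k => /=.
Qed.

Lemma cvg_le_limn_einf (l u : nat -> \bar R) L :
  l @ \oo --> L -> (forall k, l k <= u k) -> L <= limn_einf u.
Proof.
move=> lL lu; have [<- _] := cvg_limn_einf_sup lL.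
rewrite !limn_einf_lim; apply: lee_lim; [exact: is_cvg_einfs|exact: is_cvg_einfs|].
apply: nearW => k; apply: le_ereal_inf_tmp => _ [i /= ki <-].
by apply: le_trans (lu i); apply: ereal_inf_lbound; exists i.
Qed.

Lemma fatou_bound (f : nat -> T -> \bar R) F B :
  (forall k x, 0 <= f k x) -> (forall k, measurable_fun setT (f k)) ->
  (forall x, 0 <= F x) -> measurable_fun setT F ->
  (forall k, \int[mu]_x f k x <= B) ->
  (\forall x \ae mu, F x <= limn_einf (f ^~ x)) -> \int[mu]_x F x <= B.
Proof.
move=> f0 mf F0 mF fB Ff.
apply: (@le_trans _ _ (\int[mu]_x limn_einf (f ^~ x))).
  apply: le_ae_integralT => //; first by move=> x; exact: limn_einf_ge0.
  exact: measurable_limn_einf.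
apply: (le_trans (fatou mu measurableT mf (fun k x _ => f0 k x))).
exact: limn_einf_le_bound.
Qed.

Lemma nneseries_term_cvg0 (u : nat -> \bar R) : (forall k, 0 <= u k) ->
  \sum_(k <oo) u k < +oo -> u @ \oo --> 0.
Proof.
move=> u0 uoo; apply: (@squeeze_cvge _ _ _ _ (cst 0) _ (fun n => \sum_(n <= k <oo) u k)).
- apply: nearW => n; rewrite u0/=.
  have <- : \sum_(n <= k < n.+1) u k = u n by rewrite big_nat1.
  exact: nneseries_lim_ge.
- exact: cvg_cst.
- by apply: nneseries_tail_cvg => // k _.
Qed.

Lemma markov_ind (W : T -> \bar R) (f : T -> R) (A m : R) : (0 < m)%R ->
  (forall x, 0 <= W x) -> measurable_fun setT W -> measurable_fun setT f ->
  (forall x, 0 <= f x)%R ->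
  \int[mu]_x (W x * (f x)%:E) <= A%:E ->
  \int[mu]_x (W x * ind (m < f x)%R) <= (A / m)%:E.
Proof.
move=> m0 W0 mW mf f0 WA.
rewrite mulrC EFinM; apply: (@le_trans _ _ (m^-1%:E * \int[mu]_x (W x * (f x)%:E))); last first.
  by rewrite lee_wpmul2l// lee_fin invr_ge0 ltW.
have mWf : measurable_fun setT (fun x => W x * (f x)%:E).
  by apply: emeasurable_funM => //; exact/measurable_EFinP.
rewrite -integralT_scale ?invr_ge0 ?(ltW m0)//; last by move=> x; rewrite mule_ge0// lee_fin.
have mi : measurable_fun setT (fun x => ind (m < f x)%R : \bar R).
  by apply: measurable_ind; exact: measurable_fun_ltr.
apply: le_integralT => [x|||x].
- by rewrite mule_ge0 ?ind_ge0.
- exact: emeasurable_funM.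
- exact: emeasurable_funM.
rewrite muleCA lee_wpmul2l// -EFinM /ind; case: ltP => fm /=; last first.
  by rewrite lee_fin mulr_ge0 ?invr_ge0 ?(ltW m0).
by rewrite lee_fin mulrC ler_pdivlMr// mul1r ltW.
Qed.

End limits.

Section selection.
Context d (T : measurableType d) (R : realType).
Variables (mu : {measure set T -> \bar R}) (W : T -> R).
Hypothesis mW : measurable_fun setT W.
Hypothesis W0 : forall x, (0 < W x)%R.
Hypothesis Woo : \int[mu]_x (W x)%:E < +oo.
Variable K : nat -> set (T -> R).
Hypothesis Kne : forall j, K j !=set0.
Hypothesis Knested : forall i j, (i <= j)%N -> K j `<=` K i.
Hypothesis Kmid : forall j g1 g2, K j g1 -> K j g2 ->
  K j (fun x => (g1 x + g2 x) / 2)%R.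
Hypothesis Kmeas : forall j g, K j g -> measurable_fun setT g.
Hypothesis Kge0 : forall j g x, K j g -> (0 <= g x)%R.

Local Notation J g := (\int[mu]_x (W x * expR (- g x))%:E).

Let J_ge0 (g : T -> R) : 0 <= J g.
Proof. by apply: integral_ge0 => x _; rewrite lee_fin mulr_ge0 ?expR_ge0// ltW. Qed.

Let measurable_WexpN (g : T -> R) : measurable_fun setT g ->
  measurable_fun setT (fun x => (W x * expR (- g x))%:E).
Proof.
move=> mg; apply/measurable_EFinP; apply: measurable_funM => //.
by apply: measurableT_comp => //; exact: measurable_funN.
Qed.

Let J_le j g : K j g -> J g <= \int[mu]_x (W x)%:E.
Proof.
move=> Kg; apply: le_integralT => [x|||x].
- by rewrite lee_fin mulr_ge0 ?expR_ge0// ltW.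
- exact/measurable_WexpN/(Kmeas Kg).
- exact/measurable_EFinP.
rewrite lee_fin ger_pMr// expRN invf_le1 ?expR_gt0//.
by rewrite -expR0 ler_expR (Kge0 _ Kg).
Qed.

(* Diagonal minimisation of [J], which is uniformly convex along midpoints by
   [expRN_midpoint]. *)
Lemma almost_minimizers : exists g : nat -> T -> R, (forall k, K k (g k)) /\
  forall k, J (g k) + J (g k.+1) <=
    2%:E * J (fun x => (g k x + g k.+1 x) / 2)%R + (4 * (1 / 4) ^+ k)%:E.
Proof.
pose c j := ereal_inf [set J g | g in K j].
have c_le i j : (i <= j)%N -> c i <= c j.
  by move=> ij; apply: ereal_inf_le_tmp => _ [g /(Knested ij) Kg <-]; exists g.
have c0 j : 0 <= c j by apply: le_ereal_inf_tmp => _ [g _ <-]; exact: J_ge0.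
have cI j : c j <= \int[mu]_x (W x)%:E.
  have [g Kg] := Kne j; apply: ge_ereal_inf.
  by exists (J g); [exists g|exact: J_le Kg].
pose C := ereal_sup (range c).
have cC j : c j <= C by apply: ereal_sup_ubound; exists j.
have Cfin : C \is a fin_num.
  rewrite ge0_fin_numE; last exact: le_trans (c0 0%N) (cC 0%N).
  by apply: le_lt_trans Woo; apply: ge_ereal_sup => _ [j _ <-].
pose e k : R := ((1 / 4) ^+ k)%R.
have e0 k : (0 < e k)%R by rewrite exprn_gt0.
have eS k : (e k.+1 <= e k)%R by rewrite /e exprS ler_piMl ?ltW//; lra.
(* The infima [c j] increase to [C]. Each pick has [J] at most [C + e k] and lies in a set [K i]
   whose infimum is at least [C - e k]. The midpoint of two consecutive picks lies in the larger of
   the two sets, so its value of [J] is also at least [C - e k]. *)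
have pick k : exists g, [/\ K k g, J g <= C + (e k)%:E &
    exists2 i, K i g & C - (e k)%:E <= c i].
  have [_ [i _ <-] Ci] := ub_ereal_sup_adherent (e0 k) Cfin.
  pose m := maxn i k.
  have cmfin : c m \is a fin_num.
    by rewrite ge0_fin_numE// (le_lt_trans (cI m)).
  have [_ [g Kg <-] gm] := lb_ereal_inf_adherent (e0 k) cmfin.
  exists g; split; first exact: Knested (leq_maxr _ _) _ Kg.
    by apply: (le_trans (ltW gm)); apply: leeD2r; exact: (cC m).
  exists m => //; apply: (le_trans (ltW Ci)); exact/c_le/leq_maxl.
have [g gP] := choice pick; exists g; split=> [k|k]; first by have [] := gP k.
have [_ J1 [i1 K1 C1]] := gP k; have [_ J2 [i2 K2 C2]] := gP k.+1.
have {}J2 : J (g k.+1) <= C + (e k)%:E.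
  by apply: (le_trans J2); rewrite leeD2l// lee_fin.
have {}C2 : C - (e k)%:E <= c i2.
  by apply: le_trans C2; rewrite leeB// lee_fin.
have Jm : C - (e k)%:E <= J (fun x => (g k x + g k.+1 x) / 2)%R.
  have [i12|i21] := leqP i1 i2.
    apply: (le_trans C1); apply: ereal_inf_lbound.
  exists (fun x => (g k x + g k.+1 x) / 2)%R => //.
    by apply: Kmid => //; exact: Knested i12 _ K2.
  apply: (le_trans C2); apply: ereal_inf_lbound.
  exists (fun x => (g k x + g k.+1 x) / 2)%R => //.
  by apply: Kmid => //; exact: Knested (ltnW i21) _ K1.
apply: (@le_trans _ _ (2%:E * (C - (e k)%:E) + (4 * e k)%:E)); last first.
  by rewrite leeD2r// lee_wpmul2l.
apply: (le_trans (leeD J1 J2)).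
have key (D : \bar R) (r : R) : D \is a fin_num ->
    D + r%:E + (D + r%:E) <= 2%:E * (D - r%:E) + (4 * r)%:E.
  by case: D => [D||]// _; rewrite -EFinB -EFinM -!EFinD lee_fin; lra.
exact: key.
Qed.

(** By [expRN_midpoint], near-minimality bounds the integral of [W] times the squared steps of
    [exp (- g k / 2)] by [4 (1 / 4) ^ k]. The steps are then summable in [L^1], hence almost
    everywhere. *)
Lemma convergent_selection : exists g : nat -> T -> R, (forall k, K k (g k)) /\
  \forall x \ae mu, cvgn (fun k => expR (- (g k x / 2))).
Proof.
have [g [Kg gJ]] := almost_minimizers.
exists g; split=> //.
have mg k : measurable_fun setT (g k) by exact: Kmeas (Kg k).
pose E k x := expR (- (g k x / 2)).
have mE k : measurable_fun setT (E k).
  by apply: measurableT_comp => //; apply: measurable_funN; exact: measurable_funM.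
pose D k x := `|E k.+1 x - E k x|%R.
have mD k : measurable_fun setT (D k).
  by apply: measurableT_comp => //; exact: measurable_funB.
have D0 k x : (0 <= D k x)%R by exact: normr_ge0.
have WD0 k x : 0 <= (W x * D k x)%:E by rewrite lee_fin mulr_ge0 ?D0// ltW.
have mWD k : measurable_fun setT (fun x => (W x * D k x)%:E).
  by apply/measurable_EFinP; exact: measurable_funM.
have WD2 k : \int[mu]_x (W x * D k x ^+ 2)%:E <= (4 * (1 / 4) ^+ k)%:E.
  pose m x := ((g k x + g k.+1 x) / 2)%R.
  have mm : measurable_fun setT m.
    by apply: measurable_funM => //; exact: measurable_funD.
  have Jfin (f : T -> R) : measurable_fun setT f -> (forall x, 0 <= f x)%R -> J f \is a fin_num.
    move=> mf f0; rewrite ge0_fin_numE//; apply: le_lt_trans Woo.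
    apply: le_integralT => [x|||x].
    - by rewrite lee_fin mulr_ge0 ?expR_ge0// ltW.
    - exact/measurable_WexpN.
    - exact/measurable_EFinP.
    by rewrite lee_fin ger_pMr// expRN invf_le1 ?expR_gt0// -expR0 ler_expR.
  have g0 j x : (0 <= g j x)%R by exact: Kge0 (Kg j).
  have Jmfin : J m \is a fin_num.
    by apply: Jfin => // x; rewrite divr_ge0// addr_ge0.
  have JS : \int[mu]_x (W x * D k x ^+ 2)%:E + 2%:E * J m = J (g k) + J (g k.+1).
    have mD2 : measurable_fun setT (fun x => (W x * D k x ^+ 2)%:E).
      by apply/measurable_EFinP; apply: measurable_funM => //; exact: measurable_funX.
    have D20 x : 0 <= (W x * D k x ^+ 2)%:E by rewrite lee_fin mulr_ge0 ?sqr_ge0// ltW.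
    have JF0 (f : T -> R) x : 0 <= (W x * expR (- f x))%:E.
      by rewrite lee_fin mulr_ge0 ?expR_ge0// ltW.
    have mJ (f : T -> R) := @measurable_WexpN f.
    have m2 : measurable_fun setT (fun x => 2%:E * (W x * expR (- m x))%:E).
      by apply: emeasurable_funM => //; exact: mJ.
    have m20 x : 0 <= 2%:E * (W x * expR (- m x))%:E by rewrite mule_ge0.
    rewrite -(integralT_scale _ _ (JF0 m) (mJ _ mm))// -(integralT_add _ D20 m20 mD2 m2).
    rewrite -(integralT_add _ (JF0 _) (JF0 _) (mJ _ (mg k)) (mJ _ (mg k.+1))).
    apply: eq_integral => x _; rewrite -EFinM -!EFinD; congr EFin.
    by rewrite /D real_normK ?num_real// -sqrrN opprB expRN_midpoint /m; ring.
  have := gJ k; rewrite -JS addeC.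
  by rewrite leeD2lE// fin_numM.
have D1 k : \int[mu]_x (W x * D k x)%:E <=
    ((1 / 2) ^+ k)%:E * (\int[mu]_x (W x)%:E + 4%:E).
  (* [D <= 2 ^ (- k) + 2 ^ k D ^ 2] passes from squares to first powers, since [W] has finite mass
     and [2 ^ k 4 ^ (- k) = 2 ^ (- k)]. *)
  apply: (@le_trans _ _ (\int[mu]_x (((1 / 2) ^+ k)%:E * (W x)%:E +
      (2 ^+ k)%:E * (W x * D k x ^+ 2)%:E))).
    apply: le_integralT => [x|||x] //.
    - apply: emeasurable_funD; apply: emeasurable_funM => //.
        exact/measurable_EFinP.
      by apply/measurable_EFinP; apply: measurable_funM => //; exact: measurable_funX.
    rewrite -!EFinM -EFinD lee_fin.
    have Wx := W0 x; have Dx := D0 k x.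
    have : (0 < (2 : R) ^+ k)%R by rewrite exprn_gt0.
    have -> : ((1 / 2) ^+ k = ((2 : R) ^+ k)^-1)%R by rewrite div1r exprVn.
    move: (W x) (D k x) ((2 : R) ^+ k)%R Wx Dx => w z t w0 z0 t0.
    rewrite (_ : (t^-1 * w + t * (w * z ^+ 2) = w * (t^-1 + t * z ^+ 2))%R); last by ring.
    rewrite ler_wpM2l ?(ltW w0)//.
    rewrite -(ler_pM2l t0) mulrDr mulfV ?gt_eqF//.
    have := sqr_ge0 (t * z - 1)%R; have : (0 <= t * z)%R by rewrite mulr_ge0 ?(ltW t0).
    rewrite (_ : (t * (t * z ^+ 2) = (t * z) ^+ 2)%R); last by ring.
    by move: (t * z)%R => v v0; nra.
  have mD2 : measurable_fun setT (fun x => (W x * D k x ^+ 2)%:E).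
    by apply/measurable_EFinP; apply: measurable_funM => //; exact: measurable_funX.
  have D20 x : 0 <= (W x * D k x ^+ 2)%:E by rewrite lee_fin mulr_ge0 ?sqr_ge0// ltW.
  have mWE : measurable_fun setT (fun x => (W x)%:E) by exact/measurable_EFinP.
  have WE0 x : 0 <= (W x)%:E by rewrite lee_fin ltW.
  have half0 : 0 <= ((1 / 2) ^+ k)%:E :> \bar R by rewrite lee_fin exprn_ge0.
  have two0 : 0 <= (2 ^+ k)%:E :> \bar R by rewrite lee_fin exprn_ge0.
  rewrite integralT_add//; [|by move=> x; rewrite mule_ge0|by move=> x; rewrite mule_ge0|
    by apply: emeasurable_funM|by apply: emeasurable_funM].
  rewrite !integralT_scale ?exprn_ge0//.
  have WI : 0 <= \int[mu]_x (W x)%:E.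
    by apply: integral_ge0 => x _; rewrite lee_fin ltW.
  have fE : 0 <= 4%:E :> \bar R by rewrite lee_fin.
  rewrite [leRHS](ge0_muleDr _ WI fE); apply: leeD2l.
  apply: (le_trans (lee_wpmul2l _ (WD2 k))); first by rewrite lee_fin exprn_ge0.
  rewrite -!EFinM lee_fin mulrCA -exprMn mulrC ler_pM2r//.
  by rewrite (_ : (2 * (1 / 4) = 1 / 2 :> R)%R)//; field.
have : \sum_(k <oo) \int[mu]_x (W x * D k x)%:E < +oo.
  have WIfin : \int[mu]_x (W x)%:E \is a fin_num.
    by rewrite ge0_fin_numE//; apply: integral_ge0 => x _; rewrite lee_fin ltW.
  have WI : 0 <= \int[mu]_x (W x)%:E.
    by apply: integral_ge0 => x _; rewrite lee_fin ltW.
  move: WIfin WI D1; case: (\int[mu]_x (W x)%:E) => [I||]// _; rewrite lee_fin => I0 D1.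
  apply: (@le_lt_trans _ _ (\sum_(k <oo) ((I + 4) * (1 / 2) ^+ k)%:E)).
    apply: lee_nneseries => [k _ _|k _]; first exact: integral_ge0.
    by apply: (le_trans (D1 k)); rewrite -EFinD -EFinM lee_fin mulrC.
  rewrite nneseries_geometric ?ltry//; first by rewrite addr_ge0.
  by apply/andP; split; lra.
move=> /(ae_cvg0_of_series WD0 mWD); apply: filterS => x.
under eq_eseriesr do rewrite EFinM.
rewrite nneseriesZl; last by move=> k _; rewrite lee_fin.
move=> Dx; apply: cvgn_of_summable_steps.
have [//|] := ltP (\sum_(k <oo) `|E k.+1 x - E k x|%:E) +oo.
rewrite leye_eq => /eqP Ey; move: Dx; rewrite /D Ey gt0_muley ?lte_fin//.
Qed.

Variables (V : T -> R) (M : R).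
Hypothesis mV : measurable_fun setT V.
Hypothesis V0 : forall x, (0 < V x)%R.
Hypothesis KV : forall j g, K j g -> \int[mu]_x ((V x)%:E * (g x)%:E) <= M%:E.

(** Convergence of [exp (- g k / 2)] gives that of [g k] wherever the limit is positive. Where it is
    zero, [V g k] tends to infinity, which Fatou's lemma and the bound [M] allow only on a null
    set. *)
Lemma komlos_selection : exists (g : nat -> T -> R) (h : T -> R),
  [/\ forall k, K k (g k), measurable_fun setT h, forall x, (0 <= h x)%R &
      \forall x \ae mu, g ^~ x @ \oo --> h x].
Proof.
have [g [Kg gE]] := convergent_selection.
have mg k : measurable_fun setT (g k) by exact: Kmeas (Kg k).
have g0 k x : (0 <= g k x)%R by exact: Kge0 (Kg k).
pose l x := limn_esup (fun k => (g k x)%:E).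
have gsup0 x n : 0 <= esups (fun k => (g k x)%:E) n.
  by apply: (@le_trans _ _ (g n x)%:E); rewrite ?lee_fin//; apply: ereal_sup_ubound; exists n => /=.
have l0 x : 0 <= l x.
  rewrite /l limn_esup_lim; apply: lime_ge; first exact: is_cvg_esups.
  exact: nearW.
have ml : measurable_fun setT l.
  by apply: measurable_fun_limn_esup => k; exact/measurable_EFinP.
exists g, (fun x => fine (l x)); split=> //.
- exact: measurableT_comp.
- by move=> x; exact: fine_ge0.
pose f k x := (V x)%:E * (g k x)%:E.
have f0 k x : 0 <= f k x by rewrite mule_ge0 ?lee_fin// ltW.
have mf k : measurable_fun setT (f k).
  by apply: emeasurable_funM; exact/measurable_EFinP.
have mlf : measurable_fun setT (fun x => limn_einf (f ^~ x)).
  exact: measurable_limn_einf.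
have lf0 x : 0 <= limn_einf (f ^~ x) by exact: limn_einf_ge0.
have : \int[mu]_x limn_einf (f ^~ x) < +oo.
  apply: le_lt_trans (ltry M).
  apply: le_trans (fatou mu measurableT _ _) _ => //.
  by apply: limn_einf_le_bound => k; exact: KV (Kg k).
move=> /(ae_fin_integral lf0 mlf) flae.
apply: filterS2 gE flae => x /cvg_ex[/= L EL] flx.
have L0 : (0 <= L)%R.
  by apply: (cvgr_to_ge EL); apply: nearW => k; exact: expR_ge0.
have gL k : (g k x = - 2 * ln (expR (- (g k x / 2))))%R.
  by rewrite expRK; field.
have Lpos : (0 < L)%R.
  rewrite lt0r L0 andbT; apply/eqP => L00; move: flx.
  suff -> : limn_einf (f ^~ x) = +oo by rewrite ltxx.
  apply: (cvg_limn_einf_sup _).1.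
  rewrite L00 in EL.
  apply/cvgeyPge => A; near=> k.
  have : (expR (- (g k x / 2)) < expR (- (A / V x / 2)))%R.
    by near: k; apply: cvgr_lt EL _ _; exact: expR_gt0.
  rewrite ltr_expR ltrN2 ltr_pM2r// => gA.
  by rewrite /f -EFinM lee_fin mulrC -ler_pdivrMr// ltW.
have gc : g ^~ x @ \oo --> (- 2 * ln L)%R.
  rewrite (_ : g ^~ x = fun k => (- 2 * ln (expR (- (g k x / 2))))%R); last exact/funext.
  apply: cvgMr; apply: cvg_comp EL _; exact: continuous_ln.
suff -> : fine (l x) = (- 2 * ln L)%R by [].
rewrite /l; have /cvg_limn_einf_sup[_ ->//] : (fun k => (g k x)%:E) @ \oo --> (- 2 * ln L)%:E.
by apply: cvg_EFin gc; exact: nearW.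
Unshelve. all: by end_near. Qed.

End selection.

(** * Lower semicontinuity of the energy *)

Lemma epow_antitone (R : realType) (a b : \bar R) (r : R) : (r < 0)%R ->
  0 <= a -> a <= b -> epow b r <= epow a r.
Proof.
move=> r0 a0 ab; have rn : (0 < - r)%R by rewrite oppr_gt0.
have e0 : epow 0 r = +oo :> \bar R.
  by rewrite /epow leNgt r0/= powR0 ?gt_eqF// inve0.
have ey : epow +oo r = 0 :> \bar R.
  by rewrite /epow leNgt r0/= gt_eqF// invey.
have b0 := le_trans a0 ab.
case: b b0 ab => [b|_ _|//]; last by rewrite ey epow_ge0.
rewrite lee_fin => b0; case: a a0 => [a|//|//]; rewrite !lee_fin => a0 ab.
have [a00|an0] := eqVneq a 0%R; first by rewrite a00 e0 leey.
have ap : (0 < a)%R by rewrite lt0r an0.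
have bp := lt_le_trans ap ab.
rewrite !epow_pos// lee_fin -(opprK r) !(powRN _ (- r)%R).
rewrite lef_pV2 ?posrE ?powR_gt0//.
by rewrite ge0_ler_powR ?nnegrE ?(ltW rn).
Qed.

Lemma cvg_powR (R : realType) (u : nat -> R) (l p : R) : (0 < l)%R ->
  u @ \oo --> l -> (fun k => u k `^ p)%R @ \oo --> (l `^ p)%R.
Proof.
move=> l0 ul.
have -> : (l `^ p = expR (p * ln l))%R by rewrite /powR gt_eqF.
have : (fun k => expR (p * ln (u k)))%R @ \oo --> expR (p * ln l).
  apply: continuous_cvg; first exact: continuous_expR.
  apply: cvgMl_tmp; apply: continuous_cvg => //; exact: continuous_ln.
apply: cvg_trans; apply: near_eq_cvg; near=> k.
have uk : (0 < u k)%R by near: k; apply: cvgr_gt ul _ _.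
by rewrite /powR gt_eqF.
Unshelve. all: by end_near. Qed.

Section closure.
Context d (T : measurableType d) (R : realType).
Variables (mu : {sigma_finite_measure set T -> \bar R}) (dist : T -> T -> R).
Variables (N cL cU : R).
Hypothesis reg : ahlfors_regular mu dist N cL cU.
Variables (o : T) (kap s q : R).
Hypothesis kapN : (0 < kap < N)%R.
Hypothesis s1 : (1 < s)%R.
Hypothesis qs : (1 <= q < s)%R.
Hypothesis crit : ((N - kap) * s < N)%R.

Local Notation om := (wt dist o).
Local Notation pot := (pot mu dist kap).
Local Notation vnorm := (vnorm mu dist o kap).
Local Notation ener := (ener mu dist kap s q).

Variables (g : nat -> T -> R) (h : T -> R) (M0 E0 : R).
Hypotheses (M00 : (0 < M0)%R) (E00 : (0 < E0)%R).
Hypothesis mg : forall k, measurable_fun setT (g k).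
Hypothesis mh : measurable_fun setT h.
Hypothesis g0 : forall k x, (0 <= g k x)%R.
Hypothesis h0 : forall x, (0 <= h x)%R.
Hypothesis vg : forall k, vnorm (fun x => (g k x)%:E) <= M0%:E.
Hypothesis eg : forall k, ener (fun x => (g k x)%:E) <= E0%:E.
Hypothesis gh : \forall x \ae mu, g ^~ x @ \oo --> h x.

Let EgE k : measurable_fun setT (fun x => (g k x)%:E).
Proof. exact/measurable_EFinP. Qed.

Let EhE : measurable_fun setT (fun x => (h x)%:E).
Proof. exact/measurable_EFinP. Qed.

Let om_ge0 b x : 0 <= (om b x)%:E. Proof. exact: (wt_EFin_ge0 reg). Qed.

Let mom b : measurable_fun setT (fun x => (om b x)%:E).
Proof. exact: (measurable_EFin_wt reg). Qed.

Lemma limit_bound (w : T -> \bar R) (B : \bar R) : (forall x, 0 <= w x) ->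
  measurable_fun setT w -> (forall x, w x \is a fin_num) ->
  (forall k, \int[mu]_x (w x * (g k x)%:E) <= B) ->
  \int[mu]_x (w x * (h x)%:E) <= B.
Proof.
move=> w0 mw wfin gB.
apply: (fatou_bound _ _ _ _ gB) => [k x|k|x||].
- by rewrite mule_ge0 ?lee_fin.
- exact: emeasurable_funM.
- by rewrite mule_ge0 ?lee_fin.
- exact: emeasurable_funM.
apply: filterS gh => x gx; apply: cvg_le_limn_einf (fun k => lexx _).
by apply: cvgeZl => //; apply: cvg_EFin gx; exact: nearW.
Qed.

Lemma vnorm_limit : vnorm (fun x => (h x)%:E) <= M0%:E.
Proof. exact: limit_bound. Qed.

(** Vitali's argument: the sets [b (g k)] and [b h] have mass at most [del] for [om cexp], so
    [vnorm_equi_integrable] makes the parts of [g k] and [h] on them small, and dominated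
    convergence handles their complement. *)
Lemma vnorm_diff_small (eps : R) : (0 < eps)%R -> exists k0, forall k, (k0 <= k)%N ->
  vnorm (fun x => `|g k x - h x|%:E) <= eps%:E.
Proof.
move=> eps0; have s1' := s1; have Nc : (N < cexp kap s)%R by exact: N_lt_cexp.
case/andP: (kapN) => kap0 kN; have N0 : (0 < N)%R by lra.
have e30 : (0 < eps / 3)%R by lra.
have [del del0 UI] := vnorm_equi_integrable reg o kapN s1 qs crit E00 M00 e30.
pose a := ((cexp kap s - N) / 2)%R; have a0 : (0 < a)%R by rewrite /a; lra.
have Nca : (N < cexp kap s - a)%R by rewrite /a; lra.
have [C1 C10 HC1] := wt_integral_fin reg o Nca.
(* [f x = (1 + dist o x) ^ a] grows, so the condition [m < f x] cuts off a neighbourhood of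
   infinity, while [a] is small enough that [f om cexp] remains integrable. *)
pose f x := (om (- a) x).
have f0 x : (0 < f x)%R by exact: (wt_gt0 reg).
have mf : measurable_fun setT f by exact: (measurable_wt reg).
pose m := ((C1 + M0) / del)%R; have m0 : (0 < m)%R by rewrite divr_gt0 ?addr_gt0.
pose b (u : T -> R) x := (m < f x)%R || (m < u x)%R.
have mb u : measurable_fun setT u -> measurable_fun setT (b u).
  by move=> mu'; apply: measurable_or; exact: measurable_fun_ltr.
have bad (u : T -> R) : measurable_fun setT u -> (forall x, 0 <= u x)%R ->
    vnorm (fun x => (u x)%:E) <= M0%:E ->
    \int[mu]_x ((om (cexp kap s) x)%:E * ind (b u x)) <= del%:E.
  move=> mu' u0 vu.
  have m1 : measurable_fun setT (fun x => (om (cexp kap s) x)%:E * ind (m < f x)%R).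
    by apply: emeasurable_funM => //; apply: measurable_ind; exact: measurable_fun_ltr.
  have m2 : measurable_fun setT (fun x => (om (cexp kap s) x)%:E * ind (m < u x)%R).
    by apply: emeasurable_funM => //; apply: measurable_ind; exact: measurable_fun_ltr.
  apply: (@le_trans _ _ (\int[mu]_x ((om (cexp kap s) x)%:E * ind (m < f x)%R +
      (om (cexp kap s) x)%:E * ind (m < u x)%R))).
    apply: le_integralT => [x|||x].
    - by rewrite mule_ge0 ?ind_ge0.
    - by apply: emeasurable_funM => //; apply: measurable_ind; exact: mb.
    - exact: emeasurable_funD.
    rewrite -ge0_muleDr ?ind_ge0// lee_wpmul2l// /b /ind -EFinD lee_fin.
    by case: (m < f x)%R; case: (m < u x)%R => /=; lra.
  rewrite integralT_add//; [|by move=> x; rewrite mule_ge0 ?ind_ge0|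
    by move=> x; rewrite mule_ge0 ?ind_ge0].
  have -> : (del = C1 / m + M0 / m)%R.
    by rewrite -mulrDl /m invf_div mulrCA mulfV ?mulr1// gt_eqF// addr_gt0.
  rewrite EFinD; apply: leeD.
    apply: (markov_ind m0 (om_ge0 (cexp kap s)) (mom _) mf (fun x => ltW (f0 x))).
    apply: le_trans HC1; rewrite le_eqVlt; apply/orP; left; apply/eqP.
    apply: eq_integral => x _; rewrite -EFinM /f /wt -powRD_pos ?(wt_base reg)//.
    by congr (_ `^ _)%:E; rewrite opprB addrC opprK.
  apply: (markov_ind m0 (om_ge0 (cexp kap s)) (mom _) mu' u0).
    apply: le_trans vu; apply: le_integralT => [x|||x].
    + by apply: mule_ge0 => //; rewrite lee_fin.
    + by apply: emeasurable_funM => //; exact/measurable_EFinP.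
    + by apply: emeasurable_funM => //; exact/measurable_EFinP.
    rewrite lee_wpmul2r ?lee_fin// /wt ler_powR ?lerDl ?(ar_ge0 reg)//.
    rewrite lerN2 /cexp ler_peMr ?(ltW kap0)// ler_pdivlMr; lra.
have badg k : vnorm (fun x => ind (b (g k) x) * (g k x)%:E) <= (eps / 3)%:E.
  apply: UI => //; first by move=> y; rewrite lee_fin.
    exact: mb.
  exact: bad.
(* The energy of [h] has no bound yet; instead the bound for each [g k] on the fixed set [b h]
   passes to the limit by Fatou's lemma. *)
have badh : vnorm (fun x => ind (b h x) * (h x)%:E) <= (eps / 3)%:E.
  rewrite (_ : vnorm _ = \int[mu]_x ((om kap x)%:E * ind (b h x) * (h x)%:E)); last first.
    by apply: eq_integral => x _; rewrite muleA.
  apply: limit_bound => [x||x|k].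
  - by rewrite mule_ge0 ?ind_ge0.
  - by apply: emeasurable_funM => //; apply: measurable_ind; exact: mb.
  - by rewrite -EFinM.
  under eq_integral do rewrite -muleA.
  apply: UI => //; first by move=> y; rewrite lee_fin.
    exact: mb.
  by apply: bad => //; exact: vnorm_limit.
pose good k x := ~~ b (g k) x && ~~ b h x.
pose D k x := (om kap x)%:E * (ind (good k x) * `|g k x - h x|%:E).
have mgood k : measurable_fun setT (good k).
  by apply: measurable_and; apply: measurable_neg; exact: mb.
have mdiff k : measurable_fun setT (fun x => `|g k x - h x|%:E).
  by apply/measurable_EFinP; apply: measurableT_comp => //; exact: measurable_funB.
have mD k : measurable_fun setT (D k).
  apply: emeasurable_funM => //; apply: emeasurable_funM => //.
  exact: measurable_ind.
have D0 k x : 0 <= D k x by rewrite !mule_ge0 ?ind_ge0// lee_fin.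
(* On the good set [f <= m], which means [c om cexp >= 1]; the constant bound [m] for the difference
   is therefore dominated by the integrable [G]. *)
pose c := (m `^ (cexp kap s / a))%R.
pose G x := (c * m * om (cexp kap s) x)%:E.
have mG : measurable_fun setT G.
  by apply/measurable_EFinP; apply: measurable_funM => //; exact: (measurable_wt reg).
have cm0 : (0 <= c * m)%R by apply: mulr_ge0; [exact: powR_ge0|exact: ltW].
have G0 x : 0 <= G x by rewrite lee_fin; apply: mulr_ge0 => //; exact: powR_ge0.
have DG k x : D k x <= G x.
  rewrite /D /ind; have [/andP[]|_] := boolP (good k x); last first.
    by rewrite mul0e mule0.
  rewrite !negb_or -!leNgt => /andP[fm gm] /andP[_ hm].
  rewrite mul1e -EFinM lee_fin mulrAC.
  have omle1 : (om kap x <= 1)%R by apply: (wt_le1 reg); exact: ltW.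
  have dm : (`|g k x - h x| <= m)%R.
    have := g0 k x; have := h0 x; rewrite ler_norml; lra.
  have co : (1 <= c * om (cexp kap s) x)%R.
    have -> : (om (cexp kap s) x = (f x `^ (cexp kap s / a))^-1)%R.
      rewrite /f /wt -powRrM -powRN; congr (_ `^ _)%R; field; lra.
    rewrite (ler_pdivlMr _ _ (powR_gt0 _ (f0 x))) mul1r ge0_ler_powR ?nnegrE ?(ltW m0)//.
      by rewrite divr_ge0 ?(ltW a0)//; lra.
    exact: ltW.
  apply: (@le_trans _ _ (1 * m)%R); last by rewrite ler_wpM2r// ltW.
  by apply: ler_pM => //; exact: ltW (wt_gt0 reg _ _ _).
have iG : mu.-integrable setT G.
  apply/integrableP; split => //.
  under eq_integral do rewrite gee0_abs//.
  under eq_integral do rewrite /G EFinM.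
  have [C2 C20 HC2] := wt_integral_fin reg o Nc.
  rewrite integralT_scale//.
  by apply: (le_lt_trans (lee_wpmul2l _ HC2)); rewrite ?lee_fin// ltry.
have Dcvg0 : {ae mu, forall x, setT x -> D ^~ x @ \oo --> 0}.
  apply: filterS gh => x gx _.
  apply: (@squeeze_cvge _ _ _ _ (cst 0) _ (fun k => `|g k x - h x|%:E)).
  - apply: nearW => k; rewrite D0 /= /D muleA.
    rewrite -[leRHS]mul1e lee_wpmul2r ?lee_fin//.
    apply: mulr_ile1; rewrite ?ler0n ?lern1 ?leq_b1// ?(ltW (wt_gt0 reg _ _ _))//.
    by apply: (wt_le1 reg); exact: ltW.
  - exact: cvg_cst.
  - apply: cvg_EFin; first exact: nearW.
    rewrite -(@normr0 _ R) -(subrr (h x)).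
    by apply: cvg_norm; apply: cvgB => //; exact: cvg_cst.
have DG' : {ae mu, forall x k, setT x -> `|D k x| <= G x}.
  by apply: filterS gh => x _ k _; rewrite gee0_abs.
have [_ _] := dominated_convergence measurableT mD (measurable_cst 0) Dcvg0 iG DG'.
rewrite integral0 => /= intD.
have : \forall k \near \oo, \int[mu]_x D k x < (eps / 3)%:E.
  have e3 : 0 < (eps / 3)%:E by rewrite lte_fin.
  exact: (intD _ (open_ereal_lt' e3)).
case=> k0 _ Dk0; exists k0 => k /Dk0 /= /ltW Dk.
have mbg k' : measurable_fun setT (fun x => ind (b (g k') x) * (g k' x)%:E).
  by apply: emeasurable_funM => //; apply: measurable_ind; exact: mb.
have mbh : measurable_fun setT (fun x => ind (b h x) * (h x)%:E).
  by apply: emeasurable_funM => //; apply: measurable_ind; exact: mb.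
have b0 (u : T -> R) x : (0 <= u x)%R -> 0 <= (om kap x)%:E * (ind (b u x) * (u x)%:E).
  by move=> u0; apply: mule_ge0 => //; apply: mule_ge0; rewrite ?ind_ge0 ?lee_fin.
have mob (F : T -> \bar R) : measurable_fun setT F ->
  measurable_fun setT (fun x => (om kap x)%:E * F x) by move=> mF; exact: emeasurable_funM.
apply: (@le_trans _ _ (\int[mu]_x (D k x +
    ((om kap x)%:E * (ind (b (g k) x) * (g k x)%:E) +
     (om kap x)%:E * (ind (b h x) * (h x)%:E))))).
  apply: le_integralT => [x|||x].
  - by apply: mule_ge0 => //; rewrite lee_fin.
  - exact: mob.
  - apply: emeasurable_funD => //; apply: emeasurable_funD; exact: mob.
  rewrite /D /ind /good -!EFinM -!EFinD lee_fin -!mulrDr.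
  rewrite ler_wpM2l ?(ltW (wt_gt0 reg _ _ _))//.
  have uv : (`|g k x - h x| <= g k x + h x)%R.
    by have := g0 k x; have := h0 x; rewrite ler_norml; lra.
  rewrite /b; case: (m < f x)%R => /=; first by rewrite mul0r !mul1r add0r.
  case: (ltP m (g k x)) => /= mu1; case: (ltP m (h x)) => /= mv1;
    rewrite ?mul0r ?mul1r ?add0r ?addr0//;
    by have := g0 k x; have := h0 x; rewrite ler_norml; lra.
rewrite integralT_add//; last 2 first.
- by move=> x; rewrite adde_ge0 ?b0.
- by apply: emeasurable_funD; exact: mob.
rewrite integralT_add//; [|by move=> x; exact: b0|by move=> x; exact: b0|exact: mob|exact: mob].
have -> : (eps = eps / 3 + (eps / 3 + eps / 3))%R by field.
rewrite !EFinD; apply: leeD; first exact: Dk.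
by apply: leeD; [exact: badg|exact: badh].
Qed.

(** As [q - s] is negative, a lower bound for the densities of [g k] requires an upper bound for
    their potentials: the potential of [h] plus that of [|g k - h|]. The latter tends to zero almost
    everywhere along a subsequence whose weighted [p]-th powers are summable. *)
Lemma ener_limit : ener (fun x => (h x)%:E) <= E0%:E.
Proof.
case/andP: (qs) => q1 q_s; have s1' := s1.
have s0 : (0 < s)%R by lra.
have r0 : (q - s < 0)%R by lra.
have H0 x : 0 <= (h x)%:E by rewrite lee_fin.
have G0 k x : 0 <= (g k x)%:E by rewrite lee_fin.
have [v0|vn0] := eqVneq (vnorm (fun x => (h x)%:E)) 0.
  rewrite (ener_eq0 reg)//; last exact: (ae_eq0_of_vnorm reg H0 EhE v0).
  by rewrite lee_fin ltW.
have vpos : 0 < vnorm (fun x => (h x)%:E) by rewrite lt0e vn0 (vnorm_ge0 reg).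
have voo : vnorm (fun x => (h x)%:E) < +oo by exact: (le_lt_trans vnorm_limit (ltry _)).
have [p [p1 kp]] := exists_pot_power kapN.
have p0 : (0 < p)%R by lra.
have Nc : (N < cexp kap s)%R by exact: N_lt_cexp.
have [C C0 HC] := wt_pot_power_le reg o kapN p1 kp Nc.
(* Chosen so that [C (de j) ^ p = 2 ^ (- j)], which makes the bound of [wt_pot_power_le]
   summable. *)
pose de j := (((1 / 2) ^+ j / C) `^ p^-1)%R.
have half0 j : (0 <= (1 / 2 : R) ^+ j / C)%R by rewrite divr_ge0 ?exprn_ge0 ?(ltW C0).
have de0 j : (0 < de j)%R by rewrite powR_gt0// divr_gt0 ?exprn_gt0.
have deE j : (C * de j `^ p = (1 / 2) ^+ j)%R.
  rewrite /de -powRrM mulVf ?gt_eqF// powRr1// mulrC divfK// gt_eqF//.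
have phi_ex j : exists k, (j <= k)%N /\ vnorm (fun x => `|g k x - h x|%:E) <= (de j)%:E.
  have [k0 Hk0] := vnorm_diff_small (de0 j).
  by exists (maxn k0 j); split; [exact: leq_maxr|apply: Hk0; exact: leq_maxl].
have [phi phiP] := choice phi_ex.
pose dif j x : \bar R := `|g (phi j) x - h x|%:E.
have dif0 j x : 0 <= dif j x by rewrite lee_fin.
have mdif j : measurable_fun setT (dif j).
  by apply/measurable_EFinP; apply: measurableT_comp => //; exact: measurable_funB.
pose tail j x := (om (cexp kap s) x)%:E * pot 0 (dif j) x `^ p.
have tail0 j x : 0 <= tail j x by rewrite mule_ge0 ?poweR_ge0.
have mtail j : measurable_fun setT (tail j).
  apply: emeasurable_funM => //; apply: measurable_poweRe.
  exact: (measurable_pot reg).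
have tail_sum : \sum_(j <oo) \int[mu]_x tail j x < +oo.
  apply: (@le_lt_trans _ _ (\sum_(j <oo) (1 * (1 / 2) ^+ j)%:E)).
    apply: lee_nneseries => [j _ _|j _]; first exact: integral_ge0.
    apply: (le_trans (HC _ (dif0 j) (mdif j))).
    rewrite mul1r -deE EFinM lee_wpmul2l ?lee_fin ?(ltW C0)//.
    rewrite -poweR_EFin; apply: le_poweR; [exact: ltW|exact: (vnorm_ge0 reg)|].
    exact: (phiP j).2.
  rewrite nneseries_geometric ?ltry//.
  by apply/andP; split; lra.
have tail_ae := ae_cvg0_of_series tail0 mtail tail_sum.
have pH_ae := pot_ae_fin reg kapN s1 crit H0 EhE voo.
apply: (fatou_bound (fun j => ener_density_ge0 mu dist kap s q (fun x => (g (phi j) x)%:E)) _ _ _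
  (fun j => eg (phi j))).
- by move=> j; exact: (measurable_ener_density reg).
- by move=> x; exact: ener_density_ge0.
- exact: (measurable_ener_density reg).
apply: filterS2 (filterI tail_ae pH_ae) gh => x [tx px] gx.
have pxpos := pot_gt0 reg kapN x H0 EhE vpos.
have tcvg := nneseries_term_cvg0 (tail0^~ x) tx.
have [hx0|hxn0] := eqVneq (h x) 0%R.
  rewrite /ener_density hx0 eqxx; apply: limn_einf_ge0 => j.
  exact: ener_density_ge0.
have hxpos : (0 < h x)%R by rewrite lt0r hxn0 h0.
have potle j : pot 0 (fun y => (g (phi j) y)%:E) x <=
    pot 0 (fun y => (h y)%:E) x + pot 0 (dif j) x.
  rewrite -(potD reg)//; apply: (le_pot reg) => //.
    by apply: emeasurable_funD.
  move=> y; rewrite -EFinD lee_fin -lerBlDl; exact: ler_norm.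
have pfin j : pot 0 (dif j) x < +oo.
  rewrite ltNge leye_eq; apply/negP => /eqP pe; move: tx.
  rewrite ltNge leye_eq => /negP; apply; rewrite -leye_eq.
  apply: le_trans (nneseries_ge_term j (tail0^~ x)).
  by rewrite /tail pe poweRyr ?gt_eqF// gt0_muley// lte_fin (wt_gt0 reg).
pose P := fine (pot 0 (fun y => (h y)%:E) x).
have PE : pot 0 (fun y => (h y)%:E) x = P%:E by rewrite fineK// ge0_fin_numE// ltW.
have P0 : (0 < P)%R by rewrite -lte_fin -PE.
pose e j := fine (pot 0 (dif j) x).
have dp0 i : 0 <= pot 0 (dif i) x by apply: pot_ge0; exact: dif0.
have eE i : pot 0 (dif i) x = (e i)%:E.
  by apply/esym/fineK; rewrite ge0_fin_numE ?dp0 ?pfin.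
have e0 j : (0 <= e j)%R by rewrite -lee_fin -eE pot_ge0.
have ecvg : e @ \oo --> 0%R.
  apply/cvgrPdist_lt => eps eps0.
  have lim0 : 0 < (om (cexp kap s) x * eps `^ p)%:E.
    by rewrite lte_fin mulr_gt0 ?(wt_gt0 reg) ?powR_gt0.
  have tn : \forall j \near \oo, tail j x < (om (cexp kap s) x * eps `^ p)%:E.
    exact: (tcvg _ (open_ereal_lt' lim0)).
  apply: filterS tn => j /=.
  rewrite sub0r normrN ger0_norm// /tail eE poweR_EFin -EFinM lte_fin.
  rewrite ltr_pM2l ?(wt_gt0 reg)// => ej; rewrite ltNge; apply/negP => epse.
  move: ej; rewrite ltNge => /negP; apply.
  by rewrite ge0_ler_powR ?nnegrE ?(ltW p0) ?(ltW eps0).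
rewrite /ener_density PE eqe (negbTE hxn0) epow_pos// poweR_EFin -EFinM.
apply: (@cvg_le_limn_einf _ (fun j => (g (phi j) x `^ s * (P + e j) `^ (q - s))%:E)).
  apply: cvg_EFin; first exact: nearW.
  apply: cvgM; apply: cvg_powR => //.
    apply: (cvg_comp phi (g ^~ x)); last exact: gx.
    move=> A [k _ kA]; exists k => // j /= kj; apply: kA => /=.
    exact: leq_trans kj (phiP j).1.
  rewrite -[X in _ --> X]addr0; apply: cvgD => //; exact: cvg_cst.
move=> j; case: ifPn => [|_].
  by rewrite eqe => /eqP ->; rewrite powR0 ?gt_eqF// mul0r.
rewrite EFinM poweR_EFin lee_wpmul2l ?lee_fin ?powR_ge0//.
rewrite -epow_pos ?ltr_wpDr//; apply: epow_antitone => //; first exact: pot_ge0.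
by rewrite EFinD -PE -eE.
Qed.

End closure.

(** * Euclidean space is Ahlfors regular *)

Section sum_of_squares.
Context {R : rcfType} {n : nat}.
Implicit Types a b : 'I_n -> R.

(* Each term is split by [2ab <= t a^2 + b^2/t], with [t = |b|/|a|]. *)
Lemma sqrt_sum_sqrD a b : (Num.sqrt (\sum_i (a i + b i) ^+ 2) <=
  Num.sqrt (\sum_i a i ^+ 2) + Num.sqrt (\sum_i b i ^+ 2))%R.
Proof.
pose nrm (c : 'I_n -> R) := Num.sqrt (\sum_(i < n) c i ^+ 2)%R.
have sum0 (c : 'I_n -> R) : (0 <= \sum_(i < n) c i ^+ 2)%R by apply: sumr_ge0 => i _; exact: sqr_ge0.
have nrmE c : (nrm c ^+ 2 = \sum_(i < n) c i ^+ 2)%R by rewrite sqr_sqrtr.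
have nrm_ge0 c : (0 <= nrm c)%R by exact: sqrtr_ge0.
have nrm_eq0 c i : nrm c = 0%R -> c i = 0%R.
  move=> c0; have := nrmE c; rewrite c0 expr0n/= => /esym/eqP.
  rewrite psumr_eq0; last by move=> j _; exact: sqr_ge0.
  by move=> /allP/(_ i); rewrite mem_index_enum sqrf_eq0 => /(_ isT)/eqP.
have [a0|an0] := eqVneq (nrm a) 0%R.
  rewrite -/(nrm a) a0 add0r; apply/ler_wsqrtr/ler_sum => i _.
  by rewrite nrm_eq0// add0r.
have [b0|bn0] := eqVneq (nrm b) 0%R.
  rewrite -/(nrm b) b0 addr0; apply/ler_wsqrtr/ler_sum => i _.
  by rewrite (nrm_eq0 b)// addr0.
have ap : (0 < nrm a)%R by rewrite lt0r an0 nrm_ge0.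
have bp : (0 < nrm b)%R by rewrite lt0r bn0 nrm_ge0.
rewrite -/(nrm a) -/(nrm b) -[leRHS]ger0_norm ?addr_ge0// -sqrtr_sqr.
apply: ler_wsqrtr; pose t := (nrm b / nrm a)%R.
have t0 : (0 < t)%R by rewrite divr_gt0.
apply: (@le_trans _ _ (\sum_i ((1 + t) * a i ^+ 2 + (1 + t^-1) * b i ^+ 2)))%R.
  apply: ler_sum => i _; rewrite -subr_ge0.
  have -> : ((1 + t) * a i ^+ 2 + (1 + t^-1) * b i ^+ 2 - (a i + b i) ^+ 2 =
    t^-1 * (t * a i - b i) ^+ 2)%R by field; rewrite gt_eqF.
  by rewrite mulr_ge0 ?sqr_ge0// invr_ge0 ltW.
rewrite big_split/= -!mulr_sumr -!nrmE le_eqVlt; apply/orP; left; apply/eqP.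
by rewrite /t; field; rewrite an0 bn0.
Qed.

Lemma norm_le_sqrt_sum_sqr a i : (`|a i| <= Num.sqrt (\sum_j a j ^+ 2))%R.
Proof.
rewrite -sqrtr_sqr; apply: ler_wsqrtr; rewrite (bigD1 i)//= lerDl.
by apply: sumr_ge0 => j _; exact: sqr_ge0.
Qed.

Lemma sqrt_sum_sqr_le a (r : R) : (0 <= r)%R -> (forall i, `|a i| <= r)%R ->
  (Num.sqrt (\sum_j a j ^+ 2) <= n%:R * r)%R.
Proof.
move=> r0 ar; rewrite -[leRHS]ger0_norm ?mulr_ge0// -sqrtr_sqr; apply: ler_wsqrtr.
apply: (@le_trans _ _ (\sum_(j < n) r ^+ 2)%R).
  by apply: ler_sum => j _; rewrite -[leLHS]real_normK ?num_real// lerXn2r ?nnegrE.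
rewrite sumr_const card_ord -[leLHS]mulr_natl exprMn ler_wpM2r ?sqr_ge0//.
by case: (n) => [|k]; rewrite ?expr0n// -[leLHS]mulr1 expr2 ler_wpM2l// ler1n.
Qed.

End sum_of_squares.

Section euclid_regular.
Context {R : realType}.
Local Notation T := (measurableTypeR R).

Definition cube n (x : n.-tuple T) (r : R) : set (n.-tuple T) :=
  [set y | forall i, (`|(tnth x i : R) - (tnth y i : R)| < r)%R].

Lemma cubeS n (x : n.+1.-tuple T) r : cube x r =
  @tuncons R n @^-1` ([set` `](tnth x ord0 - r)%R, (tnth x ord0 + r)%R[] `*`
    cube [tuple of behead x] r).
Proof.
apply/seteqP; split=> y /=.
- move=> xy; split=> [|i] /=.
    have := xy ord0; rewrite in_itv/= ltr_norml; lra.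
  have := xy (lift ord0 i); rewrite !tnth_behead.
  by rewrite (_ : lift ord0 i = inord i.+1)//; apply/val_inj; rewrite /= inordK// ltnS.
- move=> [/=]; rewrite in_itv/= => xy0 xy i.
  have [->|[j ->]] : i = ord0 \/ exists j, i = lift ord0 j.
    by case: (unliftP ord0 i) => [j|] ->; [right; exists j|left].
  + rewrite ltr_norml; lra.
  + have := xy j; rewrite !tnth_behead.
    by rewrite (_ : inord j.+1 = lift ord0 j)//; apply/val_inj; rewrite /= inordK// ltnS.
Qed.

Lemma measurable_cube n (x : n.-tuple T) r : measurable (cube x r).
Proof.
elim: n x => [x|n IH x].
  rewrite (_ : cube x r = setT)//; apply/seteqP; split => // y _ i.
  by case: i.
rewrite cubeS -[X in measurable X]setTI; apply: measurable_tuncons => //.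
by apply: measurableX; [exact: measurable_itv|exact: IH].
Qed.

Lemma lebesgue_tuple_cube n (x : n.-tuple T) (r : R) : (0 < r)%R ->
  lebesgue_tuple n (cube x r) = ((2 * r) ^+ n)%:E.
Proof.
move=> r0; elim: n x => [x|n IH x].
  rewrite (_ : cube x r = setT) ?expr0; last first.
    by apply/seteqP; split => // y _ [].
  by rewrite /= diracT.
rewrite cubeS /= /lebesgue_cons /pushforward -comp_preimage.
rewrite (_ : _ \o _ = id) ?preimage_id; last exact/funext/tconsK.
rewrite product_measure1E//=; last exact: measurable_cube.
rewrite IH lebesgue_measure_itv/= lte_fin ifT; last by lra.
by rewrite -EFinD -EFinM exprS; congr (_ * _)%:E; lra.
Qed.

Lemma measurable_leb n (A : set (n.-tuple T)) : measurable A ->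
  measurable (A : set (euclid R n)).
Proof. by move=> mA; apply: sub_caratheodory; exact: sub_sigma_algebra. Qed.

Lemma leb_tupleE n (A : set (n.-tuple T)) : measurable A ->
  leb R n A = lebesgue_tuple n A.
Proof. by move=> mA; exact: measurable_mu_extE. Qed.

Lemma leb_sigma_finite n : sigma_finite setT (leb R n).
Proof. exact/completed_measure_extension_sigma_finite/sigma_finiteT. Qed.

Lemma measurable_coord n (i : 'I_n) :
  measurable_fun [set: euclid R n] (fun x => tnth x i : R).
Proof.
move=> _ Y mY; rewrite setTI; apply: measurable_leb.
by rewrite -[X in measurable X]setTI; exact: measurable_tnth.
Qed.

(** A ball of radius [r] contains the cube of half-side [r / (2 n)] and lies in the one of half-side
    [r]; their volumes are [(r / n) ^ n] and [(2 r) ^ n]. *)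
Lemma edist_regular n : (0 < n)%N ->
  ahlfors_regular (leb R n) (@Defs.edist R n) n%:R (n%:R^-1 ^+ n) (2 ^+ n).
Proof.
move=> n0; have nr0 : (0 < n%:R :> R)%R by rewrite ltr0n.
have med : measurable_fun [set: euclid R n * euclid R n] (fun p => Defs.edist p.1 p.2).
  have msq : measurable_fun setT (Num.sqrt : R -> R).
    by apply: continuous_measurable_fun; exact: sqrt_continuous.
  apply: (measurableT_comp msq).
  apply: measurable_sum => i; apply: measurable_funX; apply: measurable_funB.
    exact: (measurableT_comp (measurable_coord i) measurable_fst).
  exact: (measurableT_comp (measurable_coord i) measurable_snd).
have medx x : measurable_fun setT (Defs.edist x : euclid R n -> R).
  exact: (measurableT_comp med (pair1_measurable x)).
have mball x r : measurable [set y : euclid R n | (Defs.edist x y < r)%R].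
  rewrite -[X in measurable X]setTI.
  have := medx x measurableT [set` `]-oo, r[] (measurable_itv _).
  by congr measurable; apply/seteqP; split => y /=; rewrite in_itv.
have mcube (x : euclid R n) r : measurable (cube x r : set (euclid R n)).
  by apply: (@measurable_leb n (cube x r)); exact: measurable_cube.
split.
- by [].
- by rewrite exprn_gt0// invr_gt0.
- by rewrite exprn_gt0.
- by move=> x y; exact: sqrtr_ge0.
- move=> x y; congr Num.sqrt; apply: eq_bigr => i _.
  by rewrite -sqrrN opprB.
- move=> x y z; apply: le_trans (sqrt_sum_sqrD _ _).
  rewrite le_eqVlt; apply/orP; left; apply/eqP.
  congr Num.sqrt; apply: eq_bigr => i _; congr (_ ^+ 2)%R.
  by rewrite addrA subrK.
- exact: med.
- move=> x r r0; rewrite powR_mulrn ?(ltW r0)//.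
  have rn0 : (0 < r / (2 * n%:R))%R by rewrite divr_gt0// mulr_gt0.
  have -> : (n%:R^-1 ^+ n * r ^+ n = (2 * (r / (2 * n%:R))) ^+ n)%R.
    by rewrite -exprMn; congr (_ ^+ n)%R; field; rewrite gt_eqF.
  rewrite -(lebesgue_tuple_cube x rn0) -leb_tupleE; last exact: measurable_cube.
  apply: le_measure; [apply: mem_set; exact: mcube|exact/mem_set/mball|].
  move=> y xy /=; apply: (@le_lt_trans _ _ (n%:R * (r / (2 * n%:R)))%R).
    apply: sqrt_sum_sqr_le => [|i]; [exact: ltW|exact: ltW (xy i)].
  rewrite (_ : (n%:R * (r / (2 * n%:R)) = r / 2)%R); last by field; rewrite gt_eqF.
  lra.
- move=> x r r0; rewrite powR_mulrn ?(ltW r0)// -exprMn.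
  rewrite -(lebesgue_tuple_cube x r0) -leb_tupleE; last exact: measurable_cube.
  apply: le_measure; [exact/mem_set/mball|apply: mem_set; exact: mcube|].
  by move=> y /= xy i; apply: le_lt_trans xy; exact: (norm_le_sqrt_sum_sqr (fun i => _)).
Qed.

End euclid_regular.

(** * Positivity of the Riesz constant *)

Section gamma.
Context {R : realType}.
Local Notation leb1 := (@lebesgue_measure R).
Local Notation line := (measurableTypeR R).

Definition dist1 (x y : line) : R := `|(x : R) - y|%R.

Lemma dist1_regular : ahlfors_regular leb1 dist1 1 2 2.
Proof.
have ballE (x : line) r : [set y | (dist1 x y < r)%R] = [set` `](x - r)%R, (x + r)%R[].
  by apply/seteqP; split => y /=; rewrite /dist1 in_itv/= ltr_norml; lra.
have mball (x : line) r : (0 < r)%R -> leb1 [set y | (dist1 x y < r)%R] = (2 * r `^ 1)%:E.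
  move=> r0; rewrite ballE lebesgue_measure_itv/= lte_fin ifT; last by lra.
  by rewrite -EFinD powRr1 ?(ltW r0)//; congr EFin; lra.
split => //.
- by move=> x y; exact: normr_ge0.
- by move=> x y; rewrite /dist1 distrC.
- by move=> x y z; rewrite /dist1 (ler_distD y).
- apply: measurableT_comp => //; apply: measurable_funB.
    exact: measurable_fst.
  exact: measurable_snd.
- by move=> x r r0; rewrite mball.
- by move=> x r r0; rewrite mball.
Qed.

(** This is [exp y >= y] at [y = (1 + t) / b], raised to the power [b]. *)
Lemma expRN_le_powR (b t : R) : (0 < b)%R -> (0 <= t)%R ->
  (expR (- t) <= (b `^ b * expR 1) * (1 + t) `^ (- b))%R.
Proof.
move=> b0 t0; have t1 : (0 < 1 + t)%R by lra.
rewrite powRN ler_pdivlMr ?powR_gt0// expRN mulrC ler_pdivrMr ?expR_gt0//.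
rewrite -mulrA -expRD.
have -> : (1 + t = b * ((1 + t) / b))%R by rewrite mulrCA mulfV ?mulr1// gt_eqF.
rewrite powRM ?(ltW b0) ?divr_ge0 ?(ltW t1) ?(ltW b0)// ler_wpM2l ?powR_ge0//.
have -> : (expR (b * ((1 + t) / b)) = expR ((1 + t) / b) `^ b)%R.
  by rewrite mulrC -expRM.
rewrite ge0_ler_powR ?nnegrE ?(ltW b0) ?expR_ge0// ?divr_ge0 ?(ltW t1) ?(ltW b0)//.
by apply: le_trans (expR_ge1Dx _); lra.
Qed.

Definition gamma_density (z : R) (t : line) : \bar R :=
  ind (0 < (t : R))%R * ((t : R) `^ (z - 1) * expR (- (t : R)))%:E.

Lemma gamma_density_ge0 z t : 0 <= gamma_density z t.
Proof. by rewrite mule_ge0 ?ind_ge0// lee_fin mulr_ge0 ?powR_ge0 ?expR_ge0. Qed.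

Lemma measurable_gamma_density z : measurable_fun setT (gamma_density z).
Proof.
apply: emeasurable_funM.
  by apply: measurable_ind; exact: measurable_fun_ltr.
apply/measurable_EFinP; apply: measurable_funM; first exact: measurable_powR.
by apply: measurableT_comp => //; exact: measurable_funN.
Qed.

(** For [z < 1] the density is at most a multiple of [(1 + t) ^ (- 2)] times the kernel
    [t ^ (z - 1)], to which the weighted kernel estimate on the line applies. For [z >= 1] the power
    is also absorbed by the exponential. *)
Lemma Gamma_integral_lty (z : R) : (0 < z)%R ->
  \int[leb1]_t gamma_density z t < +oo.
Proof.
move=> z0; have reg := dist1_regular.
have mf := measurable_gamma_density z.
have f0 := gamma_density_ge0 z.
have dist1E (t : line) : (0 < t)%R -> dist1 t 0%R = t /\ dist1 0%R t = t.
  by move=> t0; rewrite /dist1 subr0 sub0r normrN gtr0_norm.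
have [z1|z1] := ltP z 1%R.
- have a01 : (0 < 1 - z < 1)%R by lra.
  have lt12 : (1 < 2 :> R)%R by lra.
  have [C C0 HC] := wt_pker_integral reg (0%R : line) a01 lt12.
  pose K := ((2 : R) `^ 2 * expR 1)%R.
  have K0 : (0 < K)%R by rewrite mulr_gt0 ?powR_gt0 ?expR_gt0.
  apply: (@le_lt_trans _ _ (K%:E * (C * wt dist1 (0%R : line) (1 - z) (0%R : line))%:E)); last first.
    by rewrite -EFinM ltry.
  apply: (@le_trans _ _ (\int[leb1]_t
      (K%:E * ((wt dist1 (0%R : line) 2 t)%:E * pker (1 - z) (dist1 t 0%R))))).
    apply: le_integralT => // [|t].
      apply: emeasurable_funM => //; apply: emeasurable_funM.
        exact: (measurable_EFin_wt reg).
      apply: measurable_pker; exact: (measurableT_comp (ar_meas reg) (pair2_measurable _)).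
    rewrite /gamma_density /ind; case: (ltP 0%R (t : R)) => t0 /=; last first.
      rewrite mul0e mule_ge0 ?lee_fin ?(ltW K0)// mule_ge0 ?pker_ge0//.
      by rewrite lee_fin ltW// (wt_gt0 reg).
    have [d1 d2] := dist1E t t0.
    rewrite mul1e d1 pker_gt0E// /wt d2 opprB -!EFinM lee_fin mulrC mulrA.
    by rewrite ler_wpM2r ?powR_ge0// expRN_le_powR// ltW.
  rewrite integralT_scale ?(ltW K0)//.
  - by rewrite lee_wpmul2l ?lee_fin ?(ltW K0).
  - by move=> t; rewrite mule_ge0 ?pker_ge0// lee_fin ltW// (wt_gt0 reg).
  - apply: emeasurable_funM; first exact: (measurable_EFin_wt reg).
    apply: measurable_pker; exact: (measurableT_comp (ar_meas reg) (pair2_measurable _)).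
- have lt12 : (1 < 2 :> R)%R by lra.
  have [C C0 HC] := wt_integral_fin reg (0%R : line) lt12.
  pose b := (z + 1)%R; have b0 : (0 < b)%R by rewrite /b; lra.
  pose K := (b `^ b * expR 1)%R.
  have K0 : (0 < K)%R by rewrite mulr_gt0 ?powR_gt0 ?expR_gt0.
  apply: (@le_lt_trans _ _ (K%:E * C%:E)); last by rewrite -EFinM ltry.
  apply: (@le_trans _ _ (\int[leb1]_t (K%:E * (wt dist1 (0%R : line) 2 t)%:E))).
    apply: le_integralT => // [|t].
      by apply: emeasurable_funM => //; exact: (measurable_EFin_wt reg).
    rewrite /gamma_density /ind; case: (ltP 0%R (t : R)) => t0 /=; last first.
      by rewrite mul0e mule_ge0 ?lee_fin ?(ltW K0)// ltW// (wt_gt0 reg).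
    have [d1 d2] := dist1E t t0.
    rewrite mul1e /wt d2 -!EFinM lee_fin.
    have t1 : (0 < 1 + t)%R by rewrite addr_gt0.
    have -> : ((1 + t) `^ (- 2) = (1 + t) `^ (z - 1) * (1 + t) `^ (- b))%R.
      by rewrite -powRD_pos//; congr (_ `^ _)%R; rewrite /b; lra.
    rewrite mulrCA; apply: ler_pM; rewrite ?powR_ge0 ?expR_ge0//.
      by rewrite ge0_ler_powR ?nnegrE ?(ltW t0) ?(ltW t1) ?subr_ge0//; rewrite lerDr.
    by apply: expRN_le_powR => //; exact: ltW.
  rewrite integralT_scale ?(ltW K0)//.
  - by rewrite lee_wpmul2l ?lee_fin ?(ltW K0).
  - by move=> t; rewrite lee_fin ltW// (wt_gt0 reg).
  - exact: (measurable_EFin_wt reg).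
Qed.

(** [Gamma] is defined through [fine], which sends [+oo] to zero, so positivity depends on
    [Gamma_integral_lty]. A zero integral would make the density vanish almost everywhere on the
    unit interval. *)
Lemma Gamma_gt0 (z : R) : (0 < z)%R -> (0 < Gamma z)%R.
Proof.
move=> z0; pose f := gamma_density z.
have GE : Gamma z = fine (\int[leb1]_t f t).
  rewrite /Gamma /Rintegral; congr fine.
  rewrite integral_mkcond; apply: eq_integral => t _.
  rewrite /patch mem_setE in_itv/= andbT /f /gamma_density /ind.
  by case: ifPn => _; rewrite ?mul1e ?mul0e.
have mf : measurable_fun setT f by exact: measurable_gamma_density.
have f0 t : 0 <= f t by exact: gamma_density_ge0.
rewrite GE; apply: fine_gt0; rewrite Gamma_integral_lty// andbT lt0e.
rewrite integral_ge0// andbT; apply/eqP => If0.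
have [A [mA A0 fA]] := ae_eq0_integral f0 mf If0.
have : leb1 [set` `]0%R, 1%R[] <= leb1 A.
  apply: le_measure; rewrite ?inE//.
  move=> t /=; rewrite in_itv/= => /andP[t0 _]; apply: fA => /= /eqP.
  rewrite /f /gamma_density /ind t0 mul1e eqe gt_eqF//.
  by rewrite mulr_gt0 ?powR_gt0 ?expR_gt0.
by rewrite A0 lebesgue_measure_itv/= lte_fin ltr01 oppr0 adde0 lee_fin ler10.
Qed.

Lemma riesz_const_gt0 n (alpha : R) : (0 < alpha < n%:R)%R ->
  (0 < @riesz_const R n alpha)%R.
Proof.
case/andP => a0 an; rewrite /riesz_const divr_gt0 ?Gamma_gt0//; first lra.
by rewrite !mulr_gt0 ?powR_gt0 ?pi_gt0// Gamma_gt0// divr_gt0.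
Qed.

End gamma.

(** * The energy gauge *)

Section energy_gauge.
Context d (T : measurableType d) (R : realType).
Variables (mu : {sigma_finite_measure set T -> \bar R}) (dist : T -> T -> R).
Variables (N cL cU : R).
Hypothesis reg : ahlfors_regular mu dist N cL cU.
Variables (o : T) (kap s q g : R).
Hypothesis kapN : (0 < kap < N)%R.
Hypothesis s1 : (1 < s)%R.
Hypothesis qs : (1 <= q < s)%R.
Hypothesis crit : ((N - kap) * s < N)%R.
Hypothesis g0 : (0 < g)%R.

Local Notation om := (wt dist o).
Local Notation pot := (pot mu dist kap).
Local Notation vnorm := (vnorm mu dist o kap).
Local Notation ener := (ener mu dist kap s q).
Implicit Types f h : T -> \bar R.

Definition majorant f h := [/\ forall x, 0 <= h x, measurable_fun setT h,
  vnorm h < +oo & \forall x \ae mu, `|f x| <= h x].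

(** [KV_norm] in the abstract setting, by [KV_norm_gauge]; [g] is any positive factor here and
    becomes the power [gq] of the Riesz constant there. *)
Definition gauge f : \bar R :=
  ereal_inf [set g%:E * ener h `^ q^-1 | h in majorant f].

Let q0 : (0 < q)%R. Proof. by case/andP: qs => q1 _; lra. Qed.
Let gE0 : 0 <= g%:E. Proof. by rewrite lee_fin ltW. Qed.

Lemma gauge_ge0 f : 0 <= gauge f.
Proof. by apply: le_ereal_inf_tmp => _ [h _ <-]; rewrite mule_ge0 ?poweR_ge0. Qed.

Lemma gauge_le_majorant f h : majorant f h -> gauge f <= g%:E * ener h `^ q^-1.
Proof. by move=> fh; apply: ereal_inf_lbound; exists h. Qed.

Lemma gauge_lt f (x : R) : gauge f < (g * x)%:E -> exists h,
  [/\ majorant f h, (0 < x)%R & ener h <= (x `^ q)%:E].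
Proof.
rewrite /gauge => /ereal_inf_lt[_ [h fh <-] hx]; have e0 := ener_ge0 mu dist kap s q h.
exists h; case E : (ener h) e0 hx => [e| |]//; last first.
  by move=> _; rewrite poweRyr ?invr_neq0 ?gt_eqF// gt0_muley ?lte_fin// ltye.
rewrite lee_fin poweR_EFin -EFinM lte_fin ltr_pM2l// => e0 ex.
have x0 : (0 < x)%R by exact: le_lt_trans (powR_ge0 _ _) ex.
split => //; rewrite lee_fin.
have -> : e = ((e `^ q^-1) `^ q)%R by rewrite -powRrM mulVf ?gt_eqF// powRr1.
by rewrite ge0_ler_powR ?nnegrE ?powR_ge0 ?(ltW q0) ?(ltW x0)// ltW.
Qed.

Lemma gauge_le_of_ener f h (x : R) : (0 < x)%R -> majorant f h ->
  ener h <= (x `^ q)%:E -> gauge f <= (g * x)%:E.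
Proof.
move=> x0 fh hx; apply: (le_trans (gauge_le_majorant fh)).
rewrite EFinM lee_wpmul2l//.
have -> : x%:E = (x `^ q)%:E `^ q^-1.
  by rewrite poweR_EFin -powRrM mulfV ?gt_eqF// powRr1// ltW.
by apply: le_poweR; rewrite ?invr_ge0 ?(ltW q0) ?ener_ge0.
Qed.

Lemma le_gauge f1 f2 : (\forall x \ae mu, `|f1 x| <= `|f2 x|) -> gauge f1 <= gauge f2.
Proof.
move=> f12; apply: ereal_inf_le_tmp => _ [h [h0 mh voo fh] <-].
exists h => //; split => //.
by apply: filterS2 f12 fh => x; exact: le_trans.
Qed.

(* [gauge f] is approached by [g * x] with [x > 0], so that strict inequalities
   produce majorants. *)
Lemma gauge_near f (eps : R) : (0 < eps)%R -> gauge f < +oo -> exists x : R,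
  gauge f < (g * x)%:E /\ (g * x)%:E <= gauge f + eps%:E.
Proof.
move=> eps0 foo; exists ((fine (gauge f) + eps) / g)%R.
have ff : gauge f \is a fin_num by rewrite ge0_fin_numE// gauge_ge0.
rewrite mulrCA mulfV ?gt_eqF// mulr1 EFinD fineK//; split => //.
by rewrite lteDl// lte_fin.
Qed.

Lemma gauge_triangle f1 f2 : (forall x, 0 <= f1 x) -> (forall x, 0 <= f2 x) ->
  gauge (fun x => f1 x + f2 x) <= gauge f1 + gauge f2.
Proof.
move=> f10 f20.
have [f1oo|] := ltP (gauge f1) +oo; last first.
  by rewrite leye_eq => /eqP ->; rewrite addye ?leey// gt_eqF// (lt_le_trans _ (gauge_ge0 _)).
have [f2oo|] := ltP (gauge f2) +oo; last first.
  by rewrite leye_eq => /eqP ->; rewrite addey ?leey// gt_eqF// (lt_le_trans _ (gauge_ge0 _)).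
apply/lee_addgt0Pr => eps eps0; have e2 : (0 < eps / 2)%R by lra.
have [x [fx xf]] := gauge_near e2 f1oo; have [y [fy yf]] := gauge_near e2 f2oo.
have [h1 [[h10 mh1 v1 fh1] x0 hx]] := gauge_lt fx.
have [h2 [[h20 mh2 v2 fh2] y0 hy]] := gauge_lt fy.
apply: (@le_trans _ _ (g * (x + y))%:E).
  apply: (@gauge_le_of_ener _ (fun z => h1 z + h2 z)); first exact: addr_gt0.
  - split => [z|||].
    + by rewrite adde_ge0.
    + exact: emeasurable_funD.
    + by rewrite (vnormD reg)// lte_add_pinfty.
    + apply: filterS2 fh1 fh2 => z; rewrite !gee0_abs ?adde_ge0//; exact: leeD.
  - exact: (ener_add reg kapN s1 qs crit x0 y0 h10 h20 mh1 mh2 v1 v2 hx hy).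
rewrite mulrDr EFinD; apply: (le_trans (leeD xf yf)).
by rewrite addeACA -EFinD (_ : (eps / 2 + eps / 2 = eps)%R)//; field.
Qed.

Lemma gaugeZ_le (l : R) f : (0 < l)%R -> gauge (fun x => l%:E * f x) <= l%:E * gauge f.
Proof.
move=> l0; have lE : 0 <= l%:E by rewrite lee_fin ltW.
suff : l^-1%:E * gauge (fun x => l%:E * f x) <= gauge f.
  move=> /(lee_wpmul2l lE); rewrite muleA -EFinM mulfV ?gt_eqF// mul1e; exact.
apply: le_ereal_inf_tmp => _ [h [h0 mh voo fh] <-].
have lh : majorant (fun x => l%:E * f x) (fun x => l%:E * h x).
  split => [x|||].
  - by rewrite mule_ge0.
  - exact: emeasurable_funM.
  - by rewrite (vnormZ reg) ?(ltW l0)// lte_mul_pinfty.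
  - by apply: filterS fh => x fh; rewrite abseM gee0_abs// lee_wpmul2l.
have lV : 0 <= l^-1%:E by rewrite lee_fin invr_ge0 ltW.
apply: (le_trans (lee_wpmul2l lV (gauge_le_majorant lh))).
rewrite (enerZ reg kap qs l0 h0 mh) poweRM ?lee_fin ?powR_ge0 ?ener_ge0//.
rewrite poweR_EFin -powRrM mulfV ?gt_eqF// powRr1 ?(ltW l0)//.
rewrite (muleCA g%:E) muleA -EFinM mulVf ?gt_eqF// mul1e; exact: lexx.
Qed.

Lemma gauge_ae0 f : (\forall x \ae mu, f x = 0) -> gauge f = 0.
Proof.
move=> fE; apply/eqP; rewrite eq_le gauge_ge0 andbT.
have f0 : majorant f (cst 0).
  split => //.
    suff -> : vnorm (cst 0) = 0 by exact: ltry.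
    by apply: integral0_eq => x _; rewrite mule0.
  by apply: filterS fE => x ->; rewrite abse0.
apply: (le_trans (gauge_le_majorant f0)).
rewrite (ener_eq0 reg)//; last exact: nearW.
by rewrite poweR0r ?mule0// invr_neq0// gt_eqF.
Qed.

Lemma gaugeZ (l : R) f : (0 <= l)%R -> gauge (fun x => l%:E * f x) = l%:E * gauge f.
Proof.
rewrite le_eqVlt => /predU1P[<-|l0].
  by rewrite mul0e; apply: gauge_ae0; apply: nearW => x; rewrite mul0e.
apply/eqP; rewrite eq_le gaugeZ_le//=.
have lV : (0 < l^-1)%R by rewrite invr_gt0.
have := gaugeZ_le (fun x => l%:E * f x) lV.
have lE : 0 <= l%:E by rewrite lee_fin ltW.
move=> /(lee_wpmul2l lE); rewrite muleA -EFinM mulfV ?gt_eqF// mul1e.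
congr (_ * gauge _ <= _); apply/funext => x.
by rewrite muleA -EFinM mulVf ?gt_eqF// mul1e.
Qed.

(** A majorant has the larger [vnorm], which its energy controls by [vnorm_le_ener]. Definiteness of
    the norm and its bound on local integrals both rest on this. *)
Lemma vnorm_le_gauge : exists2 C : R, (0 < C)%R & forall f,
  (forall x, 0 <= f x) -> measurable_fun setT f -> vnorm f <= C%:E * gauge f.
Proof.
have [C C0 HC] := vnorm_le_ener reg o kapN s1 qs crit.
exists (C / g)%R; first exact: divr_gt0.
move=> f f0 mf; have gV : 0 <= (g / C)%:E by rewrite lee_fin ltW// divr_gt0.
have CV : 0 <= (C / g)%:E by rewrite lee_fin ltW// divr_gt0.
suff : (g / C)%:E * vnorm f <= gauge f.
  move=> /(lee_wpmul2l CV); rewrite muleA -EFinM.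
  by rewrite (_ : (C / g * (g / C) = 1)%R) ?mul1e//; field; rewrite !gt_eqF.
apply: le_ereal_inf_tmp => _ [h [h0 mh voo fh] <-].
have fv : vnorm f <= C%:E * ener h `^ q^-1.
  apply: le_trans (HC h h0 mh voo).
  apply: le_ae_integralT => [x|x|||].
  - exact: (wtM_ge0 reg).
  - exact: (wtM_ge0 reg).
  - exact: (measurable_wtM reg).
  - exact: (measurable_wtM reg).
  by apply: filterS fh => x; rewrite gee0_abs// => fhx; rewrite lee_wpmul2l// (wt_EFin_ge0 reg).
apply: (le_trans (lee_wpmul2l gV fv)).
by rewrite muleA -EFinM divfK ?gt_eqF.
Qed.

Lemma gauge_eq0 f : (forall x, 0 <= f x) -> measurable_fun setT f ->
  gauge f = 0 <-> \forall x \ae mu, f x = 0.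
Proof.
move=> f0 mf; split=> [f00|]; last exact: gauge_ae0.
have [C C0 HC] := vnorm_le_gauge.
have v_le0 : vnorm f <= 0 by rewrite -(mule0 C%:E) -f00; exact: HC.
have v_ge0 : 0 <= vnorm f by exact: (vnorm_ge0 reg).
have v00 : vnorm f = 0 by apply: le_anti; rewrite v_le0 v_ge0.
exact: (ae_eq0_of_vnorm reg f0 mf v00).
Qed.

Lemma integral_le_gauge (A : set T) (r : R) : measurable A -> (0 <= r)%R ->
  (forall x, A x -> dist o x <= r)%R -> exists2 C : R, (0 < C)%R & forall f,
  (forall x, 0 <= f x) -> measurable_fun setT f ->
  \int[mu]_(x in A) f x <= C%:E * gauge f.
Proof.
move=> mA r0 Ar; have [C C0 HC] := vnorm_le_gauge; case/andP: (kapN) => k0 _.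
have R0 : (0 < 1 + r)%R by lra.
exists ((1 + r) `^ kap * C)%R; first by rewrite mulr_gt0 ?powR_gt0.
move=> f f0 mf; rewrite EFinM -muleA.
apply: (@le_trans _ _ (((1 + r) `^ kap)%:E * vnorm f)); last first.
  by rewrite lee_wpmul2l ?HC// lee_fin powR_ge0.
rewrite -integralT_scale ?powR_ge0//; [|exact: (wtM_ge0 reg)|exact: (measurable_wtM reg)].
rewrite [leLHS]integral_mkcond; apply: le_integralT => [x|||x].
- by rewrite /patch; case: ifP.
- by apply/(measurable_restrictT _ mA); exact: measurable_funS mf.
- by apply: emeasurable_funM => //; exact: (measurable_wtM reg).
rewrite /patch; case: ifPn => [|_]; last first.
  by rewrite mule_ge0 ?lee_fin ?powR_ge0//; exact: (wtM_ge0 reg).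
rewrite inE => Ax; rewrite muleA -EFinM -[leLHS]mul1e lee_wpmul2r// lee_fin.
rewrite /wt powRN ler_pdivlMr ?powR_gt0 ?(wt_base reg)// mul1r.
by rewrite ge0_ler_powR ?nnegrE ?(ltW k0) ?(ltW R0) ?(ltW (wt_base reg _ _))// lerD2l Ar.
Qed.

(** The indicator serves as its own majorant. On [A] its potential is at least the constant [c], by
    [pot_ge_vnorm], and since [q - s < 0] the density is at most [c ^ (q - s)]. *)
Lemma gauge_indic_lty (A : set T) (r : R) : measurable A -> (0 < r)%R ->
  (forall x, A x -> dist o x < r)%R -> gauge (fun x => (\1_A x)%:E) < +oo.
Proof.
move=> mA r0 Ar; case/andP: (kapN) => k0 _; case/andP: (qs) => q1 q_s.
pose h x : \bar R := (\1_A x)%:E.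
have h0 x : 0 <= h x by rewrite lee_fin.
have mh : measurable_fun setT h by apply/measurable_EFinP; exact: measurable_indic.
have Aoo : mu A < +oo.
  apply: (@le_lt_trans _ _ (mu [set y | (dist o y < r)%R])).
    apply: le_measure; rewrite ?inE//.
    by apply: measurable_bool_set; apply: measurable_fun_ltr => //; exact: (measurable_dist reg).
  by apply: (le_lt_trans (ar_upper reg o r0)); rewrite ltry.
have Ih : \int[mu]_x h x = mu A by rewrite integral_indic// setIT.
have voo : vnorm h < +oo.
  apply: le_lt_trans Aoo; rewrite -Ih; apply: le_integralT => // [x||x].
  - exact: (wtM_ge0 reg).
  - exact: (measurable_wtM reg).
  rewrite -[leRHS]mul1e lee_wpmul2r// lee_fin; apply: (wt_le1 reg); exact: ltW.
have hm : majorant h h by split => //; apply: nearW => x; rewrite gee0_abs.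
apply: (le_lt_trans (gauge_le_majorant hm)).
suff eoo : ener h < +oo.
  have efin : ener h \is a fin_num by rewrite ge0_fin_numE// ener_ge0.
  by rewrite -(fineK efin) poweR_EFin -EFinM ltry.
have [v0|vn0] := eqVneq (vnorm h) 0.
  suff -> : ener h = 0 by exact: ltry.
  exact: (ener_eq0 reg _ _ _ h0 mh (ae_eq0_of_vnorm reg h0 mh v0)).
have vfin : vnorm h \is a fin_num by rewrite ge0_fin_numE// (vnorm_ge0 reg).
pose v := fine (vnorm h).
have vE : vnorm h = v%:E by rewrite fineK.
have v0 : (0 < v)%R by rewrite -lte_fin -vE lt0e vn0 (vnorm_ge0 reg).
pose c := ((1 + r) `^ (- kap) * v)%R.
have c0 : (0 < c)%R by rewrite mulr_gt0// powR_gt0//; lra.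
apply: (@le_lt_trans _ _ (\int[mu]_x ((c `^ (q - s))%:E * h x))); last first.
  rewrite integralT_scale ?powR_ge0// Ih lte_mul_pinfty// lee_fin powR_ge0//.
apply: le_integralT => [x|||x].
- exact: ener_density_ge0.
- exact: (measurable_ener_density reg).
- exact: emeasurable_funM.
rewrite /ener_density /h indicE; case: ifPn => [_|]; first by rewrite mule_ge0 ?lee_fin ?powR_ge0.
rewrite eqe pnatr_eq0 eqb0 negbK inE => Ax; rewrite mem_set// poweR_EFin powR1 mul1e mule1.
rewrite -epow_pos//; apply: epow_antitone; [lra|by rewrite lee_fin ltW|].
apply: le_trans (pot_ge_vnorm reg o kapN x h0 mh).
rewrite vE -EFinM lee_fin ler_wpM2r ?(ltW v0)// /wt !powRN.
have b0 := wt_base reg o x.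
rewrite lef_pV2 ?posrE ?powR_gt0//; last by lra.
have xr := Ar x Ax; have b1 : (1 + dist o x <= 1 + r)%R by lra.
by rewrite ge0_ler_powR ?nnegrE ?(ltW k0) ?(ltW b0)//; lra.
Qed.

Lemma gauge_fatou_le (f_ : nat -> T -> \bar R) f (L : R) : (0 <= L)%R ->
  (forall j x, 0 <= f_ j x) -> (forall x, 0 <= f x) ->
  (\forall x \ae mu, nondecreasing_seq (f_ ^~ x) /\ f_ ^~ x @ \oo --> f x) ->
  (forall j, gauge (f_ j) <= L%:E) -> gauge f <= L%:E.
Proof.
move=> L0 f_0 f0 fcvg fL; apply/lee_addgt0Pr => eps eps0; rewrite -EFinD.
(* The slack [eps] makes the bound on the gauges strict, so each [f_ j] has a majorant of energy at
   most [E0]. *)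
pose x := ((L + eps) / g)%R.
have gx : (g * x = L + eps)%R by rewrite /x mulrCA mulfV ?mulr1// gt_eqF.
have x0 : (0 < x)%R by rewrite divr_gt0//; lra.
rewrite -gx; pose E0 := (x `^ q)%R; have E00 : (0 < E0)%R by rewrite powR_gt0.
have [C C0 HC] := vnorm_le_ener reg o kapN s1 qs crit.
pose M0 := (C * x)%R; have M00 : (0 < M0)%R by exact: mulr_gt0.
have vM h : (forall y, 0 <= h y) -> measurable_fun setT h -> vnorm h < +oo ->
    ener h <= E0%:E -> vnorm h <= M0%:E.
  move=> h0 mh voo hE; apply: (le_trans (HC h h0 mh voo)).
  rewrite EFinM lee_wpmul2l ?lee_fin ?(ltW C0)//.
  have -> : x%:E = E0%:E `^ q^-1.
    by rewrite poweR_EFin -powRrM mulfV ?gt_eqF// powRr1// ltW.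
  by apply: le_poweR; rewrite ?invr_ge0 ?(ltW q0) ?ener_ge0.
(* Domination of all [f_ i] with [i <= j] is built in, which makes nestedness immediate; functions
   are real-valued for the selection, and finite [vnorm] allows that up to a null set. *)
pose K j := [set u : T -> R | [/\ measurable_fun setT u, forall y, (0 <= u y)%R,
  vnorm (fun y => (u y)%:E) < +oo, ener (fun y => (u y)%:E) <= E0%:E &
  forall i, (i <= j)%N -> \forall y \ae mu, f_ i y <= (u y)%:E]].
have Kne j : K j !=set0.
  have : gauge (f_ j) < (g * x)%:E.
    by apply: (le_lt_trans (fL j)); rewrite lte_fin gx; lra.
  move=> /gauge_lt[h [[h0 mh voo fh] _ hE]].
  have hfin := ae_fin_of_vnorm reg h0 mh voo.
  have mu' : measurable_fun setT (fun y => fine (h y)) by exact: measurableT_comp.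
  have Emu : measurable_fun setT (fun y => (fine (h y))%:E) by exact/measurable_EFinP.
  have u0 y : 0 <= (fine (h y))%:E by rewrite lee_fin fine_ge0.
  have hu : \forall y \ae mu, (fine (h y))%:E = h y.
    by apply: filterS hfin => y hy; rewrite fineK// ge0_fin_numE.
  exists (fun y => fine (h y)); split.
  - exact: mu'.
  - by move=> y; exact: fine_ge0.
  - suff -> : vnorm (fun y => (fine (h y))%:E) = vnorm h by exact: voo.
    apply: (eq_ae_integralT (wtM_ge0 reg o kap u0) (wtM_ge0 reg o kap h0)).
    + exact: (measurable_wtM reg o kap Emu).
    + exact: (measurable_wtM reg o kap mh).
    + by apply: filterS hu => y ->.
  - by rewrite (eq_ae_ener reg kap s q u0 h0 Emu mh hu).
  - move=> i ij; apply: filterS2 hu (filterI fcvg fh) => y -> [[fnd _]].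
    rewrite gee0_abs//; apply: le_trans; exact: fnd.
have Knested i j : (i <= j)%N -> K j `<=` K i.
  by move=> ij u [? ? ? ? fu]; split => // k ki; apply: fu; exact: leq_trans ij.
have Kmid j u1 u2 : K j u1 -> K j u2 -> K j (fun y => (u1 y + u2 y) / 2)%R.
  move=> [m1 u10 v1 e1 f1] [m2 u20 v2 e2 f2].
  have half : (0 < 1 / 2 :> R)%R by lra.
  have halfE : 0 <= (1 / 2)%:E :> \bar R by rewrite lee_fin ltW.
  have E1 : measurable_fun setT (fun y => (u1 y)%:E) by exact/measurable_EFinP.
  have E2 : measurable_fun setT (fun y => (u2 y)%:E) by exact/measurable_EFinP.
  have p1 y : 0 <= (u1 y)%:E by rewrite lee_fin.
  have p2 y : 0 <= (u2 y)%:E by rewrite lee_fin.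
  have hp1 y : 0 <= (1 / 2)%:E * (u1 y)%:E by rewrite mule_ge0// lee_fin ltW.
  have hp2 y : 0 <= (1 / 2)%:E * (u2 y)%:E by rewrite mule_ge0// lee_fin ltW.
  have hE : (fun y => ((u1 y + u2 y) / 2)%:E) =
      (fun y => (1 / 2)%:E * (u1 y)%:E + (1 / 2)%:E * (u2 y)%:E).
    by apply/funext => y; rewrite -!EFinM -EFinD; congr EFin; field.
  split.
  - by apply: measurable_funM => //; exact: measurable_funD.
  - by move=> y; rewrite divr_ge0// addr_ge0.
  - rewrite hE (vnormD reg)//; [|exact: emeasurable_funM|exact: emeasurable_funM].
    rewrite !(vnormZ reg) ?(ltW half)//.
    by apply: lte_add_pinfty; apply: lte_mul_pinfty.
  - rewrite hE; apply: (@le_trans _ _ ((1 / 2)%:E * E0%:E + (1 / 2)%:E * E0%:E)).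
      apply: (le_trans (ener_convex reg kapN s1 qs crit half half _ p1 p2 E1 E2 v1 v2)).
        by lra.
      exact: (leeD (lee_wpmul2l halfE e1) (lee_wpmul2l halfE e2)).
    by rewrite -EFinM -EFinD lee_fin; lra.
  - move=> i ij; apply: filterS2 (f1 i ij) (f2 i ij) => y.
    case: (f_ i y) (f_0 i y) => [w||]//; rewrite !lee_fin; lra.
have Nc : (N < cexp kap s)%R by exact: N_lt_cexp.
have [C1 _ HC1] := wt_integral_fin reg o Nc.
have Woo : \int[mu]_y (om (cexp kap s) y)%:E < +oo by exact: (le_lt_trans HC1 (ltry _)).
have KV j u : K j u -> \int[mu]_y ((om kap y)%:E * (u y)%:E) <= M0%:E.
  move=> [mu' u0 voo ue _]; have Emu : measurable_fun setT (fun y => (u y)%:E) by exact/measurable_EFinP.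
  have Eu0 y : 0 <= (u y)%:E by rewrite lee_fin.
  exact: (vM _ Eu0 Emu voo ue).
have [u [h [Ku mh h0 uh]]] := @komlos_selection _ _ _ mu _ (measurable_wt reg o _)
  (wt_gt0 reg o _) Woo K Kne Knested Kmid (fun j w Kw => let: And5 a _ _ _ _ := Kw in a)
  (fun j w y Kw => let: And5 _ a _ _ _ := Kw in a y) _ M0 (measurable_wt reg o _)
  (wt_gt0 reg o kap) KV.
have um k : measurable_fun setT (u k) by case: (Ku k).
have u0 k y : (0 <= u k y)%R by case: (Ku k) => _ /(_ y).
have uv k : vnorm (fun y => (u k y)%:E) <= M0%:E by exact: KV (Ku k).
have ue k : ener (fun y => (u k y)%:E) <= E0%:E by case: (Ku k).
have hv := vnorm_limit reg um mh u0 h0 uv uh.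
have he := ener_limit reg kapN s1 qs crit M00 E00 um mh u0 h0 uv ue uh.
apply: (@gauge_le_of_ener _ (fun y => (h y)%:E)) => //; split.
- by move=> y; rewrite lee_fin.
- exact/measurable_EFinP.
- exact: le_lt_trans hv (ltry _).
have fu : \forall y \ae mu, forall i k, (i <= k)%N -> f_ i y <= (u k y)%:E.
  apply/ae_foralln => i; apply/ae_foralln => k.
  have [ik|ki] := leqP i k; last first.
    exact: nearW.
  by case: (Ku k) => _ _ _ _ /(_ i ik); apply: filterS.
apply: filterS2 fu (filterI uh fcvg) => y fuy [uhy [_ fy]].
rewrite gee0_abs//; apply: (cvge_to_le fy); apply: nearW => i.
have Euh : (fun k => (u k y)%:E) @ \oo --> (h y)%:E by apply: cvg_EFin uhy; exact: nearW.
apply: (cvge_to_ge Euh); exists i => // k /= ik; exact: fuy.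
Qed.

Lemma gauge_fatou (f_ : nat -> T -> \bar R) f :
  (forall j x, 0 <= f_ j x) -> (forall x, 0 <= f x) ->
  (\forall x \ae mu, nondecreasing_seq (f_ ^~ x) /\ f_ ^~ x @ \oo --> f x) ->
  nondecreasing_seq (gauge \o f_) /\ gauge \o f_ @ \oo --> gauge f.
Proof.
move=> f_0 f0 fcvg.
have nd : nondecreasing_seq (gauge \o f_).
  move=> i j ij; apply: le_gauge; apply: filterS fcvg => x [fnd _].
  by rewrite !gee0_abs//; exact: fnd.
split => //; have := ereal_nondecreasing_cvgn nd.
suff -> : ereal_sup (range (gauge \o f_)) = gauge f by [].
apply/eqP; rewrite eq_le; apply/andP; split.
  apply: ge_ereal_sup => _ [j _ <-]; apply: le_gauge.
  apply: filterS fcvg => x [fnd fx]; rewrite !gee0_abs//.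
  apply: (cvge_to_ge fx); exists j => // k /= jk; exact: fnd.
have [Loo|] := ltP (ereal_sup (range (gauge \o f_))) +oo; last first.
  by rewrite leye_eq => /eqP ->; exact: leey.
have gs j : gauge (f_ j) <= ereal_sup (range (gauge \o f_)).
  by apply: ereal_sup_ubound; exists j.
have s0 : 0 <= ereal_sup (range (gauge \o f_)) by exact: le_trans (gauge_ge0 _) (gs 0%N).
have sfin : ereal_sup (range (gauge \o f_)) \is a fin_num by rewrite ge0_fin_numE.
rewrite -(fineK sfin); apply: (gauge_fatou_le _ f_0 f0 fcvg); first exact: fine_ge0.
by move=> j; rewrite fineK.
Qed.

End energy_gauge.

(** * Riesz potentials on Euclidean space *)

Section potential_integrability.
Context d (T : measurableType d) (R : realType).
Variables (mu : {sigma_finite_measure set T -> \bar R}) (dist : T -> T -> R).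
Variables (N cL cU : R).
Hypothesis reg : ahlfors_regular mu dist N cL cU.
Variables (o : T) (kap : R).
Hypothesis kapN : (0 < kap < N)%R.

(** Since [u <= 1 + u ^ p] and the weight [om] is bounded below on [A], the [p]-th power estimate
    gives the local integrability demanded of a weight. *)
Lemma pot_integral_bounded (h : T -> \bar R) (A : set T) (r : R) :
  (forall x, 0 <= h x) -> measurable_fun setT h -> vnorm mu dist o kap h < +oo ->
  measurable A -> (0 <= r)%R -> (forall x, A x -> dist o x <= r)%R ->
  \int[mu]_(x in A) pot mu dist kap 0 h x < +oo.
Proof.
move=> h0 mh voo mA r0 Ar; have [p [p1 kp]] := exists_pot_power kapN.
have p0 : (0 < p)%R by lra.
case/andP: (kapN) => k0 kN.
pose b := (N + 1)%R; have Nb : (N < b)%R by rewrite /b; lra.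
have b0 : (0 <= b)%R by rewrite /b; lra.
have [C1 C10 HC1] := wt_integral_fin reg o Nb.
have [C C0 HC] := wt_pot_power_le reg o kapN p1 kp Nb.
pose u := pot mu dist kap 0 h; pose om x : \bar R := (wt dist o b x)%:E.
have u0 x : 0 <= u x by exact: pot_ge0.
have mu' : measurable_fun setT u by exact: (measurable_pot reg).
have om0 x : 0 <= om x by rewrite lee_fin ltW// (wt_gt0 reg).
have mom : measurable_fun setT om by exact: (measurable_EFin_wt reg).
have R0 : (0 < 1 + r)%R by lra.
have mF : measurable_fun setT (fun x => om x * u x `^ p).
  by apply: emeasurable_funM => //; exact: measurable_poweRe.
have F0 x : 0 <= om x * u x `^ p by rewrite mule_ge0// poweR_ge0.
have mG : measurable_fun setT (fun x => om x + om x * u x `^ p) by exact: emeasurable_funD.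
have G0 x : 0 <= om x + om x * u x `^ p by rewrite adde_ge0.
apply: (@le_lt_trans _ _ (\int[mu]_x (((1 + r) `^ b)%:E * (om x + om x * u x `^ p)))).
  rewrite [leLHS]integral_mkcond; apply: le_integralT => [x|||x].
  - by rewrite /patch; case: ifP => // _; exact: u0.
  - by apply/(measurable_restrictT _ mA); exact: measurable_funS mu'.
  - exact: emeasurable_funM.
  rewrite /patch; case: ifPn => [|_]; last first.
    by apply: mule_ge0 => //; rewrite lee_fin powR_ge0.
  rewrite inE => Ax.
  have low : 1 <= ((1 + r) `^ b)%:E * om x.
    rewrite -EFinM lee_fin /wt powRN ler_pdivlMr ?powR_gt0 ?(wt_base reg)// mul1r.
    by rewrite ge0_ler_powR ?nnegrE ?(ltW R0) ?(ltW (wt_base reg _ _))// lerD2l Ar.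
  have up : u x <= 1 + u x `^ p.
    case: (u x) (u0 x) => [v||//]; last first.
      by rewrite poweRyr ?gt_eqF// addey.
    rewrite lee_fin poweR_EFin -EFinD lee_fin => v0.
    have [v1|v1] := leP v 1%R; first by rewrite ler_wpDr ?powR_ge0.
    rewrite ler_wpDl// -[leLHS]powRr1// ler_powR//; exact: ltW.
  have -> : om x + om x * u x `^ p = om x * (1 + u x `^ p).
    by rewrite ge0_muleDr ?mule1 ?poweR_ge0.
  rewrite muleA -[leLHS]mul1e; apply: lee_pmul => //.
rewrite integralT_scale ?powR_ge0// integralT_add//.
rewrite lte_mul_pinfty ?lee_fin ?powR_ge0//.
have vfin : vnorm mu dist o kap h \is a fin_num.
  by rewrite ge0_fin_numE//; exact: (vnorm_ge0 reg).
apply: lte_add_pinfty; first exact: le_lt_trans HC1 (ltry _).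
apply: (le_lt_trans (HC h h0 mh)).
by rewrite -(fineK vfin) poweR_EFin -EFinM ltry.
Qed.

(** The functions may have any sign here: an element of [O_space] that is above [|f|] almost
    everywhere can still be negative on a null set. *)
Lemma eq_ae_pot_measurable r (h h' : T -> \bar R) x :
  measurable_fun setT h -> measurable_fun setT h' ->
  (\forall y \ae mu, h y = h' y) -> pot mu dist kap r h x = pot mu dist kap r h' x.
Proof.
move=> mh mh' hh'; have mp := measurable_pker_dist reg kap r x.
apply: ae_eq_integral; [exact: measurableT|exact: emeasurable_funM|exact: emeasurable_funM|].
by apply: filterS hh' => y -> _.
Qed.

End potential_integrability.

Lemma measurable_if_eq0 d (T : measurableType d) (R : realType) (h f : T -> \bar R) :
  measurable_fun setT h -> measurable_fun setT f ->
  measurable_fun setT (fun x => if h x == 0 then 0 else f x).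
Proof.
by move=> mh mf; apply: measurable_fun_ifT => //; exact: measurable_fun_eqe.
Qed.

HB.instance Definition _ (R : realType) n := Measure_isSigmaFinite.Build _ _ _
  (@completed_measure_extension _ _ _ (@lebesgue_tuple R n)) (leb_sigma_finite n).

Section riesz_setting.
Context {R : realType} {n : nat} (alpha s q : R).
Hypothesis n0 : (0 < n)%N.
Hypothesis s1 : (1 < s)%R.
Hypothesis alpha0 : (0 < alpha)%R.
Hypothesis alphan : (alpha < n%:R / s)%R.
Hypothesis qs : (1 <= q < s)%R.

Local Notation E := (euclid R n).

(** [leb] with its sigma-finite structure, through which the abstract estimates use Tonelli's
    theorem. *)
Definition leb_sf : {sigma_finite_measure set E -> \bar R} :=
  @completed_measure_extension _ _ _ (@lebesgue_tuple R n).

Definition origin : E := [tuple of nseq n 0%R].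

Local Notation mu := leb_sf.
Local Notation dist := (@Defs.edist R n).
Local Notation o := origin.
Local Notation kap := (n%:R - alpha)%R.
Local Notation g := (@riesz_const R n alpha).
Local Notation pot := (pot mu dist kap).
Local Notation vnorm := (vnorm mu dist o kap).
Local Notation ener := (ener mu dist kap s q).
Implicit Types h f w : E -> \bar R.

Let s0 : (0 < s)%R. Proof. by have := s1; lra. Qed.
Let q0 : (0 < q)%R. Proof. by case/andP: qs => q1 _; lra. Qed.
Let qs0 : (q - s < 0)%R. Proof. by case/andP: qs; lra. Qed.
Let nr0 : (0 < n%:R :> R)%R. Proof. by rewrite ltr0n. Qed.

Let reg : ahlfors_regular mu dist n%:R (n%:R^-1 ^+ n) (2 ^+ n).
Proof. exact: edist_regular. Qed.

Let crit : ((n%:R - kap) * s < n%:R)%R.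
Proof. by rewrite opprB addrC subrK -ltr_pdivlMr. Qed.

Let alpha_lt_n : (alpha < n%:R)%R.
Proof.
apply: (lt_le_trans alphan); rewrite ler_pdivrMr// ler_peMr ?(ltW nr0)//; exact: ltW.
Qed.

Let kapN : (0 < kap < n%:R)%R.
Proof. by have := alpha_lt_n; have := alpha0; move=> *; apply/andP; split; lra. Qed.

Let g0 : (0 < g)%R.
Proof. by apply: riesz_const_gt0; rewrite alpha0 alpha_lt_n. Qed.

Lemma enormE (x : E) : enorm x = dist o x.
Proof.
rewrite /enorm /Defs.edist; congr Num.sqrt; apply: eq_bigr => i _.
have -> : tnth o i = 0%R by rewrite (tnth_nth 0%R); have := nth_nseq (0%R : R) n 0%R i; rewrite ltn_ord.
by rewrite sub0r sqrrN.
Qed.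

Lemma riesz_potentialE h x : riesz_potential alpha h x = g%:E * pot 0 h x.
Proof.
rewrite /riesz_potential; congr (_ * _); apply: eq_integral => y _.
by rewrite add0r -(opprB _ alpha) epowN_pker//; case/andP: kapN.
Qed.

Lemma riesz_capE A : riesz_cap alpha s A = cap mu dist kap s g A.
Proof.
congr ereal_inf; apply/seteqP; split => _ [f [[mf f0] fA] <-]; exists f.
- by split=> // x /fA; rewrite riesz_potentialE.
- rewrite poweR_Lnorm ?gt_eqF//; apply: eq_integral => x _.
  by rewrite gee0_abs.
- by split=> // x /fA; rewrite riesz_potentialE.
- rewrite poweR_Lnorm ?gt_eqF//; apply: eq_integral => x _.
  by rewrite gee0_abs.
Qed.

Definition weight_energy h w : \bar R :=
  \int[leb R n]_(x in [set x | h x != 0]) (epow `|h x| s * epow (w x) (q - s)).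

Lemma weight_energy_if h w : weight_energy h w =
  \int[mu]_x (if h x == 0 then 0 else epow `|h x| s * epow (w x) (q - s)).
Proof.
rewrite /weight_energy integral_mkcond; apply: eq_integral => x _.
rewrite /patch; case: eqP => hx.
  by rewrite ifF//; apply/negbTE/negP; rewrite inE/= hx eqxx.
by rewrite ifT// inE/=; exact/eqP.
Qed.

Lemma weight_energyE h w : (forall x, 0 <= h x) -> weight_energy h w =
  \int[mu]_x (if h x == 0 then 0 else h x `^ s * epow (w x) (q - s)).
Proof.
move=> h0; rewrite weight_energy_if; apply: eq_integral => x _.
by rewrite gee0_abs// epow_nneg// ltW.
Qed.

Definition riesz_energy h : \bar R :=
  \int[leb R n]_x (if h x == 0 then 0
    else epow (h x) s * epow (riesz_potential alpha h x) (q - s)).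

Lemma riesz_energyE h : (forall x, 0 <= h x) -> measurable_fun setT h ->
  riesz_energy h = (g `^ (q - s))%:E * ener h.
Proof.
move=> h0 mh; have md := measurable_ener_density reg kap s q h0 mh.
have d0 x := ener_density_ge0 mu dist kap s q h x.
rewrite -[RHS](integralT_scale mu (powR_ge0 g (q - s)) d0 md).
apply: eq_integral => x _; rewrite /ener_density; case: ifPn => _; first by rewrite mule0.
by rewrite riesz_potentialE epowZ ?pot_ge0// epow_nneg ?(ltW s0)// muleCA.
Qed.

(** The Riesz constant enters the energy through the potential alone, hence to the power [q - s];
    the norm takes the [q]-th root. *)
Let gq : R := ((g `^ (q - s)) `^ q^-1)%R.

Let gq0 : (0 < gq)%R. Proof. by rewrite !powR_gt0. Qed.

Lemma riesz_energy_root h : (forall x, 0 <= h x) -> measurable_fun setT h ->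
  riesz_energy h `^ q^-1 = gq%:E * ener h `^ q^-1.
Proof.
move=> h0 mh; rewrite riesz_energyE// poweRM ?lee_fin ?powR_ge0 ?ener_ge0//.
Qed.

Lemma weighted_vnorm_fin h w : measurable_fun setT h -> (forall x, 0 <= h x) ->
  qe_weight alpha s w -> Lcap_norm alpha s q w <= 1 ->
  weight_energy h w < +oo -> vnorm h < +oo.
Proof.
move=> mh h0 [w0 [mw _]] wle hw.
apply: (vnorm_fin_of_weight reg s1 qs crit h0 mh mw); last by rewrite -weight_energyE.
(* The weight is nonnegative off a set of zero capacity, which the trace inequality shows to be null
   for [om cexp dx] and so for Lebesgue measure. *)
- have [C C0 HC] := trace_capacity reg o kapN s1 crit g0.
  pose b x := ~~ (0 <= w x).
  have mb : measurable_fun setT b.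
    by apply: measurable_neg; exact: measurable_fun_lee.
  have mi : measurable_fun setT (fun x => (wt dist o (cexp kap s) x)%:E * ind (b x)).
    by apply: emeasurable_funM; [exact: (measurable_EFin_wt reg)|exact: measurable_ind].
  have i0 x : 0 <= (wt dist o (cexp kap s) x)%:E * ind (b x).
    by rewrite mule_ge0 ?ind_ge0// lee_fin ltW// (wt_gt0 reg).
  have := HC b mb.
  have -> : cap mu dist kap s g [set x | b x] = 0.
    rewrite -riesz_capE -w0; congr riesz_cap; apply/seteqP.
    by split => x /negP.
  rewrite mule0 => le0; have /(ae_eq0_integral i0 mi) :
    \int[mu]_x ((wt dist o (cexp kap s) x)%:E * ind (b x)) = 0.
    by apply: le_anti; rewrite le0 integral_ge0.
  apply: filterS => x; rewrite /ind /b; case: (0 <= w x) => //=.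
  by rewrite mule1 => /eqP; rewrite eqe gt_eqF// (wt_gt0 reg).
- have [C C0 HC] := weight_integral reg o q kapN s1 crit g0.
  apply: (le_lt_trans (HC w mw)); apply: lte_mul_pinfty; rewrite ?lee_fin ?(ltW C0)//.
  move: wle; rewrite /Lcap_norm.
  under eq_integral do rewrite riesz_capE.
  have : 0 <= \int[lebesgue_measure]_(t in `]0%R, +oo[)
      cap mu dist kap s g [set x | t%:E < `|w x| `^ q].
    by apply: integral_ge0 => t _; exact: cap_ge0.
  case: (\int[lebesgue_measure]_(t in _) _) => [I||]// _; first by rewrite ltry.
  by rewrite poweRyr ?invr_neq0 ?gt_eqF// leNgt ltry.
Qed.

Lemma O_space_vnorm h : (forall x, 0 <= h x) -> O_space alpha s q h -> vnorm h < +oo.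
Proof.
move=> h0 [mh /ereal_inf_lt[_ [w [qw wle] <-] hw]].
apply: (weighted_vnorm_fin mh h0 qw wle).
rewrite ltNge leye_eq; apply/negP => /eqP wE; move: hw.
rewrite -/(weight_energy h w) wE poweRyr ?invr_neq0 ?gt_eqF// ltxx.
Qed.

(** The weight is the potential of [c h], for which [h ^ s w ^ (q - s)] is a multiple of the energy
    density of [h]. *)
Lemma vnorm_O_space h : (forall x, 0 <= h x) -> measurable_fun setT h ->
  vnorm h < +oo -> ener h < +oo -> O_space alpha s q h.
Proof.
move=> h0 mh voo eoo; split => //.
have [C C0 HC] := capacitary_strong_type reg o kapN s1 qs crit g0.
have efin : ener h \is a fin_num by rewrite ge0_fin_numE// ener_ge0.
pose e := fine (ener h); have eE : ener h = e%:E by rewrite fineK.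
have e0 : (0 <= e)%R by rewrite -lee_fin -eE ener_ge0.
have Ce : (0 < C * (e + 1))%R by rewrite mulr_gt0//; lra.
(* The strong-type bound for [c h] is [C c ^ q e], by homogeneity; this [c] makes it at most [1],
   with [e + 1] in place of [e] to cover [e = 0]. *)
pose c := ((C * (e + 1))^-1 `^ q^-1)%R.
have c0 : (0 < c)%R by rewrite powR_gt0// invr_gt0.
have cq : (c `^ q = (C * (e + 1))^-1)%R.
  by rewrite /c -powRrM mulVf ?gt_eqF// powRr1// ltW// invr_gt0.
pose k x := c%:E * h x; pose w := pot 0 k.
have cE : 0 <= c%:E by rewrite lee_fin ltW.
have k0 x : 0 <= k x by exact: mule_ge0.
have mk : measurable_fun setT k by exact: emeasurable_funM.
have vk : vnorm k < +oo by rewrite (vnormZ reg) ?(ltW c0)//; exact: lte_mul_pinfty.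
have w0 x : 0 <= w x by exact: pot_ge0.
have mw : measurable_fun setT w by exact: (measurable_pot reg).
have capw : \int[lebesgue_measure]_(t in `]0%R, +oo[)
    cap mu dist kap s g [set x | t%:E < `|w x| `^ q] <= 1.
  apply: (le_trans (HC k k0 mk vk)).
  rewrite (enerZ reg kap qs c0 h0 mh) cq eE -!EFinM lee_fin mulrA.
  rewrite mulrC mulrA -/(_ / _)%R ler_pdivrMr// mul1r mulrC ler_wpM2l ?(ltW C0)//; lra.
have qw : qe_weight alpha s w.
  split.
    have e0' : [set x | ~ 0 <= w x] = set0.
      by apply/seteqP; split => x //= /(_ (w0 x)).
    by rewrite /quasi_everywhere riesz_capE e0'; apply: cap_set0.
  split => // A mA [r Ar]; apply/integrableP; split; first exact: measurable_funS mw.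
  under eq_integral do rewrite gee0_abs//.
  apply: (pot_integral_bounded reg kapN (r := `|r|%R) k0 mk vk mA) => //.
  by move=> x /Ar; rewrite -enormE => /le_trans; apply; exact: ler_norm.
have wle : Lcap_norm alpha s q w <= 1.
  rewrite /Lcap_norm; under eq_integral do rewrite riesz_capE.
  have <- : 1%:E `^ q^-1 = 1 :> \bar R by rewrite poweR_EFin powR1.
  apply: le_poweR => //; first by rewrite invr_ge0 ltW.
  by apply: integral_ge0 => t _; exact: cap_ge0.
apply: (@le_lt_trans _ _ (weight_energy h w `^ s^-1)).
  by apply: ereal_inf_lbound; exists w.
have -> : weight_energy h w = (c `^ (q - s))%:E * ener h.
  rewrite weight_energyE//; have md := measurable_ener_density reg kap s q h0 mh.
  have d0 x := ener_density_ge0 mu dist kap s q h x.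
  rewrite -[RHS](integralT_scale mu (powR_ge0 c (q - s)) d0 md).
  apply: eq_integral => x _; rewrite /ener_density; case: ifPn => _; first by rewrite mule0.
  by rewrite /w (potZ reg kap 0%R x (ltW c0) h0 mh) epowZ ?pot_ge0// muleCA.
by rewrite eE -EFinM poweR_EFin ltry.
Qed.

(** Taking the positive part removes the points with [h < 0] from the domain of integration and
    changes nothing elsewhere; it allows majorants to be nonnegative everywhere. *)
Lemma weight_energy_max h w : measurable_fun setT h -> measurable_fun setT w ->
  weight_energy (fun x => maxe (h x) 0) w <= weight_energy h w.
Proof.
move=> mh mw.
have mh' : measurable_fun setT (fun x => maxe (h x) 0) by exact: measurable_maxe.
have mabs (k : E -> \bar R) : measurable_fun setT k -> measurable_fun setT (fun x => `|k x|).
  by move=> mk; exact: measurableT_comp.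
rewrite !weight_energy_if; apply: le_integralT => [x|||x].
- by case: ifP => // _; apply: mule_ge0; exact: epow_ge0.
- apply: (measurable_if_eq0 mh').
  exact: (emeasurable_funM (measurable_epow s (mabs _ mh')) (measurable_epow (q - s)%R mw)).
- apply: (measurable_if_eq0 mh).
  exact: (emeasurable_funM (measurable_epow s (mabs _ mh)) (measurable_epow (q - s)%R mw)).
case: (leP (h x) 0) => hx; last exact: lexx.
by rewrite eqxx; case: ifP => // _; apply: mule_ge0; exact: epow_ge0.
Qed.

Lemma O_space_max h : O_space alpha s q h -> O_space alpha s q (fun x => maxe (h x) 0).
Proof.
move=> [mh Oh]; split; first exact: measurable_maxe.
apply: le_lt_trans Oh; apply: le_ereal_inf_tmp => _ [w [qw wle] <-].
have mw : measurable_fun setT w by case: qw => _ [].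
apply: (@le_trans _ _ (weight_energy (fun x => maxe (h x) 0) w `^ s^-1)).
  by apply: ereal_inf_lbound; exists w.
apply: le_poweR; [by rewrite invr_ge0 ltW| |exact: weight_energy_max].
by apply: integral_ge0 => x _; apply: mule_ge0; exact: epow_ge0.
Qed.

(** Majorants of infinite energy contribute only [+oo] to the infimum, whether or not they belong to
    [O_space]. In the other direction [h] is replaced by its positive part, equal to it almost
    everywhere because [h >= |f|] almost everywhere. *)
Lemma KV_norm_gauge f : KV_norm alpha s q f = gauge mu dist o kap s q gq f.
Proof.
apply/eqP; rewrite eq_le; apply/andP; split.
  apply: le_ereal_inf_tmp => _ [h [h0 mh voo fh] <-].
  have [eoo|] := ltP (ener h) +oo; last first.
    by rewrite leye_eq => /eqP ->; rewrite poweRyr ?invr_neq0 ?gt_eqF// gt0_muley ?lte_fin// leey.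
  rewrite -riesz_energy_root//; apply: ereal_inf_lbound; exists h => //.
  by split => //; exact: vnorm_O_space.
apply: le_ereal_inf_tmp => _ [h [[mh Oh] fh] <-].
pose h' x := maxe (h x) 0.
have h'0 x : 0 <= h' x by rewrite /h' le_max lexx orbT.
have mh' : measurable_fun setT h' by exact: measurable_maxe.
have hh' : \forall x \ae mu, h x = h' x.
  apply: filterS fh => x fx; rewrite /h' max_l//; exact: le_trans (abse_ge0 _) fx.
have Oh' : O_space alpha s q h' by exact: O_space_max.
have voo := O_space_vnorm h'0 Oh'.
have rE x : riesz_potential alpha h x = riesz_potential alpha h' x.
  rewrite !riesz_potentialE; congr (_ * _).
  exact: (eq_ae_pot_measurable reg kap 0%R x mh mh' hh').
have mrp : measurable_fun setT (riesz_potential alpha h').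
  rewrite (_ : riesz_potential alpha h' = (fun x => g%:E * pot 0 h' x)).
    exact: (emeasurable_funM (measurable_cst _) (measurable_pot reg kap 0%R h'0 mh')).
  exact/funext/riesz_potentialE.
have mdens (k : E -> \bar R) : measurable_fun setT k -> measurable_fun setT
    (fun x => if k x == 0 then 0 else epow (k x) s * epow (riesz_potential alpha h' x) (q - s)).
  move=> mk; apply: (measurable_if_eq0 mk).
  exact: (emeasurable_funM (measurable_epow s mk) (measurable_epow (q - s)%R mrp)).
have dens0 (k : E -> \bar R) x : 0 <= (if k x == 0 then 0 else
    epow (k x) s * epow (riesz_potential alpha h' x) (q - s)).
  by case: ifP => // _; rewrite mule_ge0 ?epow_ge0.
rewrite -/(riesz_energy h); have -> : riesz_energy h = riesz_energy h'.
  rewrite /riesz_energy; under eq_integral do rewrite rE.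
  apply: eq_ae_integralT => [x|x|||].
  - exact: dens0.
  - exact: dens0.
  - exact: mdens.
  - exact: mdens.
  - by apply: filterS hh' => x ->.
rewrite riesz_energy_root//; apply: gauge_le_majorant; split => //.
by apply: filterS2 fh hh' => x fx <-.
Qed.

Lemma KV_norm_abs f : KV_norm alpha s q f = KV_norm alpha s q (fun x => `|f x|).
Proof.
rewrite !KV_norm_gauge; apply: le_anti; apply/andP.
by split; apply: le_gauge; apply: nearW => x; rewrite abse_id.
Qed.

Lemma KV_norm_banach : banach_function_norm (@KV_norm R n alpha s q).
Proof.
split.
- by move=> f _; rewrite KV_norm_gauge; exact: gauge_ge0.
- move=> f [mf f0]; rewrite KV_norm_gauge.
  exact: (gauge_eq0 reg o kapN s1 qs crit gq0 f0 mf).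
- move=> f1 f2 [_ f10] [_ f20]; rewrite !KV_norm_gauge.
  exact: (gauge_triangle reg o kapN s1 qs crit gq0 f10 f20).
- move=> f l _ l0; rewrite !KV_norm_gauge.
  exact: (gaugeZ reg o kap qs gq0 f l0).
- move=> f_ f f_0 [_ f0] fcvg.
  have -> : KV_norm alpha s q \o f_ = gauge mu dist o kap s q gq \o f_.
    by apply/funext => j; exact: KV_norm_gauge.
  rewrite KV_norm_gauge.
  exact: (gauge_fatou reg o kapN s1 qs crit gq0 (fun j => (f_0 j).2) f0 fcvg).
- move=> A mA [r Ar]; rewrite KV_norm_gauge.
  have r0 : (0 < `|r| + 1)%R by rewrite ltr_wpDl.
  have Ar' x : A x -> (dist o x < `|r| + 1)%R.
    move=> /Ar; rewrite -enormE => /le_lt_trans; apply.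
    by rewrite (le_lt_trans (ler_norm r))// ltrDl.
  exact: (gauge_indic_lty reg gq kapN qs mA r0 Ar').
- move=> A mA [r Ar].
  have Ar' x : A x -> (dist o x <= `|r|)%R.
    by move=> /Ar; rewrite -enormE => /le_trans; apply; exact: ler_norm.
  have [C C0 HC] := integral_le_gauge reg kapN s1 qs crit gq0 mA (normr_ge0 r) Ar'.
  exists C; split; first exact: ltW.
  by move=> f [mf f0]; rewrite KV_norm_gauge; exact: HC.
Qed.

End riesz_setting.

Unset Implicit Arguments.
Local Close Scope ereal_scope.
Local Close Scope classical_set_scope.

Theorem theorem9p2 (R : realType) (n : nat) (alpha s q : R)
    (hn : (1 <= n)%N) (hs : 1 < s)
    (halpha0 : 0 < alpha) (halpha : alpha < n%:R / s)
    (hq1 : 1 <= q) (hqs : q < s) :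
  banach_function_space (@KV_space R n alpha s q)
    (@KV_norm R n alpha s q) (@KV_norm R n alpha s q).
Proof.
have qs : 1 <= q < s by rewrite hq1 hqs.
have nrmE := KV_norm_abs hn hs halpha0 halpha qs.
split.
- exact: (KV_norm_banach hn hs halpha0 halpha qs).
- by apply/seteqP; split => f [mf fX]; split => //; [rewrite -nrmE|rewrite nrmE].
- by move=> f _; exact: nrmE.
Qed.
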